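(* Let $n\geq 7$ be a positive integer and let $q=11^s$ be a power of $11$ (with $s$ a positive integer). If $3\mid q^n-1$ and $x^n-1$ has a degree $3$ factor in $\mathbb{F}_q[x]$, then there exists a $3$-primitive element in $\mathbb{F}_{q^n}$ which is $3$-normal over $\mathbb{F}_q$.
   Context: $\mathbb{F}_{q^n}$ is the finite field with $q^n$ elements. For a divisor $r$ of $q^n-1$, an element $\alpha \in \mathbb{F}_{q^n}^*$ is $r$-primitive if its multiplicative order is $(q^n-1)/r$. An element $\alpha \in \mathbb{F}_{q^n}$ is $k$-normal over $\mathbb{F}_q$ (where $0\le k\le n-1$) if the greatest common divisor in $\mathbb{F}_{q^n}[x]$ of $x^n-1$ and $g_\alpha(x)=\sum_{i=0}^{n-1}\alpha^{q^i}x^{n-1-i}$ has degree $k$. *)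

(* Defs.v *)
From HB Require Import structures.
From mathcomp Require Import all_boot all_order all_algebra all_field.

Set Implicit Arguments.
Unset Strict Implicit.
Unset Printing Implicit Defensive.

Import GRing.Theory.
Local Open Scope ring_scope.

(* The extension F_{q^n} / F_q is modelled by a finite field F with q elements *)
(* and an arbitrary field extension L of F of degree n (a [fieldExtType F] is  *)
(* finite-dimensional over F); thus q = #|F| and n = \dim {:L}.                *)

(* [m.-primitive_root a] says that m is the least positive integer with        *)
(* a ^+ m = 1, i.e., that a is nonzero and has multiplicative order m.         *)
Definition r_primitive (F : finFieldType) (L : fieldExtType F)
    (r : nat) (a : L) : Prop :=
  (r %| #|F| ^ \dim {:L} - 1)%N
  /\ ((#|F| ^ \dim {:L} - 1) %/ r)%N.-primitive_root a.

Definition g_poly (F : finFieldType) (L : fieldExtType F) (a : L) : {poly L} :=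
  \sum_(i < \dim {:L}) a ^+ (#|F| ^ i) *: 'X^(\dim {:L} - 1 - i).

(* [gcdp] is only defined up to a nonzero scalar, which does not affect its    *)
(* degree; as 'X^n - 1 != 0, the gcd is nonzero and its degree is its size     *)
(* minus one. The bound on k excludes a = 0, for which the gcd has degree n.   *)
Definition k_normal (F : finFieldType) (L : fieldExtType F)
    (k : nat) (a : L) : Prop :=
  (k <= \dim {:L} - 1)%N
  /\ size (gcdp ('X^(\dim {:L}) - 1) (g_poly a)) = k.+1.

(* Main.v *)
Require Import Defs.
From HB Require Import structures.
From Stdlib Require BinNat Nnat Pnat.
From mathcomp Require Import all_boot all_order all_algebra all_field.
From mathcomp Require Import cyclic.
From mathcomp Require Import ring lra zify.

Set Implicit Arguments.
Unset Strict Implicit.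
Unset Printing Implicit Defensive.
Import Order.TTheory GRing.Theory Num.Theory.
Local Open Scope ring_scope.

(** Write sigma for the map x |-> x^q, put M = q^n - 1 and Q = M / (q - 1), let f be
    the given cubic factor of X^n - 1 and h = (X^n - 1) / f. A polynomial over F
    acts on L through sigma ([act]).

    An element x is 3-normal as soon as h annihilates it and h / m does not, for
    every irreducible factor m of h ([k_normal_criterion]). This condition is
    stable under scaling by the nonzero elements of F, and scaling changes the
    discrete logarithm of x by an arbitrary multiple of Q. So, with d0 = gcd(3, Q),
    it is enough to find such an x which is a d0-th power without being a d0 p-th
    power for any prime p dividing Q / d0 ([scale_to_primitive]): the primes of
    q - 1 which do not divide Q disappear from the problem.

    The elements of ker h(sigma) which are d0-th powers are then sieved by the bad
    events `x is a d0 p-th power' and `h / m annihilates x'. Any conjunction of bad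
    events says that x lies in the kernel of some (h / g)(sigma) and is a d-th
    power, and the number of such nonzero x is q^(deg (h / g)) / d up to an error
    of q^(n/2) ([count_approx]). The error term is the usual one of character sums,
    but it is obtained from a second moment of Gauss periods with rational values
    ([period_bound]), so that no character is needed.

    The sieve ([sieve_exists]) removes some events exactly, each at the cost of a
    factor 2 in the error, and the others by a union bound. Since 3 divides
    11^(s n) - 1 the exponent s n is even, and dividing by the error term leaves an
    inequality whose main term is 11^x with x = s n / 2 - 3 s ([sieve_setup]).
    Outside finitely many pairs (s, n) it holds for uniform choices of the events:
    for large n the polynomials are sieved exactly ([case_large_degree]), for large q
    and small n by the union bound ([case_union]), and for n = 7 the primes of Q are
    sparse enough ([case_degree_seven]). For most of the remaining pairs, the primes
    of Q below a bound are computed ([individual]).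

    The inequality is out of reach only for q = 11 and n = 8, 10, where x is 1 or 2.
    There an element is exhibited through its minimal polynomial, and the two
    properties are verified by computation ([explicit_witness]). *)

(** * A combinatorial sieve *)

Section Sieve.

Variables (T : finType) (I : eqType) (bad : I -> pred T) (w : I -> rat).
Variables (B : {set T}) (M E : rat) (evs : seq I).

Definition sifted (A S : seq I) :=
  [set x in B | all (bad^~ x) A && ~~ has (bad^~ x) S].

Hypothesis approx : forall A, uniq A -> {subset A <= evs} ->
  `|#|sifted A [::]|%:R - M * \prod_(i <- A) w i| <= E.

(** Sieving out one more event i is the difference of two counts which are known by
    induction, with i absent and with i imposed; this doubles the error. *)
Lemma sifted_approx A S : uniq (A ++ S) -> {subset A ++ S <= evs} ->
  `|#|sifted A S|%:R - M * \prod_(i <- A) w i * \prod_(i <- S) (1 - w i)|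
    <= 2 ^+ size S * E.
Proof.
elim: S A => [|i S IH] A uAS sAS.
  rewrite big_nil mulr1 expr0 mul1r.
  by rewrite cats0 in uAS sAS; apply: approx.
have perm : perm_eq (A ++ i :: S) (i :: A ++ S) by rewrite -cat1s perm_catCA perm_refl.
have uiAS : uniq (i :: A ++ S) by rewrite -(perm_uniq perm).
have siAS : {subset i :: A ++ S <= evs}.
  by move=> j; rewrite -(perm_mem perm); apply: sAS.
have /IH H1 : uniq (A ++ S) by case/andP: uiAS.
have {}H1 := H1 (fun j jAS => siAS j (mem_behead (s := i :: _) jAS)).
have H2 := IH (i :: A) uiAS siAS.
have splitAS : (#|sifted A S| = #|sifted A (i :: S)| + #|sifted (i :: A) S|)%N.
  rewrite -(cardsID [set x | bad i x] (sifted A S)) addnC; congr (_ + _)%N.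
    apply: eq_card => x; rewrite !inE /= negb_or.
    by case: (bad i x); rewrite ?andbF ?andbT.
  apply: eq_card => x; rewrite !inE /=.
  by case: (bad i x); rewrite ?andbF ?andbT.
move: H1 H2; rewrite splitAS natrD !big_cons /= exprS.
set a := (#|_|)%:R; set b := (#|_|)%:R; set p := \prod_(j <- A) _.
set r := \prod_(j <- S) _ => H1 H2.
have -> : a - M * p * ((1 - w i) * r) =
  (a + b - M * p * r) - (b - M * (w i * p) * r) by ring.
apply: le_trans (ler_normB _ _) _; apply: le_trans (lerD H1 H2) _.
by rewrite -mulrA mulr2n mulrDl mul1r.
Qed.

(** Events in S are removed exactly, which multiplies the error by 2 to the size of S.
    Those in U are removed by a union bound, which multiplies it by the size of U
    plus 1 only, but asks for the sum of their weights to be less than 1. *)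
Lemma sieve_exists (S U : seq I) :
  uniq (S ++ U) -> {subset S ++ U <= evs} ->
  2 ^+ size S * (1 + (size U)%:R) * E
    < M * \prod_(i <- S) (1 - w i) * (1 - \sum_(i <- U) w i) ->
  exists2 x, x \in B & forall i, i \in S ++ U -> ~~ bad i x.
Proof.
move=> uSU sSU ineq.
case: (pickP [pred x in B | ~~ has (bad^~ x) (S ++ U)]) => [x /andP[xB]|none].
  by rewrite -all_predC => /allP ok; exists x => // i /ok.
exfalso; move: ineq; apply/negP; rewrite -leNgt.
have cover : (#|sifted [::] S| <= \sum_(u <- U) #|sifted [:: u] S|)%N.
  under [leqRHS]eq_bigr do rewrite -sum1_card.
  rewrite (exchange_big_dep predT) //= -sum1_card big_mkcond /=.
  apply: leq_sum => x _.
  case: ifP => // xS; rewrite sum1_count -has_count.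
  move: (none x) xS; rewrite !inE /= has_cat => + /andP[xB xS].
  rewrite xB (negbTE xS) /= => /negbFE /hasP[u uU bu].
  by apply/hasP; exists u => //; rewrite !inE /= xB bu xS.
have H0 : M * \prod_(i <- S) (1 - w i) - 2 ^+ size S * E <= #|sifted [::] S|%:R.
  have := @sifted_approx [::] S; rewrite big_nil mulr1 => H.
  have {}H : `|#|sifted [::] S|%:R - M * \prod_(i <- S) (1 - w i)| <= 2 ^+ size S * E.
    apply: H => [|i iS]; first by move: uSU; rewrite cat_uniq => /andP[].
    by apply: sSU; rewrite mem_cat iS.
  by move: H; rewrite ler_norml; lra.
have HU : forall u, u \in U -> #|sifted [:: u] S|%:R
   <= M * \prod_(i <- S) (1 - w i) * w u + 2 ^+ size S * E.
  move=> u uU; have := @sifted_approx [:: u] S; rewrite big_seq1 => H.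
  have {}H : `|#|sifted [:: u] S|%:R - M * w u * \prod_(i <- S) (1 - w i)|
      <= 2 ^+ size S * E.
    apply: H => [|i] /=.
      move: uSU; rewrite cat_uniq => /and3P[-> /hasPn dSU _]; rewrite andbT.
      exact: dSU.
    rewrite inE => /predU1P[->|iS]; apply: sSU; rewrite mem_cat ?uU ?orbT //.
    by rewrite iS.
  by move: H; rewrite ler_norml; lra.
have HS : \sum_(u <- U) #|sifted [:: u] S|%:R <=
   M * \prod_(i <- S) (1 - w i) * \sum_(u <- U) w u + (size U)%:R * (2 ^+ size S * E).
  rewrite mulr_sumr mulr_natl -(sum1_size U) -sumrMnr -big_split /=.
  by rewrite big_seq [leRHS]big_seq; apply: ler_sum => u /HU; rewrite mulr1n.
have := cover; rewrite -(ler_nat rat) natr_sum => cov.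
lra.
Qed.
End Sieve.

(** * Equidistribution of multiplicative sets in subspaces *)

Section Equidistribution.

Variables (F : finFieldType) (L : fieldExtType F).
Local Notation K := (finvect_type L).
Local Notation q := (#|F|%:R : rat).

(** The sum of psi(y) over the nontrivial additive characters psi of F. *)
Definition delta0 (y : F) : rat := if y == 0 then q - 1 else -1.

Definition functional (phi : K -> F) :=
  forall a x y, phi (a *: x + y) = a * phi x + phi y.

Lemma functionalD phi x y : functional phi -> phi (x + y) = phi x + phi y.
Proof. by move=> lphi; rewrite -[x]scale1r lphi mul1r scale1r. Qed.

Lemma functional0 phi : functional phi -> phi 0 = 0.
Proof.
by move=> lphi; apply: (addrI (phi 0)); rewrite -functionalD // !addr0.
Qed.

Lemma functionalZ phi a x : functional phi -> phi (a *: x) = a * phi x.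
Proof. by move=> lphi; rewrite -[a *: x]addr0 lphi functional0 // addr0. Qed.

Lemma functional_mul phi b : functional phi -> functional (fun x => phi (x * b)).
Proof. by move=> lphi a x y; rewrite mulrDl -scalerAl lphi. Qed.

Lemma sum_delta0 : \sum_(y : F) delta0 y = 0.
Proof.
rewrite (bigD1 0) //= /delta0 eqxx.
under eq_bigr => y /negbTE-> do [].
rewrite sumr_const -mulr_natr (_ : #|_| = #|F|.-1).
  have := finNzRing_gt1 F; case: #|F| => // m _ /=.
  by rewrite -[m.+1]addn1 natrD; ring.
by rewrite (cardC1 (0 : F)).
Qed.

(** On each line parallel to v the factor g is constant, whereas psi takes every value
    of F exactly once, and delta0 has sum zero. *)
Lemma sum_delta0_shift (g : K -> rat) psi v : functional psi -> psi v != 0 ->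
  (forall c x, g (x + c *: v) = g x) -> \sum_x g x * delta0 (psi x) = 0.
Proof.
move=> lpsi psiv gv.
suff: q * (\sum_x g x * delta0 (psi x)) = 0.
  move/eqP; rewrite mulf_eq0 => /predU1P[/eqP|/eqP//].
  by rewrite pnatr_eq0 -leqn0 leqNgt (ltnW (finNzRing_gt1 F)).
rewrite mulr_natl -sumr_const.
rewrite (eq_bigr (fun c : F => \sum_x g x * delta0 (psi x + c * psi v))); last first.
  move=> c _; rewrite (reindex_inj (addIr (c *: v))) /=.
  by apply: eq_bigr => x _; rewrite gv functionalD // functionalZ.
rewrite exchange_big /= big1 // => x _; rewrite -mulr_sumr.
have <- : \sum_y delta0 y = \sum_(c : F) delta0 (psi x + c * psi v).
  by rewrite (reindex_inj (addrI (psi x))) (reindex_inj (mulIf psiv)).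
by rewrite sum_delta0 mulr0.
Qed.

Lemma sum_delta0_functional psi v : functional psi -> psi v != 0 ->
  \sum_x delta0 (psi x) = 0.
Proof.
move=> lpsi nz; under eq_bigr do rewrite -[delta0 _]mul1r.
exact: (@sum_delta0_shift (fun=> 1) psi v).
Qed.

Lemma sum_delta0_sqr psi v : functional psi -> psi v != 0 ->
  \sum_x delta0 (psi x) * delta0 (psi x) = (q - 1) * #|K|%:R.
Proof.
move=> lpsi nz.
rewrite (eq_bigr (fun x => (q - 2) * delta0 (psi x) + (q - 1))); last first.
  by move=> x _; rewrite /delta0; case: ifP => _; ring.
rewrite big_split /= -mulr_sumr (sum_delta0_functional lpsi nz) mulr0 add0r.
by rewrite sumr_const -[LHS]mulr_natr.
Qed.

(** Orthogonality of the twists of phi. When h' is not a multiple of h, some v is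
    annihilated by the first twist and not by the second: otherwise the two forms
    would be proportional, and so would h and h'. *)
Lemma sum_delta0_indep phi x0 h h' : functional phi -> phi x0 != 0 -> h != 0 ->
  (forall c, h' != c *: h) ->
  \sum_x delta0 (phi (x * h)) * delta0 (phi (x * h')) = 0.
Proof.
move=> lphi phix0 h0 indep.
have [v /andP[/eqP vh vh']|none] :=
  pickP [pred v | (phi (v * h) == 0) && (phi (v * h') != 0)].
  apply: (@sum_delta0_shift _ (fun x => phi (x * h')) v) => //.
    exact: functional_mul.
  by move=> c x; rewrite mulrDl -scalerAl (functionalD _ _ lphi) (functionalZ _ _ lphi) vh mulr0 addr0.
pose c := phi (x0 / h * h') / phi x0.
suff eq0 x : phi (x * (h' - c *: h)) = 0.
  have nz : h' - c *: h != 0 by rewrite subr_eq0.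
  by have /eqP := eq0 (x0 / (h' - c *: h)); rewrite divfK // (negbTE phix0).
pose y := x - (phi (x * h) / phi x0) *: (x0 / h).
have yh : phi (y * h) = 0.
  rewrite mulrBl -scalerAl divfK // -scaleNr (functionalD _ _ lphi) (functionalZ _ _ lphi).
  by rewrite mulNr divfK // subrr.
have := none y; rewrite /= yh eqxx /= => /negbFE/eqP.
rewrite /y mulrBl -scalerAl -scaleNr (functionalD _ _ lphi) (functionalZ _ _ lphi) => H.
rewrite mulrBr -scalerAr -scaleNr (functionalD _ _ lphi) (functionalZ _ _ lphi).
rewrite -[RHS]H; congr (_ + _); rewrite /c; field.
exact: phix0.
Qed.

(** The Gauss periods over H of the nontrivial additive characters of F composed with
    phi, summed over these characters. *)
Definition period (phi : K -> F) (H : {set K}) := \sum_(h in H) delta0 (phi h).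

(** Second moment. Twisting phi by an element of H leaves the period unchanged, so that
    the squares of the periods of all twists add up to at least the size of H times the
    square of this one. Expand them: by orthogonality a pair (h, h') contributes only
    when h' is an F-multiple of h, which happens at most q - 1 times for each h. *)
Lemma period_bound (phi : K -> F) (H : {set K}) x0 (E : rat) :
  functional phi -> phi x0 != 0 -> 0 \notin H ->
  {in H &, forall b h, b * h \in H} -> 0 <= E -> E ^+ 2 = #|K|%:R ->
  `|period phi H| <= (q - 1) * E.
Proof.
move=> lphi phix0 H0 HM E0 EE.
have q1 : 0 <= q - 1 by rewrite subr_ge0 ler1n (ltnW (finNzRing_gt1 F)).
have [->|/set0Pn[h0 h0H]] := eqVneq H set0.
  by rewrite /period big_set0 normr0 mulr_ge0.
have nzH h : h \in H -> h != 0 by apply: contraTneq => ->.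
pose D b := period (fun x => phi (b * x)) H.
have Dconst b : b \in H -> D b = period phi H.
  move=> bH; rewrite /period.
  have bHH : [set b * h | h in H] = H.
    apply/eqP; rewrite eqEcard card_imset ?leqnn ?andbT; last first.
      by apply: mulfI; apply: nzH.
    by apply/subsetP=> _ /imsetP[h hH ->]; apply: HM.
  rewrite -[in RHS]bHH big_imset //= => x y _ _.
  by apply: mulfI; apply: nzH.
have second : \sum_b D b ^+ 2 <= #|H|%:R * ((q - 1) * ((q - 1) * #|K|%:R)).
  rewrite (eq_bigr (fun b => \sum_(h in H) \sum_(h' in H)
     delta0 (phi (b * h)) * delta0 (phi (b * h')))); last first.
    by move=> b _; rewrite expr2 mulr_suml; under eq_bigr do rewrite mulr_sumr.
  rewrite exchange_big mulr_natl -sumr_const; apply: ler_sum => h hH.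
  rewrite exchange_big /=.
  rewrite (bigID (fun h' => h' \in [set c *: h | c in [set~ 0]])) /=.
  rewrite [X in _ + X]big1 ?addr0; last first.
    move=> h' /andP[h'H out]; apply: (sum_delta0_indep lphi phix0 (nzH _ hH)).
    move=> c; apply: contra out => /eqP eqh; apply/imsetP; exists c => //.
    rewrite !inE; apply: contraTneq h'H => c0.
    by rewrite eqh c0 scale0r.
  rewrite (eq_bigr (fun=> (q - 1) * #|K|%:R)); last first.
    move=> h' /andP[h'H /imsetP[c]]; rewrite !inE => c0 eqh.
    rewrite (eq_bigr (fun x => delta0 (phi (x * h)) * delta0 (phi (x * h)))).
      apply: (sum_delta0_sqr (psi := fun x => phi (x * h)) (v := x0 / h)).
        exact: functional_mul.
      by rewrite divfK ?nzH.
    move=> x _; congr (_ * _); rewrite /delta0 eqh -scalerAr functionalZ //.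
    by rewrite mulf_eq0 (negbTE c0).
  rewrite sumr_const -[leLHS]mulr_natl ler_wpM2r ?mulr_ge0 //.
  have -> : q - 1 = #|[set~ (0 : F)]|%:R.
    by rewrite cardsC1 -subn1 natrB // ltnW // finNzRing_gt1.
  rewrite ler_nat; apply: leq_trans (leq_imset_card (fun c => c *: h) _).
  by apply: subset_leq_card; apply/subsetP=> h' /andP[].
have {}second : #|H|%:R * period phi H ^+ 2
     <= #|H|%:R * ((q - 1) * ((q - 1) * #|K|%:R)).
  apply: le_trans second.
  rewrite mulr_natl -sumr_const [leRHS](bigID (mem H)) /=.
  rewrite -[leLHS]addr0 lerD //.
    by rewrite le_eqVlt; apply/orP; left; apply/eqP; apply: eq_bigr => b /Dconst->.
  by apply: sumr_ge0 => b _; apply: sqr_ge0.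
have Hpos : 0 < #|H|%:R :> rat by rewrite ltr0n; apply/card_gt0P; exists h0.
rewrite ler_pM2l // in second.
rewrite -ler_sqr ?nnegrE ?mulr_ge0 // -normrX ger0_norm ?sqr_ge0 //.
by rewrite exprMn EE expr2 -mulrA.
Qed.

Lemma functional_exists : exists lam : K -> F, functional lam /\ lam 1 != 0.
Proof.
pose b := vbasis {:L}; have b1 : (1 : L) \in <<b>>%VS.
  by rewrite (span_basis (vbasisP _)) memvf.
have [i ci|all0] := pickP (fun i => coord b i 1 != 0).
  by exists (coord b i); split=> // a x y; rewrite linearP.
have := coord_span b1; rewrite big1 => [/eqP|i _]; first by rewrite oner_eq0.
by move/negbFE/eqP: (all0 i) => ->; rewrite scale0r.
Qed.

(** An element x belongs to V = ker T when all the forms x |-> lam (w * T x) vanish at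
    it, and summing delta0 of these forms over w detects this. Exactly as many forms
    are identically zero as V has elements; they give the main term, and
    [period_bound] applies to each of the others. *)
Lemma kernel_equidistributed (T : K -> K) (H : {set K}) (E : rat) :
  (forall a x y, T (a *: x + y) = a *: T x + T y) -> 0 \notin H ->
  {in H &, forall b h, b * h \in H} -> 0 <= E -> E ^+ 2 = #|K|%:R ->
  `|#|K|%:R * #|[set x in H | T x == 0]|%:R - #|[set x | T x == 0]|%:R * #|H|%:R|
    <= (#|K|%:R - #|[set x | T x == 0]|%:R) * E.
Proof.
move=> lT H0 HM E0 EE; have [lam [llam lam1]] := functional_exists.
pose phi w x := lam (w * T x).
have lphi w : functional (phi w).
  by move=> a x y; rewrite /phi lT mulrDr -scalerAr llam.
have q1 : 0 < q - 1 by rewrite subr_gt0 ltr1n finNzRing_gt1.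
have K0 : 0 < #|K|%:R :> rat by rewrite ltr0n; apply/card_gt0P; exists 0.
have total x : \sum_w delta0 (phi w x) = if T x == 0 then (q - 1) * #|K|%:R else 0.
  case: ifP => [/eqP Tx|/negbT Tx].
    rewrite (eq_bigr (fun=> q - 1)) ?sumr_const ?mulr_natr // => w _.
    by rewrite /phi Tx mulr0 functional0 // /delta0 eqxx.
  apply: (@sum_delta0_functional (fun w => lam (w * T x)) (T x)^-1).
    exact: functional_mul.
  by rewrite mulVf.
have totalA (A : {set K}) : \sum_w period (phi w) A =
    #|[set x in A | T x == 0]|%:R * ((q - 1) * #|K|%:R).
  rewrite exchange_big /= (eq_bigr _ (fun x _ => total x)) -big_mkcondr /=.
  by rewrite sumr_const mulr_natl; congr (_ *+ _); apply: eq_card => x; rewrite !inE.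
pose Z := [set w | [forall x, phi w x == 0]].
have periodZ w (A : {set K}) : w \in Z -> period (phi w) A = (q - 1) * #|A|%:R.
  rewrite inE => /forallP wZ; rewrite mulr_natr -sumr_const; apply: eq_bigr => x _.
  by rewrite (eqP (wZ x)) /delta0 eqxx.
have cardZ : #|Z| = #|[set x | T x == 0]|.
  have := totalA setT; rewrite (bigID (mem Z)) /=.
  rewrite [X in _ + X]big1 ?addr0; last first.
    move=> w; rewrite inE negb_forall => /existsP[v phiv].
    by rewrite /period (eq_bigl xpredT) ?(sum_delta0_functional (lphi w) phiv) // => x; rewrite inE.
  rewrite (eq_bigr _ (fun w => @periodZ w setT)) cardsT sumr_const -[LHS]mulr_natl.
  have nz : (q - 1) * #|K|%:R != 0 by rewrite mulf_neq0 // gt_eqF.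
  move=> /(mulIf nz)/eqP; rewrite eqr_nat => /eqP->.
  by apply: eq_card => x; rewrite !inE.
have := totalA H; rewrite (bigID (mem Z)) /=.
rewrite (eq_bigr _ (fun w => @periodZ w H)) sumr_const cardZ.
rewrite -[X in X + _]mulr_natl.
set V := #|[set x | T x == 0]|%:R; set N := #|[set x in H | _]|%:R => eqN.
suff bound : `|\sum_(w | w \notin Z) period (phi w) H| <= (#|K|%:R - V) * ((q - 1) * E).
  have eqS : \sum_(w | w \notin Z) period (phi w) H =
             (q - 1) * (#|K|%:R * N - V * #|H|%:R) by lra.
  by move: bound; rewrite eqS normrM (gtr0_norm q1) mulrCA ler_pM2l.
apply: le_trans (ler_norm_sum _ _ _) _.
apply: le_trans (_ : \sum_(w | w \notin Z) (q - 1) * E <= _).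
  apply: ler_sum => w; rewrite inE negb_forall => /existsP[v phiv].
  exact: (period_bound (lphi w) phiv).
rewrite sumr_const -[leLHS]mulr_natl ler_wpM2r ?mulr_ge0 ?(ltW q1) //.
have -> : #|K|%:R - V = #|~: Z|%:R by rewrite -(cardsC Z) natrD cardZ addrAC subrr add0r.
by rewrite ler_nat; apply: subset_leq_card; apply/subsetP => w; rewrite in_setC.
Qed.

End Equidistribution.

(** * Polynomials acting through the Frobenius map *)

Section Linearized.

Variables (F : finFieldType) (L : fieldExtType F).
Local Notation K := (finvect_type L).
Local Notation q := #|F|.
Local Notation n := (\dim {:L}).

Definition frob (x : L) := x ^+ q.

Lemma card_pnat : [pchar L].-nat q.
Proof.
have [p p_pr pF] := finPcharP F; have pL : p \in [pchar L] by rewrite pchar_lalg.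
rewrite (eq_pnat _ (pcharf_eq pL)) (card_pprimeChar pF).
by rewrite pnatX pnat_id.
Qed.

Lemma frobD : {morph frob : x y / x + y}.
Proof. by move=> x y; apply: exprDn_pchar; apply: card_pnat. Qed.

Lemma frob_zmod : zmod_morphism frob.
Proof.
move=> x y; apply: (addIr (frob y)); rewrite -frobD !subrK //.
Qed.

Lemma frob_monoid : monoid_morphism frob.
Proof. by split=> [|x y]; rewrite /frob ?expr1n ?exprMn. Qed.

HB.instance Definition _ := GRing.isZmodMorphism.Build L L frob frob_zmod.
HB.instance Definition _ := GRing.isMonoidMorphism.Build L L frob frob_monoid.

Lemma frobZ c x : frob (c *: x) = c *: frob x.
Proof. by rewrite /frob exprZn expf_card. Qed.

Lemma card_K : #|K| = (q ^ n)%N.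
Proof. by rewrite -[LHS](@card_vspacef F K (Vector.class K)) card_vspace. Qed.

Lemma iter_frob i x : iter i frob x = x ^+ (q ^ i).
Proof. by elim: i => [|i IH] /=; rewrite ?expr1 // IH /frob -exprM expnSr. Qed.

Lemma frob_dim (x : L) : x ^+ (q ^ n) = x.
Proof. by rewrite -card_K; apply: (@expf_card K). Qed.

Lemma frob_fixed (x : L) : frob x = x -> exists c : F, x = c%:A.
Proof.
move=> fx; have := Fermat's_little_theorem (1%AS : {subfield L}) x.
rewrite dimv1 expn1 -/(frob x) fx eqxx => /vlineP[c ->]; by exists c.
Qed.

(** The polynomial e evaluated at the Frobenius map of L over F, applied to x. It makes L
    a module over F[X], annihilated by X^n - 1. *)
Definition act (e : {poly F}) (x : L) : L :=
  \sum_(i < size e) e`_i *: x ^+ (q ^ i).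

Lemma act_wide m (e : {poly F}) x : (size e <= m)%N ->
  act e x = \sum_(i < m) e`_i *: x ^+ (q ^ i).
Proof.
move=> le_em; rewrite /act (big_ord_widen _ (fun i => e`_i *: x ^+ (q ^ i)) le_em).
rewrite big_mkcond; apply: eq_bigr => i _.
by case: ltnP => // /(nth_default 0) ->; rewrite scale0r.
Qed.

Lemma actD e1 e2 x : act (e1 + e2) x = act e1 x + act e2 x.
Proof.
pose m := maxn (size e1) (size e2).
rewrite !(@act_wide m) ?leq_maxl ?leq_maxr ?(leq_trans (size_polyD _ _)) //.
by rewrite -big_split; apply: eq_bigr => i _; rewrite coefD scalerDl.
Qed.

Lemma actZ c e x : act (c *: e) x = c *: act e x.
Proof.
rewrite !(@act_wide (size e)) ?size_scale_leq // scaler_sumr.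
by apply: eq_bigr => i _; rewrite coefZ scalerA.
Qed.

Lemma act0 x : act 0 x = 0.
Proof. by rewrite /act size_poly0 big_ord0. Qed.

Lemma actC c x : act c%:P x = c *: x.
Proof.
by rewrite (@act_wide 1) ?size_polyC_leq1 // big_ord1 coefC eqxx expr1.
Qed.

Lemma act_frob e x : act e (frob x) = frob (act e x).
Proof.
rewrite /act rmorph_sum; apply: eq_bigr => i _.
by rewrite /= frobZ /frob -!exprM mulnC.
Qed.

Lemma actMX e x : act (e * 'X) x = frob (act e x).
Proof.
rewrite -act_frob (@act_wide (size e).+1); last first.
  by have [->|e0] := eqVneq e 0; rewrite ?mul0r ?size_poly0 // size_mulX.
rewrite big_ord_recl coefMX eqxx scale0r add0r; apply: eq_bigr => i _.
by rewrite coefMX /= /frob -exprM expnS.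
Qed.

Lemma actM e1 e2 x : act (e1 * e2) x = act e1 (act e2 x).
Proof.
elim/poly_ind: e1 => [|e1 c IH]; first by rewrite mul0r !act0.
rewrite mulrDl !actD mulrAC !actMX IH; congr (_ + _).
by rewrite mul_polyC actZ actC.
Qed.

Lemma act_linear e (c : F) x y : act e (c *: x + y) = c *: act e x + act e y.
Proof.
rewrite /act scaler_sumr -big_split; apply: eq_bigr => i _ /=.
rewrite -!iter_frob; have -> : iter i frob (c *: x + y) = c *: iter i frob x + iter i frob y.
  by elim: (i : nat) => //= j ->; rewrite frobD frobZ.
by rewrite scalerDr !scalerA mulrC.
Qed.

Lemma actX0 e : act e 0 = 0.
Proof.
rewrite /act big1 // => i _.
by rewrite expr0n gtn_eqF ?scaler0 // expn_gt0 (ltnW (finNzRing_gt1 F)).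
Qed.

Lemma act_Xn i x : act 'X^i x = x ^+ (q ^ i).
Proof.
rewrite -iter_frob; elim: i => [|i IH]; first by rewrite expr0 actC scale1r.
by rewrite exprSr actMX IH.
Qed.

Lemma act_Xn_sub1 x : act ('X^n - 1) x = 0.
Proof. by rewrite actD -scaleN1r actZ actC act_Xn frob_dim scale1r scaleN1r subrr. Qed.

Lemma act_dvd e1 e2 x : e1 %| e2 -> act e1 x = 0 -> act e2 x = 0.
Proof. by move=> /dvdpP[d ->] ex; rewrite actM ex actX0. Qed.

Lemma act_gcd e1 e2 x : act e1 x = 0 -> act e2 x = 0 -> act (gcdp e1 e2) x = 0.
Proof.
have [[u v] /= /eqp_dvdl] := Bezoutp e1 e2.
move=> eqg e1x e2x; apply: (@act_dvd (u * e1 + v * e2)); last first.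
  by rewrite actD !actM e1x e2x !actX0 addr0.
by rewrite eqg.
Qed.

(** The fibre consists of roots of a polynomial of degree q^(deg e). *)
Lemma card_fiber_le (e : {poly F}) (y : K) : e != 0 ->
  (#|[set x : K | act e x == y]| <= q ^ (size e).-1)%N.
Proof.
move=> e0; have q1 := finNzRing_gt1 F.
pose P : {poly L} := \sum_(i < size e) (e`_i)%:A *: 'X^(q ^ i) - y%:P.
have Se : (0 < size e)%N by rewrite size_poly_gt0.
have P0 : P != 0.
  apply: contraNneq e0 => P0; rewrite -lead_coef_eq0.
  have /eqP := congr1 (fun p : {poly L} => p`_(q ^ (size e).-1)) P0.
  rewrite coefB coefC gtn_eqF ?expn_gt0 ?(ltnW q1) //= subr0.
  rewrite coef_sum coef0.
  have lte : ((size e).-1 < size e)%N by rewrite prednK.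
  rewrite (bigD1 (Ordinal lte)) //= coefZ coefXn eqxx mulr1 big1 ?addr0.
    by rewrite scaler_eq0 oner_eq0 orbF.
  move=> i ni; rewrite coefZ coefXn eqn_exp2l //.
  by rewrite eq_sym (_ : (_ == _) = false) ?mulr0 //; apply/negbTE.
have sizeP : (size P <= (q ^ (size e).-1).+1)%N.
  apply: leq_trans (size_polyD _ _) _; rewrite geq_max size_polyN.
  rewrite (leq_trans (size_polyC_leq1 _)) // andbT.
  apply: leq_trans (size_sum _ _ _) _; apply/bigmax_leqP => i _.
  apply: leq_trans (size_scale_leq _ _) _; rewrite size_polyXn ltnS.
  by rewrite leq_exp2l // -ltnS prednK.
rewrite -ltnS; apply: leq_trans sizeP; rewrite cardE.
apply: (@max_poly_roots L) => //; last exact: enum_uniq.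
apply/allP=> x; rewrite (@mem_enum K) inE => /eqP exy.
rewrite rootE hornerD hornerN hornerC horner_sum -exy subr_eq0; apply/eqP.
by apply: eq_bigr => i _; rewrite hornerZ hornerXn mulr_algl.
Qed.

(** If d * e = X^n - 1, then act d sends the q^n elements of L into the kernel of act e,
    with fibres of at most q^(deg d) elements; this is the lower bound. *)
Lemma card_kernel (e : {poly F}) : e %| 'X^n - 1 ->
  #|[set x : K | act e x == 0]| = (q ^ (size e).-1)%N.
Proof.
move=> /dvdpP[d def]; have n0 : (0 < n)%N by rewrite adim_gt0.
have nz : d * e != 0 by rewrite -def -size_poly_eq0 size_XnsubC.
have [d0 e0] : d != 0 /\ e != 0 by apply/andP; rewrite -negb_or -mulf_eq0.
have sz : ((size d).-1 + (size e).-1 = n)%N.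
  have := size_XnsubC (1 : F) n0; rewrite def size_mul //.
  rewrite -!size_poly_gt0 in d0 e0; move: d0 e0; move: (size d) (size e) => a b.
  by rewrite -(prednK (_ : 0 < n)%N) //; lia.
apply/eqP; rewrite eqn_leq card_fiber_le //=.
rewrite -(leq_pmul2r (_ : 0 < q ^ (size d).-1))%N; last first.
  by rewrite expn_gt0 (ltnW (finNzRing_gt1 F)).
rewrite -expnD addnC sz -card_K.
have toker y : act e (act d y) = 0 by rewrite -actM mulrC -def act_Xn_sub1.
rewrite -[#|K|]sum1_card.
rewrite (partition_big (act d : K -> K) (mem [set x : K | act e x == 0])) /=; last first.
  by move=> y _; rewrite inE toker.
rewrite -sum_nat_const; apply: leq_sum => y _.
rewrite sum1_card; apply: leq_trans (card_fiber_le y d0).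
by apply: subset_leq_card; apply/subsetP=> x; rewrite inE.
Qed.
End Linearized.

(** * A criterion for k-normality *)

Lemma irreducible_factor_exists (F : finFieldType) (p : {poly F}) :
  (1 < size p)%N -> exists2 m, irreducible_poly m & m %| p.
Proof.
have [k] := ubnP (size p); elim: k p => // k IH p lek p1.
have p0 : p != 0 by rewrite -size_poly_gt0 ltnW.
(* Divisors of p are coded by row vectors, which form a finite type. *)
pose proper := [pred v : 'rV[F]_(size p) |
  [&& size (rVpoly v) != 1, rVpoly v %| p & ~~ (rVpoly v %= p)]].
have [v /and3P[v1 vp vNp]|none] := pickP proper.
  have v0 : rVpoly v != 0 by apply: contraNneq p0 => v0; rewrite -dvd0p -v0.
  have ltvp : (size (rVpoly v) < size p)%N.
    by rewrite ltn_neqAle dvdp_leq // (dvdp_size_eqp vp) vNp.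
  have v_gt1 : (1 < size (rVpoly v))%N by rewrite ltn_neqAle eq_sym v1 size_poly_gt0.
  have [m irr_m mv] := IH _ (leq_trans ltvp lek) v_gt1.
  by exists m => //; apply: dvdp_trans vp.
exists p => //; split=> // d d1 dp; apply: contraFT (none (poly_rV d)) => nd.
by rewrite /= poly_rV_K ?d1 ?dp // dvdp_leq.
Qed.

Section NormalCriterion.

Variables (F : finFieldType) (L : fieldExtType F).
Local Notation q := #|F|.
Local Notation n := (\dim {:L}).
Local Notation "e ^L" := (map_poly (in_alg L) e) (at level 2, format "e ^L").
Local Notation phi := (@frob F L).

Let n_gt0 : (0 < n)%N. Proof. exact: adim_gt0. Qed.

Let N0 : 'X^n - 1 != 0 :> {poly L}.
Proof. by rewrite -size_poly_eq0 size_XnsubC. Qed.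

Lemma g_poly_linear c (x y : L) : g_poly (c *: x + y) = c%:A *: g_poly x + g_poly y.
Proof.
rewrite /g_poly scaler_sumr -big_split; apply: eq_bigr => i _ /=.
have := act_linear 'X^i c x y; rewrite !act_Xn => ->.
by rewrite scalerDl scalerA mulr_algl.
Qed.

(** Modulo X^n - 1, multiplying g_a by X amounts to replacing a by its image under the
    Frobenius map. Hence a |-> g_a is a morphism of F[X]-modules. *)
Lemma g_poly_frob (a : L) : 'X * g_poly a = g_poly (phi a) + a *: ('X^n - 1).
Proof.
rewrite /g_poly mulr_sumr; have := frob_dim a; case: n n_gt0 => // m _ am.
rewrite subn1 /= big_ord_recl [in RHS]big_ord_recr /= expr1 subn0 subnn expr0.
rewrite -scalerAr -exprS scalerBr /frob -exprM -expnS am.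
rewrite addrACA subrr addr0 [RHS]addrC; congr (_ + _).
apply: eq_bigr => i _; rewrite -exprM -expnS -scalerAr -exprS.
by rewrite -[bump _ _]/(i.+1) -subSn.
Qed.

Lemma g_poly0 : g_poly (0 : L) = 0.
Proof.
rewrite /g_poly big1 // => i _.
by rewrite expr0n gtn_eqF ?scale0r // expn_gt0 (ltnW (finNzRing_gt1 F)).
Qed.

Lemma g_poly_act (e : {poly F}) (a : L) :
  'X^n - 1 %| e^L * g_poly a - g_poly (act e a).
Proof.
elim/poly_ind: e a => [|e c IH] a.
  by rewrite rmorph0 mul0r act0 g_poly0 subrr dvdp0.
rewrite rmorphD rmorphM /= map_polyX map_polyC /= actD actMX actC -act_frob.
rewrite [act e _ + _]addrC g_poly_linear.
have -> : (e^L * 'X + (in_alg L c)%:P) * g_poly a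
      - (c%:A *: g_poly a + g_poly (act e (phi a)))
    = (e^L * g_poly (phi a) - g_poly (act e (phi a))) + (a%:P * e^L) * ('X^n - 1).
  rewrite mulrDl -mulrA g_poly_frob -!mul_polyC; ring.
by rewrite dvdp_add // dvdp_mulIr.
Qed.

Lemma size_g_poly (a : L) : (size (g_poly a) <= n)%N.
Proof.
apply: leq_trans (size_sum _ _ _) _; apply/bigmax_leqP => i _.
apply: leq_trans (size_scale_leq _ _) _; rewrite size_polyXn.
by case: n n_gt0 i => // m _ i; rewrite subn1 ltnS leq_subr.
Qed.

Lemma g_poly_eq0 (a : L) : g_poly a = 0 -> a = 0.
Proof.
move=> /(congr1 (fun p : {poly L} => p`_(n - 1))); rewrite coef0 coef_sum.
rewrite (bigD1 (Ordinal n_gt0)) //= coefZ coefXn subn0 eqxx mulr1 expr1 => <-.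
rewrite big1 ?addr0 // => i i0; rewrite coefZ coefXn.
have -> : (n - 1 == n - 1 - i)%N = false.
  apply/eqP; move: i0 (ltn_ord i); rewrite -val_eqE /=; clear; lia.
by rewrite mulr0.
Qed.

(** The assumptions say that h generates the annihilator of a in F[X]. On the other hand
    write X^n - 1 = U * gcd (X^n - 1, g_a): the polynomial U generates the annihilator of
    g_a in L[X] modulo X^n - 1. Up to a scalar U is invariant under the Frobenius map,
    hence defined over F, so it divides h and is divisible by it; the degree of
    the gcd is then n - deg h. *)
Lemma k_normal_criterion k (f h : {poly F}) (a : L) :
  f * h = 'X^n - 1 -> size f = k.+1 -> (k <= n - 1)%N -> act h a = 0 ->
  (forall m, irreducible_poly m -> m %| h -> act (h %/ m) a != 0) ->
  k_normal k a.
Proof.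
move=> fh sf kn ha irr; split=> //.
have h0 : h != 0.
  have : f * h != 0 by rewrite fh -size_poly_eq0 size_XnsubC.
  by apply: contraNneq => ->; rewrite mulr0.
(* h generates the annihilator of a: a proper divisor of h which annihilates a
   would give h / m annihilating a, for an irreducible m. *)
have order e : act e a = 0 -> h %| e.
  move=> ea; have /dvdpP[w hw] := dvdp_gcdl h e.
  have [w1|w1] := leqP (size w) 1.
    have w0 : w`_0 != 0.
      by apply: contraNneq h0 => w0; rewrite hw (size1_polyC w1) w0 mul0r.
    by rewrite hw (size1_polyC w1) mul_polyC dvdpZl // dvdp_gcdr.
  have [m irr_m /dvdpP[w' ww']] := irreducible_factor_exists w1.
  have hE : h = w' * gcdp h e * m by rewrite {1}hw ww' mulrAC.
  have := irr m irr_m; rewrite {1}hE dvdp_mulIr {1}hE mulpK ?irredp_neq0 //.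
  by rewrite actM act_gcd // actX0 eqxx => /(_ isT).
set N : {poly L} := 'X^n - 1; have nzN : N != 0 := N0.
set G := g_poly a; set D := gcdp N G.
have [U NU] : exists U, N = U * D by apply/dvdpP/dvdp_gcdl.
have [G' GG'] : exists G', G = G' * D by apply/dvdpP/dvdp_gcdr.
have D0 : D != 0 by rewrite gcdp_eq0 negb_and nzN.
have coUG : coprimep U G'.
  rewrite -gcdp_eqp1 -(eqp_mul2r _ _ D0) mul1r eqp_sym.
  by have := gcdp_mul2r U G' D; rewrite -NU -GG'.
have annih v : (N %| v * G) = (U %| v).
  by rewrite NU GG' mulrA dvdp_mul2r // Gauss_dvdpl.
have U0 : U != 0 by apply: contraNneq nzN => U0; rewrite NU U0 mul0r.
pose u := (lead_coef U)^-1 *: U.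
have uU : u %= U by rewrite eqp_scale // invr_eq0 lead_coef_eq0.
have mon_u : u \is monic by rewrite monicE lead_coefZ mulVf ?lead_coef_eq0.
(* The Frobenius map sends the annihilator of g_a to that of g_(phi a), which is
   the same ideal since X is invertible modulo X^n - 1. *)
have uphi : map_poly phi u = u.
  suff dvd_u : u %| map_poly phi u.
    apply/eqP; rewrite -eqp_monic ?map_monic // eqp_sym.
    by rewrite -(dvdp_size_eqp dvd_u) size_map_poly.
  rewrite (eqp_dvdl _ uU) -annih -(@Gauss_dvdpr _ _ 'X); last first.
    by rewrite coprimepX rootE !hornerE expr0n gtn_eqF // sub0r oppr_eq0 oner_eq0.
  rewrite mulrCA g_poly_frob mulrDr dvdp_add //; last first.
    by rewrite -mul_polyC mulrA dvdp_mulIr.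
  have phiN : map_poly phi N = N.
    by rewrite rmorphB /= map_polyXn rmorph1.
  have phiG : map_poly phi G = g_poly (phi a).
    rewrite /G /g_poly rmorph_sum /=; apply: eq_bigr => i _.
    by rewrite map_polyZ map_polyXn rmorphXn.
  by rewrite -phiG -rmorphM -{1}phiN dvdp_map annih (eqp_dvdr _ uU).
have [e eu] : exists e : {poly F}, u = e^L.
  exists (\poly_(i < size u) odflt 0 [pick c : F | c%:A == u`_i]).
  apply/polyP=> i; rewrite coef_map coef_poly.
  case: ltnP => [_|/(nth_default 0) ->]; last by rewrite /= scale0r.
  have [|c ci] := @frob_fixed F L u`_i; first by rewrite -[in RHS]uphi coef_map.
  by case: pickP => [d /eqP <- //|/(_ c)]; rewrite ci eqxx.
have he : h %| e.
  apply: order; apply: g_poly_eq0; apply: contraTeq isT => nz.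
  have := size_g_poly (act e a); rewrite leqNgt => /negP; case.
  have szN : size N = n.+1 := size_XnsubC 1 n_gt0; rewrite -szN.
  apply: dvdp_leq => //; have := g_poly_act e a.
  by rewrite dvdp_subr // annih -eu (eqp_dvdr _ uU).
have hU : U %| h^L.
  rewrite -annih; have := g_poly_act h a.
  by rewrite ha g_poly0 subr0.
have sUh : size U = size h.
  apply/eqP; rewrite eqn_leq -{2}(eqp_size uU) eu size_map_poly.
  rewrite (dvdp_leq _ he) ?andbT; last first.
    by rewrite -(map_poly_eq0 (in_alg L)) -eu monic_neq0.
  by rewrite -(size_map_poly (in_alg L) h) dvdp_leq // map_poly_eq0.
have f0 : f != 0 by rewrite -size_poly_gt0 sf.
have := size_XnsubC (1 : L) n_gt0; rewrite -/N NU size_mul // sUh.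
have := size_XnsubC (1 : F) n_gt0; rewrite -fh size_mul // sf.
move: h0; rewrite -size_poly_gt0; move: (size h) (size D) => x y; clear; lia.
Qed.

End NormalCriterion.

(** * Orders of elements up to scaling by the base field *)

Lemma prime_coprime_forall (a b : nat) : (0 < b)%N ->
  (forall p, prime p -> p %| a -> p %| b -> False)%N -> coprime a b.
Proof.
move=> b0 nop; rewrite /coprime; have g0 : (0 < gcdn a b)%N by rewrite gcdn_gt0 b0 orbT.
case: (leqP (gcdn a b) 1) => [|/pdiv_prime p_pr]; first by move=> g1; rewrite eqn_leq g1.
have := pdiv_dvd (gcdn a b); rewrite dvdn_gcd => /andP[pa pb].
by case: (nop _ p_pr pa pb).
Qed.

(** If a > 0, take for j the largest divisor of M prime to a: then a prime divisor of M divides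
    exactly one of a and Q * j. *)
Lemma coprime_shift (a Q M : nat) : (0 < M)%N -> coprime a Q ->
  exists j, coprime (a + Q * j) M.
Proof.
move=> M0 aQ; case: (posnP a) => [a0|a_gt0].
  by exists 1%N; move: aQ; rewrite a0 /coprime gcd0n add0n muln1 => /eqP->; rewrite gcd1n.
exists (M`_(\pi(a)^'))%N; apply: prime_coprime_forall => // p p_pr pS pM.
have [pa|npa] := boolP (p %| a)%N.
  move: pS; rewrite dvdn_addr // Euclid_dvdM // => /orP[pQ|].
    have := dvdn_gcd p a Q; rewrite pa pQ (eqP aQ) dvdn1 => /eqP p1.
    by rewrite p1 in p_pr.
  move=> pj; have /(pnatP _ (part_gt0 _ M)) /(_ p p_pr pj) := part_pnat (\pi(a)^') M.
  by rewrite !inE /= mem_primes p_pr a_gt0 pa.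
have pj : (p %| M`_(\pi(a)^'))%N.
  have -> : (p = p`_(\pi(a)^'))%N.
    by rewrite part_pnat_id // pnatE // !inE mem_primes p_pr a_gt0 (negbTE npa).
  exact: partn_dvd.
by move: pS; rewrite dvdn_addl ?dvdn_mull // (negbTE npa).
Qed.

Definition base3 (Q : nat) := if (3 %| Q)%N then 3%N else 1%N.

(** When 3 divides Q it also divides a, and both are first divided by 3. Otherwise a
    first shift makes a a multiple of 3. *)
Lemma gcd_shift (a Q M : nat) : (0 < M)%N -> (3 %| M)%N -> (Q %| M)%N ->
  (base3 Q %| a)%N ->
  (forall p, prime p -> p %| Q %/ base3 Q -> ~~ (base3 Q * p %| a))%N ->
  exists j, gcdn (a + Q * j) M = 3%N.
Proof.
move=> M0 /dvdnP[M' defM] QM; rewrite /base3.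
have M'0 : (0 < M')%N by move: M0; rewrite defM muln_gt0 => /andP[].
have Q0 : (0 < Q)%N by apply: dvdn_gt0 M0 QM.
case: ifP => [/dvdnP[Q' defQ]|nQ3].
  move=> /dvdnP[a' defa]; rewrite defQ mulnK // => ok.
  have /(coprime_shift M'0) [j co] : coprime a' Q'.
    apply: prime_coprime_forall => [|p p_pr pa pQ].
      by move: Q0; rewrite defQ muln_gt0 => /andP[].
    by have := ok p p_pr pQ; rewrite defa mulnC dvdn_pmul2r // pa.
  exists j; rewrite defa defM -mulnA (mulnC 3%N j) mulnA -mulnDl -muln_gcdl.
  by rewrite (eqP co).
move=> _; rewrite divn1 => ok.
have co_aQ : coprime a Q.
  by apply: prime_coprime_forall => // p p_pr pa /(ok _ p_pr); rewrite mul1n pa.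
have [j0 j0P] : exists j0, (3 %| a + Q * j0)%N.
  have : (Q %% 3 = 1 \/ Q %% 3 = 2)%N by move/negbT: nQ3; rewrite /dvdn; lia.
  have : (a %% 3 = 0 \/ a %% 3 = 1 \/ a %% 3 = 2)%N by lia.
  move=> [a0|[a0|a0]] [Q1|Q1]; [exists 0%N|exists 0%N|exists 2%N|exists 1%N|exists 1%N|exists 2%N];
  by rewrite /dvdn; lia.
case/dvdnP: j0P => a1 a1E.
have /(coprime_shift M'0) [j co] : coprime a1 Q.
  apply: prime_coprime_forall => // p p_pr pa pQ.
  have : (p %| a)%N.
    by rewrite -(dvdn_addl _ (dvdn_mulr j0 pQ)) a1E dvdn_mulr.
  by move=> pa'; have := ok p p_pr pQ; rewrite mul1n pa'.
exists (j0 + j * 3)%N; rewrite mulnDr addnA a1E defM mulnA -mulnDl -muln_gcdl.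
by rewrite (eqP co).
Qed.

Section Multiplicative.

Variables (F : finFieldType) (L : fieldExtType F).
Local Notation K := (finvect_type L).
Local Notation q := #|F|.
Local Notation n := (\dim {:L}).
Local Notation M := (q ^ n - 1)%N.
Local Notation Q := (M %/ (q - 1))%N.

(** For x nonzero and d a divisor of q^n - 1, this says that x is a d-th power. *)
Definition power_residue (d : nat) (x : L) := x ^+ (M %/ d) == 1.

Lemma M_gt0 : (0 < M)%N.
Proof.
rewrite subn_gt0 -(exp1n n) ltn_exp2r ?adim_gt0 //; exact: finNzRing_gt1.
Qed.

Lemma M_div : (M = (q - 1) * Q)%N.
Proof. by rewrite mulnC divnK // !subn1 predn_exp dvdn_mulr. Qed.

Lemma unit_exp (x : L) : x != 0 -> x ^+ M = 1.
Proof.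
move=> x0; apply: (mulfI x0); rewrite -exprS mulr1 subn1 prednK; first exact: frob_dim.
by rewrite expn_gt0 (ltnW (finNzRing_gt1 F)).
Qed.

Lemma primitive_exists : exists z : L, M.-primitive_root z.
Proof.
have : has M.-primitive_root [seq x <- enum K | x != 0].
  apply: has_prim_root; first exact: M_gt0.
  - by apply/allP=> x; rewrite mem_filter unity_rootE => /andP[x0 _]; rewrite unit_exp.
  - by rewrite filter_uniq // enum_uniq.
  have -> : M = #|predC1 (0 : K)| by rewrite cardC1 card_K subn1.
  rewrite cardE; apply: (@uniq_leq_size K); first exact: enum_uniq.
  move=> x; rewrite (@mem_enum K) => x0; rewrite mem_filter; apply/andP; split=> //.
  by rewrite (@mem_enum K).
by case/hasP=> z _ zP; exists z.
Qed.

Lemma power_residue_prim (z : L) d a : M.-primitive_root z -> (d %| M)%N ->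
  power_residue d (z ^+ a) = (d %| a)%N.
Proof.
move=> zP dM; rewrite /power_residue -exprM -(prim_order_dvd zP).
have d0 := dvdn_gt0 M_gt0 dM.
have Md0 : (0 < M %/ d)%N by rewrite divn_gt0 // dvdn_leq // M_gt0.
by rewrite -{1}(divnK dM) (mulnC a) dvdn_pmul2l.
Qed.

Lemma power_residue_mul (d p p' : nat) (x : L) : (d * (p * p') %| M)%N -> x != 0 ->
  coprime p p' ->
  power_residue (d * (p * p')) x = power_residue (d * p) x && power_residue (d * p') x.
Proof.
move=> dvdM x0 co; have [z zP] := primitive_exists.
have [[i _] /= ->] := prim_rootP zP (unit_exp x0).
have d0 : (0 < d)%N by move: (dvdn_gt0 M_gt0 dvdM); rewrite muln_gt0 => /andP[].
have dpM : (d * p %| M)%N.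
  by apply: dvdn_trans dvdM; rewrite dvdn_pmul2l // dvdn_mulr.
have dp'M : (d * p' %| M)%N.
  by apply: dvdn_trans dvdM; rewrite dvdn_pmul2l // dvdn_mull.
rewrite !power_residue_prim //.
have [/dvdnP[k ->]|nd] := boolP (d %| i)%N; last first.
  have no m : (d * m %| i)%N = false.
    by apply: contraNF nd; apply: dvdn_trans; apply: dvdn_mulr.
  by rewrite !no.
by rewrite (mulnC k) !dvdn_pmul2l // Gauss_dvd.
Qed.

Lemma card_power_residue (d : nat) : (d %| M)%N ->
  #|[set x : K | (x != 0) && power_residue d (x : L)]| = (M %/ d)%N.
Proof.
move=> dM; have [z zP] := primitive_exists.
have d0 := dvdn_gt0 M_gt0 dM.
have k0 : (0 < M %/ d)%N by rewrite divn_gt0 // dvdn_leq // M_gt0.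
have yP : (M %/ d).-primitive_root (z ^+ d).
  by have := exp_prim_root zP d; rewrite (gcdn_idPl dM).
apply/eqP; rewrite eqn_leq; apply/andP; split.
  rewrite cardE; apply: (@max_unity_roots L) => //; last exact: enum_uniq.
  by apply/allP=> x; rewrite (@mem_enum K) inE unity_rootE => /andP[].
pose r (i : 'I_(M %/ d)) : K := (z ^+ d) ^+ i.
have inj_r : injective r.
  move=> i j /eqP; rewrite /r (eq_prim_root_expr yP) !modn_small // => /eqP.
  exact: val_inj.
rewrite -[X in (X <= _)%N]card_ord -(card_codom inj_r).
apply: subset_leq_card; apply/subsetP=> _ /codomP[i ->]; rewrite inE /r.
rewrite /power_residue [_ ^+ i ^+ _]exprAC (prim_expr_order yP) expr1n eqxx andbT.
rewrite expf_neq0 // expf_neq0 //; apply: contraNneq (oner_neq0 L) => z0.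
by rewrite -(prim_expr_order zP) z0 expr0n gtn_eqF // M_gt0.
Qed.

(** If z is primitive, the nonzero elements of F are the powers of z^Q, so scaling
    x = z^a replaces a by a + Q * j, and [gcd_shift] provides j. *)
Lemma scale_to_primitive (x : L) : (3 %| M)%N -> x != 0 ->
  power_residue (base3 Q) x ->
  (forall p, prime p -> (p %| Q %/ base3 Q)%N -> ~~ power_residue (base3 Q * p) x) ->
  exists2 c : F, c != 0 & (M %/ 3).-primitive_root (c *: x).
Proof.
move=> M3 x0; have [z zP] := primitive_exists.
have [[a _] /= ->] := prim_rootP zP (unit_exp x0).
have QM : (Q %| M)%N by rewrite {2}M_div dvdn_mull.
have bQ : (base3 Q %| Q)%N by rewrite /base3; case: ifP.
rewrite power_residue_prim ?(dvdn_trans bQ QM) // => ba nres.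
have [|j gcdj] := @gcd_shift a Q M M_gt0 M3 QM ba.
  move=> p p_pr pQ; have := nres p p_pr pQ; rewrite power_residue_prim //.
  apply: dvdn_trans QM; rewrite -{2}(divnK bQ) mulnC dvdn_pmul2r //.
  by rewrite /base3; case: ifP.
have z0 : z != 0.
  apply: contraNneq (oner_neq0 L) => z0.
  by rewrite -(prim_expr_order zP) z0 expr0n gtn_eqF // M_gt0.
have [c cE] : exists c : F, z ^+ (Q * j) = c%:A.
  have expE m k : (m = (q - 1) * k -> k * j * q = m * j + k * j)%N.
    move=> ->; rewrite mulnBl mul1n mulnBl subnK; first by rewrite mulnC mulnA.
    by rewrite -mulnA leq_pmull // ltnW // finNzRing_gt1.
  apply: frob_fixed; rewrite /frob -exprM (expE _ _ M_div) exprD exprM.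
  by rewrite (prim_expr_order zP) expr1n mul1r.
exists c; first by apply: contraTneq (expf_neq0 (Q * j) z0) => c0; rewrite cE c0 scale0r eqxx.
have -> : c *: z ^+ a = z ^+ (a + Q * j) by rewrite exprD cE mulr_algr.
by have := exp_prim_root zP (a + Q * j); rewrite gcdj.
Qed.

End Multiplicative.

(** * The sieve criterion *)

Definition monic_irreducible (F : finFieldType) (m : {poly F}) :=
  m \is monic /\ irreducible_poly m.

Lemma irreducible_list (F : finFieldType) (h : {poly F}) : h != 0 ->
  exists ms : seq {poly F}, [/\ uniq ms, (forall m, m \in ms -> monic_irreducible m),
    \prod_(m <- ms) m %| h
    & forall m, irreducible_poly m -> m %| h -> exists2 m', m' \in ms & m %= m'].
Proof.
have [k] := ubnP (size h); elim: k h => // k IH h lek h0.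
have [h1|h1] := leqP (size h) 1.
  exists [::]; split=> //; first by rewrite big_nil dvd1p.
  move=> m irr /dvdp_leq => /(_ h0); by rewrite leqNgt (leq_ltn_trans h1 irr.1).
have [m0 irr0 m0h] := irreducible_factor_exists h1.
have m0nz := irredp_neq0 irr0.
pose m := (lead_coef m0)^-1 *: m0.
have mm0 : m %= m0 by rewrite eqp_scale // invr_eq0 lead_coef_eq0.
have mon : m \is monic by rewrite monicE lead_coefZ mulVf ?lead_coef_eq0.
have irr : irreducible_poly m.
  split; first by rewrite (eqp_size mm0) irr0.1.
  move=> d d1 dm; apply: eqp_trans (irr0.2 d d1 _) _; last by rewrite eqp_sym.
  by rewrite -(eqp_dvdr _ mm0).
have /dvdpP[h' hE] : m %| h by rewrite (eqp_dvdl _ mm0).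
have h'0 : h' != 0 by apply: contraNneq h0 => h'0; rewrite hE h'0 mul0r.
have [||ms [ums irrms prodms allms]] := IH h' => //.
  have lt_h'h : (size h' < size h)%N.
    rewrite hE size_mul // ?(monic_neq0 mon) //.
    have := irr.1; move: h'0; rewrite -size_poly_gt0.
    by move: (size m) (size h') => a b; clear; lia.
  by apply: leq_trans lt_h'h _; rewrite -ltnS.
exists (if m \in ms then ms else m :: ms); split.
- by case: ifP => //= ->.
- by case: ifP => _ // m'; rewrite inE => /predU1P[->|/irrms].
- case: ifP => _; first by rewrite hE dvdp_mulr.
  by rewrite big_cons hE mulrC dvdp_mul.
move=> m' irr' m'h.
have [/(allms _ irr')[m'' m''ms eqm]|nd] := boolP (m' %| h').
  by exists m'' => //; case: ifP => //; rewrite inE m''ms orbT.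
exists m; first by case: ifP => // _; rewrite mem_head.
have co : coprimep m' h' by rewrite irreducible_poly_coprime.
have m'm : m' %| m by rewrite -(Gauss_dvdpr _ co) -hE.
by apply: irr.2 => //; rewrite gtn_eqF // irr'.1.
Qed.

Lemma monic_irreducible_coprime (F : finFieldType) (m m' : {poly F}) :
  monic_irreducible m -> monic_irreducible m' -> m != m' -> coprimep m m'.
Proof.
move=> [mon irr] [mon' irr']; apply: contraNT.
rewrite irreducible_poly_coprime // negbK -eqp_monic // => mm'.
by apply: irr'.2 => //; rewrite gtn_eqF // irr.1.
Qed.

Section Criterion.

Variables (F : finFieldType) (L : fieldExtType F).
Local Notation K := (finvect_type L).
Local Notation q := #|F|.
Local Notation n := (\dim {:L}).
Local Notation M := (q ^ n - 1)%N.
Local Notation Q := (M %/ (q - 1))%N.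
Local Notation d0 := (base3 Q).

(** Bezout: e is a combination of e * a and e * b. *)
Lemma act_coprime (e a b : {poly F}) (x : L) : coprimep a b ->
  act (e * a) x = 0 -> act (e * b) x = 0 -> act e x = 0.
Proof.
move=> co ax bx; apply: act_dvd (act_gcd ax bx).
rewrite (eqp_dvdl _ (gcdp_mul2l _ _ _)) -[X in _ %| X]mulr1 dvdp_mul //.
by rewrite -gcdp_eqp1 in co; rewrite (eqp_dvdl _ co).
Qed.

(** Apply [kernel_equidistributed] to the set of nonzero d-th powers. It has
    (q^n - 1) / d elements instead of q^n / d; the discrepancy is absorbed by the factor
    q^n - |V| in the error. *)
Lemma count_approx (e : {poly F}) (d : nat) (E : rat) :
  e %| 'X^n - 1 -> (d %| M)%N -> 0 <= E -> E ^+ 2 = #|K|%:R ->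
  `|#|[set x : K | [&& x != 0, power_residue d (x : L) & act e x == 0]]|%:R
     - (q ^ (size e).-1)%:R / d%:R| <= E.
Proof.
move=> eN dM E0 EE.
pose H := [set x : K | (x != 0) && power_residue d (x : L)].
have H0 : (0 : K) \notin H by rewrite inE eqxx.
have HM : {in H &, forall b h : K, b * h \in H}.
  move=> b h; rewrite !inE => /andP[b0 /eqP rb] /andP[h0 /eqP rh].
  by rewrite mulf_neq0 // /power_residue exprMn rb rh mulr1 eqxx.
have := kernel_equidistributed (T := act e : K -> K) (act_linear e) H0 HM E0 EE.
rewrite card_kernel // card_power_residue //.
have -> : [set x in H | act e x == 0] =
  [set x : K | [&& x != 0, power_residue d (x : L) & act e x == 0]].
  by apply/setP=> x; rewrite !inE andbA.
set N := #|_|%:R; set V := (q ^ _)%:R => bound.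
have d_gt0 : (0 < d)%N := dvdn_gt0 (M_gt0 L) dM.
have K0 : 0 < #|K|%:R :> rat by rewrite ltr0n; apply/card_gt0P; exists 0.
have E1 : 1 <= E.
  rewrite -(@ler_pXn2r _ 2) ?nnegrE // expr1n EE ler1n.
  by apply/card_gt0P; exists 0.
have cM : (M %/ d)%:R = (#|K|%:R - 1) / d%:R :> rat.
  have dnz : d%:R != 0 :> rat by rewrite pnatr_eq0 -lt0n.
  apply: (mulIf dnz); rewrite divfK // -natrM divnK // card_K natrB //.
  by rewrite expn_gt0 (ltnW (finNzRing_gt1 F)).
rewrite {}cM in bound.
have V0 : 0 <= V by rewrite ler0n.
have Vd : V / d%:R <= V * E.
  rewrite ler_wpM2l //; apply: le_trans E1; rewrite invf_le1 ?ltr0n //.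
  by rewrite ler1n.
rewrite -(ler_pM2l K0) -[X in X * `|_|](gtr0_norm K0) -normrM.
have -> : #|K|%:R * (N - V / d%:R) =
   (#|K|%:R * N - V * ((#|K|%:R - 1) / d%:R)) - V / d%:R.
  by field; rewrite pnatr_eq0 -lt0n.
apply: le_trans (ler_normB _ _) _.
rewrite [X in _ + X]ger0_norm ?divr_ge0 ?ler0n //.
by apply: le_trans (lerD bound Vd) _; rewrite -mulrDl subrK.
Qed.

(** An event is either a prime p dividing Q / d0, which is bad for x when x is a
    d0 p-th power, or a monic irreducible factor m of h, which is bad for x when h / m
    annihilates x. [ev_prime] and [ev_poly] give its contributions to the index of the
    power subgroup and to the divisor of h. *)
Local Notation event := (nat + {poly F})%type.

Definition ev_prime (i : event) : nat := if i is inl p then p else 1%N.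
Definition ev_poly (i : event) : {poly F} := if i is inr m then m else 1.
Definition weight (i : event) : rat :=
  match i with inl p => p%:R^-1 | inr m => (q ^ (size m).-1)%:R^-1 end.
Definition bad_event (h : {poly F}) (i : event) : pred K := fun x : L =>
  match i with
  | inl p => power_residue (d0 * p) x
  | inr m => act (h %/ m) x == 0
  end.
Definition events (ms : seq {poly F}) : seq event :=
  map inl (primes (Q %/ d0)) ++ map inr ms.

Section Events.

Variables (k : nat) (f h : {poly F}) (ms : seq {poly F}).
Hypotheses (fh : f * h = 'X^n - 1) (sf : size f = k.+1) (kn : (k <= n - 1)%N).
Hypothesis M3 : (3 %| M)%N.
Hypotheses (ums : uniq ms) (irrms : forall m, m \in ms -> monic_irreducible m).
Hypothesis prodms : \prod_(m <- ms) m %| h.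
Hypothesis allms : forall m, irreducible_poly m -> m %| h ->
  exists2 m', m' \in ms & m %= m'.

Let P (A : seq event) := (\prod_(i <- A) ev_prime i)%N.
Let G (A : seq event) : {poly F} := \prod_(i <- A) ev_poly i.

Let QM : (Q %| M)%N. Proof. by rewrite {2}(M_div L) dvdn_mull. Qed.
Let bQ : (d0 %| Q)%N. Proof. by rewrite /base3; case: ifP. Qed.
Let b_gt0 : (0 < d0)%N. Proof. by rewrite /base3; case: ifP. Qed.
Let Q_gt0 : (0 < Q)%N. Proof. exact: dvdn_gt0 (M_gt0 L) QM. Qed.
Let Q'_gt0 : (0 < Q %/ d0)%N. Proof. by rewrite divn_gt0 // dvdn_leq. Qed.
Let h0 : h != 0.
Proof.
have : f * h != 0 by rewrite fh -size_poly_eq0 size_XnsubC ?adim_gt0.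
by apply: contraNneq => ->; rewrite mulr0.
Qed.

Lemma mul_base_dvd (p : nat) : (p %| Q %/ d0)%N -> (d0 * p %| M)%N.
Proof.
by move=> pQ; apply: dvdn_trans QM; rewrite -{2}(divnK bQ) mulnC dvdn_pmul2r.
Qed.

Lemma inl_events p : (inl p \in events ms) = (p \in primes (Q %/ d0)).
Proof.
rewrite mem_cat mem_map; last by move=> x y [].
by rewrite [X in _ || X](_ : _ = false) ?orbF //; apply/negbTE/mapP=> -[].
Qed.

Lemma inr_events m : (inr m \in events ms) = (m \in ms).
Proof.
rewrite mem_cat [X in _ || X]mem_map; last by move=> x y [].
by rewrite [X in X || _](_ : _ = false) //; apply/negbTE/mapP=> -[].
Qed.

Lemma events_uniq : uniq (events ms).
Proof.
rewrite cat_uniq; apply/and3P; split.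
- by rewrite map_inj_uniq ?primes_uniq // => x y [].
- by apply/hasPn=> _ /mapP[m _ ->]; apply/mapP=> -[].
by rewrite map_inj_uniq // => x y [].
Qed.

(** A conjunction of bad events has the shape of a single one, because conditions with
    coprime parameters combine: on the multiplicative side by unique factorisation
    of exponents, on the additive side by [act_coprime]. *)
Lemma intersect_events (A : seq event) : uniq A -> {subset A <= events ms} ->
  [/\ (P A %| Q %/ d0)%N, G A %| h,
      (forall p, prime p -> inl p \notin A -> coprime p (P A)),
      (forall m, m \in ms -> inr m \notin A -> coprimep m (G A))
    & forall x : L, x != 0 ->
        [&& power_residue d0 x, act h x == 0 & all ((bad_event h)^~ x) A]
        = power_residue (d0 * P A) x && (act (h %/ G A) x == 0)].
Proof.
elim: A => [|i A IH].
  rewrite /P /G !big_nil; split=> //.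
  - exact: dvd1p.
  - by move=> p _ _; apply: coprimen1.
  - by move=> m _ _; rewrite coprimep1.
  by move=> x x0; rewrite /= andbT divp1 muln1.
case/andP=> iA uA sA; have {}IH := IH uA (fun j jA => sA j (mem_behead (s := i :: A) jA)).
case: IH => PQ Gh coP coG eqA; have iE := sA i (mem_head _ _).
rewrite /P /G !big_cons -/(P A) -/(G A).
case: i iE iA {sA} => [p|m] /= iE iA.
  rewrite inl_events mem_primes in iE; case/and3P: iE => p_pr _ pQ.
  have copP := coP p p_pr iA.
  rewrite mul1r; split=> //.
  - by rewrite Gauss_dvd // pQ.
  - move=> p' p'_pr; rewrite inE negb_or => /andP[p'p p'A].
    rewrite coprimeMr (coP p') // andbT prime_coprime // dvdn_prime2 //.
  move=> x x0; rewrite power_residue_mul //; last first.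
    by apply: mul_base_dvd; rewrite Gauss_dvd // pQ.
  rewrite -andbA -eqA // !andbA; case: (power_residue (d0 * p) x); rewrite ?andbF ?andbT //.
have mms : m \in ms by rewrite -inr_events.
have comG := coG m mms iA.
have mh : m %| h.
  by apply: dvdp_trans prodms; rewrite (big_rem m mms) dvdp_mulr.
have mGh : m * G A %| h by rewrite Gauss_dvdp // mh.
rewrite mul1n; split=> //.
- move=> m' m'ms; rewrite inE negb_or => /andP[m'm m'A].
  rewrite coprimepMr coG // andbT monic_irreducible_coprime //; try exact: irrms.
move=> x x0; have {}eqA := eqA x x0; case/dvdpP: mGh => e hE.
have m0 : m != 0 := irredp_neq0 (irrms mms).2.
have G0 : G A != 0.
  by apply: contraNneq h0 => G0; rewrite hE G0 !mulr0.
have em : h %/ m = e * G A by rewrite hE mulrCA mulrC mulpK.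
have eG : h %/ G A = e * m by rewrite hE mulrA mulpK.
have eE : h %/ (m * G A) = e by rewrite hE mulpK ?mulf_neq0.
rewrite eE; move: eqA; rewrite eG em.
set a := act (e * m) x; set b := act (e * G A) x; set c := act e x.
have -> : (c == 0) = (a == 0) && (b == 0).
  apply/eqP/andP=> [c0|[/eqP a0 /eqP b0]]; last exact: act_coprime a0 b0.
  by split; apply/eqP; apply: act_dvd c0; apply: dvdp_mulr.
move=> eqA'; rewrite [RHS]andbA -eqA' -!andbA.
by case: power_residue; case: (act h x == 0); case: (b == 0); rewrite ?andbF ?andbT.
Qed.

Lemma prod_weight (A : seq event) : G A != 0 ->
  \prod_(i <- A) weight i = (P A * q ^ (size (G A)).-1)%:R^-1.
Proof.
elim: A => [|i A IH].
  by rewrite /P /G !big_nil size_poly1 expn0 invr1.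
rewrite /P /G !big_cons -/(P A) -/(G A) mulf_eq0 negb_or => /andP[i0 A0].
rewrite IH //; case: i i0 => [p|m] /= m0; rewrite -invfM -natrM; congr (_%:R^-1).
  by rewrite mul1r mulnA.
rewrite mul1n size_mul // mulnCA -expnD; congr (_ * q ^ _)%N.
by move: m0 A0; rewrite -!size_poly_gt0; move: (size m) (size (G A)) => a b; clear; lia.
Qed.

(** The sieve applies with the counts of [count_approx] as densities. The element found
    is then scaled to the right order, which preserves the additive conditions. *)
Lemma sieve_criterion (S U : seq event) (E : rat) :
  perm_eq (S ++ U) (events ms) -> 0 <= E -> E ^+ 2 = #|K|%:R ->
  2 ^+ size S * (1 + (size U)%:R) * E <
    (q ^ (size h).-1)%:R / d0%:R
      * \prod_(i <- S) (1 - weight i) * (1 - \sum_(i <- U) weight i) ->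
  exists2 a : L, (M %/ 3).-primitive_root a & k_normal k a.
Proof.
move=> permSU E0 EE ineq.
pose B := [set x : K | [&& x != 0, power_residue d0 (x : L) & act h x == 0]].
have memSU i : (i \in S ++ U) = (i \in events ms) by rewrite (perm_mem permSU).
have [||x||x xB good] := @sieve_exists K event (bad_event h) weight B
    ((q ^ (size h).-1)%:R / d0%:R) E (events ms) _ S U.
- move=> A uA sA; have [PQ Gh _ _ eqA] := intersect_events uA sA.
  have G0 : G A != 0 by apply: contraNneq h0 => G0; move: Gh; rewrite G0 dvd0p.
  have -> : sifted (bad_event h) B A [::] = [set x : K |
     [&& x != 0, power_residue (d0 * P A) (x : L) & act (h %/ G A) x == 0]].
    apply/setP=> x; rewrite !inE /= andbT -andbA.
    by have [//|x0] := eqVneq x 0; rewrite /= -eqA // andbA.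
  have -> : (q ^ (size h).-1)%:R / d0%:R * \prod_(i <- A) weight i =
     (q ^ (size (h %/ G A)).-1)%:R / (d0 * P A)%:R.
    have -> : (q ^ (size h).-1 = q ^ (size (h %/ G A)%R).-1 * q ^ (size (G A)).-1)%N.
      rewrite -expnD; congr (_ ^ _)%N; rewrite size_divp //.
      have := dvdp_leq h0 Gh; move: G0; rewrite -size_poly_gt0.
      by move: (size h) (size (G A)) => a b; clear; lia.
    have nzR m : (0 < m)%N -> m%:R != 0 :> rat by rewrite pnatr_eq0 -lt0n.
    rewrite prod_weight // !natrM; field; rewrite !nzR //.
      by rewrite expn_gt0 (ltnW (finNzRing_gt1 F)).
    exact: dvdn_gt0 Q'_gt0 PQ.
  apply: count_approx => //; last exact: mul_base_dvd.
  apply: dvdp_trans (_ : h %| _); last by rewrite -fh dvdp_mull.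
  by rewrite -{2}(divpK Gh) dvdp_mulr.
- by rewrite (perm_uniq permSU) events_uniq.
- by rewrite memSU.
- exact: ineq.
have /[!inE] /and3P[x0 rx /eqP hx] := xB.
have [p p_pr pQ|c c0 prim] := scale_to_primitive M3 x0 rx.
  have /good : inl p \in S ++ U.
    by rewrite memSU inl_events mem_primes p_pr Q'_gt0.
  exact.
exists (c *: (x : L)) => //.
have hcx e : act e (c *: (x : L)) = c *: act e x.
  by rewrite -[c *: (x : L)]addr0 act_linear actX0 addr0.
apply: (k_normal_criterion fh sf kn); first by rewrite hcx hx scaler0.
move=> m irr mh; have [m' m'ms mm'] := allms irr mh.
have /good /= : inr m' \in S ++ U by rewrite memSU inr_events.
rewrite hcx scaler_eq0 negb_or c0 /=; apply: contraNneq => mx.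
apply/eqP; apply: act_dvd mx.
have m'h : m' %| h by rewrite -(eqp_dvdl _ mm').
rewrite -(@dvdp_mul2r _ m') ?(irredp_neq0 (irrms m'ms).2) // divpK //.
by rewrite -{2}(divpK mh) dvdp_mul // (eqp_dvdr _ mm').
Qed.

End Events.
End Criterion.

(** * A numerical form of the criterion *)

Lemma prod_primes_dvd (m : nat) (ps : seq nat) : uniq ps ->
  (forall p, p \in ps -> prime p && (p %| m))%N -> (\prod_(p <- ps) p %| m)%N.
Proof.
elim: ps => [|p ps IH] /=; first by rewrite big_nil dvd1n.
case/andP=> pps ups ok; rewrite big_cons.
have /andP[p_pr pm] := ok p (mem_head _ _).
rewrite Gauss_dvd ?pm ?IH // => [r rps|]; first by apply: ok; rewrite inE rps orbT.
rewrite big_seq; apply big_ind => [|a b|r rps]; first exact: coprimen1.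
  by move=> pa pb; rewrite coprimeMr pa.
have /andP[r_pr _] := ok r (mem_behead (s := p :: _) rps).
rewrite prime_coprime // dvdn_prime2 //; by apply: contraNneq pps => ->.
Qed.

(** The density 1 - 1/p which remains after sieving by p, divided by the factor 2 which
    sieving it exactly costs in the error. *)
Definition half_loss (p : nat) : rat := (1 - p%:R^-1) / 2.

Lemma half_loss_itv p : (0 < p)%N -> 0 <= half_loss p <= 1.
Proof.
move=> p0; rewrite /half_loss.
have : 0 <= (p%:R^-1 : rat) <= 1 by rewrite invr_ge0 ler0n invf_le1 ?ltr0n // ler1n.
by case/andP; lra.
Qed.

Lemma prod_subset_ge (T : eqType) (w : T -> rat) (A B : seq T) :
  uniq A -> uniq B -> {subset A <= B} -> (forall b, b \in B -> 0 <= w b <= 1) ->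
  \prod_(b <- B) w b <= \prod_(a <- A) w a.
Proof.
move=> uA uB sAB wb; rewrite (bigID (mem A)) /= -big_filter.
have -> : \prod_(a <- A) w a = \prod_(b <- [seq b <- B | b \in A]) w b.
  apply/perm_big/uniq_perm => [||x] //; first exact: filter_uniq.
  by rewrite mem_filter; case: (boolP (x \in A)) => // /sAB ->.
rewrite -[leRHS]mulr1 ler_wpM2l //.
  rewrite big_seq prodr_ge0 // => b; rewrite mem_filter => /andP[_ /wb].
  by case/andP.
by rewrite big_seq_cond prodr_ile1 // => b /andP[/wb].
Qed.

Lemma sum_subset_le (T : eqType) (w : T -> rat) (A B : seq T) :
  uniq A -> uniq B -> {subset A <= B} -> (forall b, 0 <= w b) ->
  \sum_(a <- A) w a <= \sum_(b <- B) w b.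
Proof.
move=> uA uB sAB wb; rewrite [leRHS](bigID (mem A)) /= -[X in _ <= X + _]big_filter.
have -> : \sum_(a <- A) w a = \sum_(b <- [seq b <- B | b \in A]) w b.
  apply/perm_big/uniq_perm => [||x] //; first exact: filter_uniq.
  by rewrite mem_filter; case: (boolP (x \in A)) => // /sAB ->.
by rewrite lerDl sumr_ge0.
Qed.

(** Sieving data for the primes of m: the list ls for those which are sieved exactly, us
    for known ones left to the union bound, and t bounding the number of all others,
    since they are at least B. *)
Definition prime_data (m : nat) (ls us : seq nat) (B t : nat) :=
  [/\ uniq ls, uniq us, all (leq 1) ls, ((1 < B) && (m < B ^ t.+1))%N
    & forall p, prime p -> (p %| m)%N -> (p < B)%N -> p \in ls ++ us].

(** The lists may contain numbers which do not divide m, or are not prime: these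
    only worsen the bounds. *)
Lemma prime_data_bounds m ls us B t : (0 < m)%N -> prime_data m ls us B t ->
  [/\ \prod_(p <- ls) half_loss p <= \prod_(p <- [seq p <- primes m | p \in ls]) half_loss p,
   (size [seq p <- primes m | p \notin ls] <= size us + t)%N
   & \sum_(p <- [seq p <- primes m | p \notin ls]) p%:R^-1
     <= \sum_(p <- us) p%:R^-1 + t%:R / B%:R :> rat].
Proof.
move=> m0 [uls uus /allP ls0 /andP[B1 mB] cover]; pose r := [seq p <- primes m | p \notin ls].
pose r1 := [seq p <- r | (p < B)%N]; pose r2 := [seq p <- r | ~~ (p < B)%N].
have ur : uniq r by rewrite filter_uniq ?primes_uniq.
have memr p : p \in r -> [/\ prime p, (p %| m)%N & p \notin ls].
  by rewrite mem_filter mem_primes => /andP[-> /and3P[-> _ ->]].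
have sr1 : {subset r1 <= us}.
  move=> p; rewrite mem_filter => /andP[pB /memr[p_pr pm nls]].
  by have := cover p p_pr pm pB; rewrite mem_cat (negbTE nls).
have c2 : (size r2 <= t)%N.
  rewrite -ltnS -(ltn_exp2l _ _ B1); apply: leq_ltn_trans mB.
  apply: leq_trans (_ : \prod_(p <- r2) p <= m)%N; last first.
    apply/dvdn_leq/prod_primes_dvd => // [|p]; first by rewrite !filter_uniq ?primes_uniq.
    by rewrite mem_filter => /andP[_ /memr[-> -> _]].
  have : all (leq B) r2 by apply/allP=> p; rewrite mem_filter -leqNgt => /andP[].
  elim: (r2) => [|p ps IH] /=; first by rewrite big_nil.
  by case/andP=> Bp /IH; rewrite big_cons expnS; apply: leq_mul.
have permr : perm_eq r (r1 ++ r2) by rewrite perm_sym perm_filterC.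
split.
- apply: prod_subset_ge => //.
  + by rewrite filter_uniq ?primes_uniq.
  + by move=> p; rewrite mem_filter => /andP[].
  by move=> p /ls0; apply: half_loss_itv.
- rewrite (perm_size permr) size_cat leq_add // uniq_leq_size //.
  by rewrite !filter_uniq ?primes_uniq.
rewrite (perm_big _ permr) big_cat /= lerD //.
  apply: sum_subset_le => // [|p]; last by rewrite invr_ge0 ler0n.
  by rewrite !filter_uniq ?primes_uniq.
apply: le_trans (_ : \sum_(p <- r2) B%:R^-1 <= _).
  rewrite big_seq [leRHS]big_seq; apply: ler_sum => p.
  rewrite mem_filter -leqNgt => /andP[Bp _].
  have B0 : (0 < B)%N := ltnW B1.
  by rewrite lef_pV2 ?posrE ?ltr0n ?ler_nat // (leq_trans B0).
rewrite big_const_seq count_predT iter_addr_0 -[leLHS]mulr_natl.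
by rewrite ler_wpM2r ?invr_ge0 ?ler0n // ler_nat.
Qed.

Lemma prod_ge_exp (T : eqType) (c : rat) (w : T -> rat) (A : seq T) : 0 <= c ->
  (forall a, a \in A -> c <= w a) -> c ^+ size A <= \prod_(a <- A) w a.
Proof.
move=> c0; elim: A => [|a A IH] wA; first by rewrite big_nil.
rewrite big_cons exprS ler_pM ?exprn_ge0 ?wA ?mem_head // IH // => b bA.
by rewrite wA // inE bA orbT.
Qed.

Lemma expo_identity (n s x : nat) : (4 <= n)%N -> (s * n = 2 * (x + 3 * s))%N ->
  (s * (n - 2).-1 = x + (x + 3 * s))%N.
Proof.
move=> n4; have {1}-> : (n = (n - 2).-1 + 3)%N by lia.
by rewrite mulnDr; lia.
Qed.

Lemma main_term_mono (X d d' c c' w w' : rat) (u : nat) : 0 <= X -> 0 < d' -> d' <= d ->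
  0 <= c -> c <= c' -> w <= w' -> u%:R < X / d * c * w -> u%:R < X / d' * c' * w'.
Proof.
move=> X0 d'0 dd' c0 cc' ww' ineq.
have d0 : 0 < d := lt_le_trans d'0 dd'.
have Xd0 : 0 <= X / d * c by rewrite !mulr_ge0 // invr_ge0 ltW.
have w0 : 0 <= w.
  rewrite leNgt; apply/negP => wlt0; move: (le_lt_trans (ler0n _ u) ineq).
  by rewrite ltNge mulr_ge0_le0 // ltW.
apply: lt_le_trans ineq _; apply: ler_pM => //; apply: ler_pM => //.
  by rewrite mulr_ge0 // invr_ge0 ltW.
by rewrite ler_wpM2l // lef_pV2.
Qed.

Lemma le_5_11 (rho : rat) : rho <= 5 / 11 -> rho <= 1.
Proof. lra. Qed.

Lemma half_ge (rho w : rat) : rho <= 5 / 11 -> 0 <= w <= 11^-1 -> rho <= (1 - w) / 2.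
Proof. lra. Qed.

(** T is the power of 2 lost in the error, absorbed in c by halving its factors. *)
Lemma sieve_rescale (T E X d c w u : rat) : 0 < T -> 0 < E ->
  1 + u < X / d * c * w -> T * (1 + u) * E < X * E / d * (T * c) * w.
Proof.
move=> T0 E0 ineq; have TE : 0 < T * E by rewrite mulr_gt0.
have -> : T * (1 + u) * E = T * E * (1 + u) by ring.
have -> : X * E / d * (T * c) * w = T * E * (X / d * c * w) by ring.
by rewrite ltr_pM2l.
Qed.

Section Numeric.

Variables (F : finFieldType) (L : fieldExtType F).
Local Notation K := (finvect_type L).
Local Notation q := #|F|.
Local Notation n := (\dim {:L}).
Local Notation M := (q ^ n - 1)%N.
Local Notation Q := (M %/ (q - 1))%N.
Local Notation d0 := (base3 Q).

(** What has to be known of the distinct monic irreducible factors of h, whichever cubic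
    factor of X^n - 1 is removed: their number and the sum of their weights. *)
Definition factor_bound (b : nat) (sigma : rat) :=
  forall (h : {poly F}) (ms : seq {poly F}), h %| 'X^n - 1 -> size h = (n - 2)%N ->
    uniq ms -> (forall m, m \in ms -> monic_irreducible m) ->
    \prod_(m <- ms) m %| h ->
    (size ms <= b)%N /\ \sum_(m <- ms) ((q ^ (size m).-1)%:R^-1 : rat) <= sigma.

(** The criterion after division by the error term E = 11^(x + 3 s) and by the power of 2
    coming from the exact events, which is distributed over the factors of the product.
    The polynomials are sieved exactly or left to the union bound, according
    to exact_polys; their weights are at most 1/11, so (1 - w) / 2 is at least 5/11. *)
Lemma sieve_setup (d : nat) (ls us : seq nat) (B t : nat) (s x b : nat) (sigma rho : rat)
    (exact_polys : bool) :
  q = (11 ^ s)%N -> (s * n = 2 * (x + 3 * s))%N -> (4 <= n)%N -> (3 %| M)%N ->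
  (exists p : {poly F}, size p = 4%N /\ p %| 'X^n - 1) ->
  (d0 <= d)%N -> prime_data (Q %/ d0) ls us B t -> factor_bound b sigma ->
  0 <= rho <= 5 / 11 ->
  (1 + size us + t + (if exact_polys then 0 else b))%:R <
    11 ^+ x / d%:R * (\prod_(p <- ls) half_loss p)
    * (if exact_polys then rho ^+ b else 1)
    * (1 - \sum_(p <- us) p%:R^-1 - t%:R / B%:R - (if exact_polys then 0 else sigma)) ->
  exists a : L, r_primitive 3 a /\ k_normal 3 a.
Proof.
move=> qE sn n4 M3 [f [sf /dvdpP[h hE]]] d0d pd fb /andP[rho0 rho_le] ineq.
have fh : f * h = 'X^n - 1 by rewrite hE mulrC.
have N0 : 'X^n - 1 != 0 :> {poly F} by rewrite -size_poly_eq0 size_XnsubC ?adim_gt0.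
have h0 : h != 0 by apply: contraNneq N0 => h0; rewrite -fh h0 mulr0.
have f0 : f != 0 by rewrite -size_poly_gt0 sf.
have sh : size h = (n - 2)%N.
  have := size_XnsubC (1 : F) (leq_trans (isT : 0 < 4)%N n4); rewrite -fh size_mul // sf.
  by move: (size h) => a; clear; lia.
have [ms [ums irrms prodms allms]] := irreducible_list h0.
have [] := fb h ms _ sh ums irrms prodms; first by rewrite -fh dvdp_mull.
move=> msb mssig.
have Q_gt0 : (0 < Q)%N.
  by move: (M_gt0 L); rewrite {1}(M_div L) muln_gt0 => /andP[].
have d0_gt0 : (0 < d0)%N by rewrite /base3; case: ifP.
have Q'_gt0 : (0 < Q %/ d0)%N.
  by rewrite divn_gt0 // dvdn_leq // /base3; case: ifP.
have [boundS sizeU boundU] := prime_data_bounds Q'_gt0 pd.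
set p1 := [seq p <- primes (Q %/ d0) | p \in ls] in boundS.
set p2 := [seq p <- primes (Q %/ d0) | p \notin ls] in sizeU boundU.
pose S : seq (nat + {poly F}) := map inl p1 ++ if exact_polys then map inr ms else [::].
pose U : seq (nat + {poly F}) := map inl p2 ++ if exact_polys then [::] else map inr ms.
have permSU : perm_eq (S ++ U) (events L ms).
  have perm12 : perm_eq (map inl p1 ++ map inl p2 : seq (nat + {poly F}))
                        (map inl (primes (Q %/ d0))).
    by rewrite -map_cat perm_map // perm_filterC.
  rewrite /S /U /events; case: (exact_polys).
    rewrite cats0 perm_catAC perm_cat2r; exact: perm12.
  by rewrite cats0 catA perm_cat2r; exact: perm12.
pose E : rat := (11 ^ (x + 3 * s))%:R.
have E0 : 0 < E by rewrite ltr0n expn_gt0.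
have EE : E ^+ 2 = #|K|%:R by rewrite /E -natrX -expnM card_K qE -expnM sn mulnC.
have qE2 : (q ^ (size h).-1)%:R = 11 ^+ x * E :> rat.
  rewrite /E -natrX -natrM -expnD qE -expnM; congr (11 ^ _)%:R.
  by rewrite sh (expo_identity n4 sn).
clearbody E.
have sieve := @sieve_criterion F L 3 f h ms fh sf _ M3 ums irrms prodms allms S U E
  permSU (ltW E0) EE.
have n3 : (3 <= n - 1)%N by rewrite leq_subRL // ltnW // ltnW // ltnW.
have [|a prim norm] := sieve n3; last by exists a; split; first split.
pose c := \prod_(i <- S) ((1 - weight i) / 2).
have -> : \prod_(i <- S) (1 - weight i) = 2 ^+ size S * c.
  rewrite /c; elim: (S) => [|i A IH]; first by rewrite !big_nil mulr1.
  by rewrite !big_cons IH exprS; field.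
rewrite qE2.
suff main : (1 + size U)%:R < 11 ^+ x / d0%:R * c * (1 - \sum_(i <- U) weight i).
  by rewrite natrD in main; apply: sieve_rescale; rewrite ?exprn_gt0.
have q11 : (11 <= q)%N.
  have := finNzRing_gt1 F; rewrite qE; case: (s) => // r _.
  by rewrite -{1}[11%N]expn1 leq_pexp2l.
have weight_ms m : m \in ms -> 0 <= (weight (inr m : nat + {poly F})) <= 11^-1.
  move=> /irrms[_ irr]; rewrite /= invr_ge0 ler0n /=.
  rewrite lef_pV2 ?posrE ?ltr0n ?expn_gt0 ?(leq_trans _ q11) // ler_nat.
  apply: leq_trans q11 _; rewrite -{1}[q]expn1 leq_pexp2l ?(leq_trans _ q11) //.
    exact: ltnW (finNzRing_gt1 F).
  by case: (size m) irr.1 => [|[]].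
have half0 : 0 <= \prod_(p <- p1) half_loss p.
  rewrite big_seq prodr_ge0 // => p; rewrite mem_filter mem_primes.
  by case/andP=> _ /and3P[/prime_gt0/half_loss_itv/andP[]].
have ls0 : 0 <= \prod_(p <- ls) half_loss p.
  have [_ _ /allP lsp _ _] := pd; rewrite big_seq prodr_ge0 // => p /lsp.
  by move/half_loss_itv/andP => [].
have [Sbound Usize Usum] : [/\
    (\prod_(p <- ls) half_loss p) * (if exact_polys then rho ^+ b else 1) <= c,
    (1 + size U <= 1 + size us + t + if exact_polys then 0 else b)%N &
    1 - \sum_(p <- us) p%:R^-1 - t%:R / B%:R - (if exact_polys then 0 else sigma)
      <= 1 - \sum_(i <- U) weight i].
  rewrite /c /S /U; case: (exact_polys); rewrite ?cats0 ?size_cat ?size_map ?big_cat ?big_map /=.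
    split.
    + apply: (ler_pM ls0 (exprn_ge0 b rho0) boundS).
      apply: le_trans (ler_wiXn2l rho0 (le_5_11 rho_le) msb) _.
      by apply: (prod_ge_exp rho0) => m /weight_ms; apply: (half_ge rho_le).
    + by rewrite !addn0 -addnA leq_add2l.
    + by rewrite subr0 -addrA -opprD lerD2l lerN2.
  rewrite ?big_nil ?mulr1; split=> //.
  + by rewrite addnA -!addnA leq_add2l addnA leq_add.
  + by rewrite -!addrA -!opprD addrA lerD2l lerN2 lerD.
have := Usize; rewrite -(ler_nat rat) => /le_lt_trans; apply.
rewrite -[X in X * (1 - _ - _ - _)]mulrA in ineq.
apply: (main_term_mono _ _ _ _ _ Usum ineq); rewrite ?ltr0n ?ler_nat //.
  by rewrite exprn_ge0.
by rewrite mulr_ge0 //; case: (exact_polys) => //; rewrite exprn_ge0.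
Qed.

End Numeric.

(** * Irreducible factors of X^n - 1 *)

Lemma size_prod_monic (R : idomainType) (ms : seq {poly R}) :
  (forall m, m \in ms -> m \is monic) ->
  size (\prod_(m <- ms) m) = (\sum_(m <- ms) (size m).-1).+1.
Proof.
elim: ms => [|m ms IH] mon; first by rewrite !big_nil size_poly1.
have mon_m := mon m (mem_head _ _).
have {}mon m' : m' \in ms -> m' \is monic by move=> m'ms; apply: mon; rewrite inE m'ms orbT.
rewrite !big_cons size_monicM //; last first.
  by apply: monic_neq0; rewrite big_seq; apply: monic_prod.
rewrite IH // addnS /=; move: (monic_neq0 mon_m); rewrite -size_poly_gt0.
by case: (size m).
Qed.

(** The left-hand side increases when degree-two factors are traded for linear ones, so
    the worst case has as many linear factors as possible. *)
Lemma linear_weight_arith (a r g N : nat) (q : rat) : (a + r * 2 <= N)%N -> (a <= g)%N ->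
  1 <= q -> a%:R / q + r%:R / q ^+ 2 <= g%:R / q + (N%:R - g%:R) / (2 * q ^+ 2).
Proof.
move=> aN ag q1; have q0 : 0 < q by apply: lt_le_trans q1.
have i1 : q^-1 <= 1 by rewrite invf_le1.
have i0 : 0 < q^-1 by rewrite invr_gt0.
have -> : (2 * q ^+ 2)^-1 = 2^-1 * q^-1 ^+ 2 by field; rewrite gt_eqF.
rewrite -exprVn; set i := q^-1 in i0 i1 *.
have aN' : a%:R + r%:R * 2 <= N%:R :> rat by rewrite -natrM -natrD ler_nat.
have ag' : a%:R <= g%:R :> rat by rewrite ler_nat.
have i2 : i ^+ 2 <= i by rewrite expr2 -[leRHS]mulr1 ler_pM2l.
have i20 : 0 <= i ^+ 2 by rewrite exprn_ge0 // ltW.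
have h1 : 0 <= (N%:R - a%:R - r%:R * 2) * i ^+ 2 by rewrite mulr_ge0 //; lra.
have h2 : 0 <= (g%:R - a%:R) * (i - i ^+ 2 / 2) by rewrite mulr_ge0 //; lra.
have -> : g%:R * i + (N%:R - g%:R) * (2^-1 * i ^+ 2) =
  a%:R * i + r%:R * i ^+ 2 + (N%:R - a%:R - r%:R * 2) * i ^+ 2 / 2
  + (g%:R - a%:R) * (i - i ^+ 2 / 2) by field.
by lra.
Qed.

Section FactorBound.

Variables (F : finFieldType) (L : fieldExtType F).
Local Notation q := #|F|.
Local Notation n := (\dim {:L}).

Lemma factor_degrees (h : {poly F}) (ms : seq {poly F}) :
  h != 0 -> (forall m, m \in ms -> monic_irreducible m) ->
  \prod_(m <- ms) m %| h -> (\sum_(m <- ms) (size m).-1 < size h)%N.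
Proof.
move=> h0 irr /(dvdp_leq h0); rewrite size_prod_monic // => m /irr[]//.
Qed.

Lemma weight_le (m : {poly F}) (k : nat) : (k <= (size m).-1)%N ->
  (q ^ (size m).-1)%:R^-1 <= q%:R^-1 ^+ k :> rat.
Proof.
move=> km; rewrite exprVn -natrX.
rewrite lef_pV2 ?posrE ?ltr0n ?expn_gt0 ?(ltnW (finNzRing_gt1 F)) // ler_nat.
by rewrite leq_pexp2l // ltnW // finNzRing_gt1.
Qed.

Lemma factor_bound_trivial : factor_bound L (n - 3) ((n - 3)%:R / q%:R).
Proof.
move=> h ms hN sh ums irr dvd.
have h0 : h != 0.
  by apply: contraTneq hN => ->; rewrite dvd0p -size_poly_eq0 size_XnsubC ?adim_gt0.
have := factor_degrees h0 irr dvd; rewrite sh => degs.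
have sz : (size ms <= \sum_(m <- ms) (size m).-1)%N.
  rewrite -sum1_size big_seq [leqRHS]big_seq; apply: leq_sum => m /irr[_ [m1 _]].
  by case: (size m) m1 => [|[]].
have szms : (size ms <= n - 3)%N by lia.
split=> //; apply: le_trans (_ : \sum_(m <- ms) q%:R^-1 <= _).
  rewrite big_seq [leRHS]big_seq; apply: ler_sum => m /irr[_ [m1 _]].
  rewrite -[leRHS]expr1; apply: weight_le.
  by case: (size m) m1 => [|[]].
rewrite big_const_seq count_predT iter_addr_0 -[leLHS]mulr_natl.
by rewrite ler_wpM2r ?invr_ge0 ?ler0n // ler_nat.
Qed.

(** The linear factors of X^n - 1 correspond to the n-th roots of unity in F, whose
    orders also divide q - 1. *)
Lemma linear_factors (ms : seq {poly F}) : uniq ms ->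
  (forall m, m \in ms -> monic_irreducible m) -> \prod_(m <- ms) m %| 'X^n - 1 ->
  (count (fun m : {poly F} => size m == 2) ms <= gcdn n (q - 1))%N.
Proof.
move=> ums irr dvd; have n0 : (0 < n)%N := adim_gt0 _.
set lins := [seq m : {poly F} <- ms | size m == 2].
have linE m : m \in lins -> m = 'X + (m`_0)%:P.
  rewrite mem_filter => /andP[/eqP s2 /irr[mon _]]; apply/polyP=> i.
  rewrite coefD coefX coefC; case: i => [|[|i]] /=; rewrite ?add0r ?addr0 //.
    by move: mon; rewrite monicE lead_coefE s2 => /eqP.
  by rewrite nth_default // s2.
have ur : uniq [seq - m`_0 | m : {poly F} <- lins].
  rewrite map_inj_in_uniq ?filter_uniq // => m m' ml m'l /oppr_inj eq0.
  by rewrite (linE m ml) (linE m' m'l) eq0.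
rewrite -size_filter -/lins -(size_map (fun m : {poly F} => - m`_0)).
apply: (@max_unity_roots F) => //; first by rewrite gcdn_gt0 n0.
apply/allP=> _ /mapP[m ml ->]; set x := - m`_0.
have mx : m = 'X - x%:P by rewrite [LHS](linE m ml) /x polyCN opprK.
have mms : m \in ms by move: ml; rewrite mem_filter => /andP[].
have xn : x ^+ n = 1.
  have : 'X - x%:P %| 'X^n - 1.
    by rewrite -mx; apply: dvdp_trans dvd; rewrite (big_rem m mms) dvdp_mulr.
  by rewrite dvdp_XsubCl rootE !hornerE subr_eq0 => /eqP.
have x0 : x != 0.
  by apply: contraNneq (oner_neq0 F) => x0; rewrite -xn x0 expr0n gtn_eqF.
have xq : x ^+ (q - 1) = 1.
  apply: (mulfI x0); rewrite -exprS mulr1 subn1 prednK ?expf_card //.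
  exact: ltnW (finNzRing_gt1 F).
have [k kP kn] := prim_order_exists n0 xn.
have kq : (k %| q - 1)%N by rewrite (prim_order_dvd kP) xq.
by apply/unity_rootP/eqP; rewrite -(prim_order_dvd kP) dvdn_gcd kn.
Qed.

(** At most g factors are linear, and the degrees of all factors add up to at most
    n - 3. *)
Lemma factor_bound_linear (g := gcdn n (q - 1)) :
  factor_bound L ((n - 3 + g) %/ 2)
    (g%:R / q%:R + ((n - 3)%:R - g%:R) / (2 * q%:R ^+ 2)).
Proof.
move=> h ms hN sh ums irr dvd.
have h0 : h != 0.
  by apply: contraTneq hN => ->; rewrite dvd0p -size_poly_eq0 size_XnsubC ?adim_gt0.
have := factor_degrees h0 irr dvd; rewrite sh => degs.
have lin := linear_factors ums irr (dvdp_trans dvd hN).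
set a := count _ ms in lin.
have split2 : (a + size [seq m : {poly F} <- ms | size m != 2] = size ms)%N.
  by rewrite size_filter count_predC.
set r := size _ in split2.
have sz : (a + r * 2 <= \sum_(m <- ms) (size m).-1)%N.
  rewrite (bigID (fun m : {poly F} => size m == 2)) /= leq_add //.
    by rewrite /a -sum1_count; apply: leq_sum => m /eqP->.
  rewrite /r size_filter -sum1_count big_distrl /= big_seq_cond [leqRHS]big_seq_cond.
  apply: leq_sum => m /andP[/irr[_ [m1 _]]].
  by case: (size m) m1 => [|[|[]]].
have aN : (a + r * 2 <= n - 3)%N by lia.
split; first by rewrite leq_divRL //; lia.
apply: le_trans (linear_weight_arith aN lin _); last by rewrite ler1n (ltnW (finNzRing_gt1 F)).
rewrite (bigID (fun m : {poly F} => size m == 2)) /= lerD //.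
  rewrite -big_filter; apply: le_trans (_ : \sum_(m <- ms | size m == 2) q%:R^-1 <= _).
    rewrite big_filter; apply: ler_sum => m /eqP ->; by rewrite expn1.
  by rewrite big_const_seq iter_addr_0 -[leLHS]mulr_natl.
rewrite big_seq_cond; apply: le_trans (_ : \sum_(m <- ms | size m != 2) q%:R^-1 ^+ 2 <= _).
  rewrite [leRHS]big_seq_cond; apply: ler_sum => m /andP[/irr[_ [m1 _]] m2].
  by apply: weight_le; case: (size m) m1 m2 => [|[|[]]].
by rewrite big_const_seq iter_addr_0 -[leLHS]mulr_natl /r size_filter exprVn.
Qed.
End FactorBound.

(** * Sieving data for the primes of 11^N - 1 *)

Definition medium_primes : seq nat :=
  [:: 17; 19; 23; 29; 31; 37; 41; 43; 47; 53; 59; 61; 67; 71; 73; 79; 83; 89;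
      97; 101; 103; 107; 109; 113].

Definition large_primes : seq nat :=
  [:: 37; 41; 43; 47; 53; 59; 61; 67; 71; 73; 79; 83; 89; 97; 101; 103; 107;
      109; 113; 127; 131; 137; 139; 149; 151; 157; 163; 167; 173; 179; 181;
      191; 193; 197; 199; 211; 223; 227; 229; 233; 239; 241; 251; 257; 263;
      269; 271; 277; 281; 283; 293; 307; 311; 313; 317; 331; 337; 347; 349;
      353; 359; 367; 373; 379; 383; 389; 397; 401].

(** The prime 11 is excepted since it does not divide 11^N - 1. *)
Definition covers (B : nat) (ps : seq nat) :=
  all (fun p => prime p ==> (p \in 11%N :: ps)) (iota 0 B).

Lemma prime_data_cover (m N : nat) (ls us : seq nat) (B t : nat) :
  (m %| 11 ^ N - 1)%N -> (0 < m)%N -> (0 < N)%N ->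
  uniq ls -> uniq us -> all (leq 1) ls -> (1 < B)%N -> (11 ^ N <= B ^ t.+1)%N ->
  covers B (ls ++ us) -> prime_data m ls us B t.
Proof.
move=> mN m0 N0 uls uus ls1 B1 NB cov.
have big : (1 < 11 ^ N)%N by rewrite -(expn0 11) ltn_exp2l.
split=> //.
  rewrite B1 /=; apply: leq_trans NB; apply: leq_ltn_trans (dvdn_leq _ mN) _.
    by rewrite subn_gt0.
  by rewrite ltn_subrL /= ltnW.
move=> p p_pr pm pB; move/allP: cov => /(_ p); rewrite mem_iota /= add0n => /(_ pB).
rewrite p_pr /= inE => /predU1P[p11|//].
have d11 : (11 %| 11 ^ N)%N by rewrite -{1}(expn1 11) dvdn_exp2l.
by have := dvdn_trans pm mN; rewrite p11 (dvdn_subr (ltnW big) d11).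
Qed.

Lemma prime_data_small (m N : nat) : (m %| 11 ^ N - 1)%N -> (0 < m)%N -> (0 < N)%N ->
  prime_data m [:: 2; 3; 5; 7; 13]%N medium_primes 121 (N %/ 2).
Proof.
move=> mN m0 N0; apply: (prime_data_cover mN) => //.
(* B = 11^2, so more than N / 2 primes above B would exceed 11^N. *)
rewrite -[121%N]/(11 ^ 2)%N -expnM leq_exp2l //; lia.
Qed.

Lemma prime_data_medium (m N : nat) : (m %| 11 ^ N - 1)%N -> (0 < m)%N -> (0 < N)%N ->
  prime_data m [:: 2; 3; 5; 7; 13; 17; 19; 23; 29; 31]%N large_primes 402 (2 * N %/ 5).
Proof.
move=> mN m0 N0; apply: (prime_data_cover mN) => //.
(* B = 402 is the least integer with 11^5 <= B^2. *)
rewrite -(@leq_exp2r _ _ 2) // -!expnM.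
apply: (@leq_trans (11 ^ (5 * (2 * N %/ 5).+1))); first by rewrite leq_exp2l //; lia.
by rewrite (expnM 11) (mulnC _ 2%N) (expnM 402) leq_exp2r.
Qed.

Lemma prime_data_all (m N B t : nat) : (m %| 11 ^ N - 1)%N -> (0 < m)%N -> (0 < N)%N ->
  (1 < B)%N -> (11 ^ N <= B ^ t.+1)%N ->
  prime_data m [seq p <- primes m | (p < B)%N] [::] B t.
Proof.
move=> mN m0 N0 B1 NB; have big : (1 < 11 ^ N)%N by rewrite -(expn0 11) ltn_exp2l.
split=> //.
- by rewrite filter_uniq ?primes_uniq.
- by apply/allP=> p; rewrite mem_filter mem_primes => /andP[_ /and3P[/prime_gt0]].
- rewrite B1 /=; apply: leq_trans NB; apply: leq_ltn_trans (dvdn_leq _ mN) _.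
    by rewrite subn_gt0.
  by rewrite ltn_subrL /= ltnW.
by move=> p p_pr pm pB; rewrite cats0 mem_filter pB mem_primes p_pr m0.
Qed.

Lemma prod_iota_telescope k :
  \prod_(i <- iota 2 k) (1 - i%:R^-1) = k.+1%:R^-1 :> rat.
Proof.
elim: k => [|k IH]; first by rewrite big_nil invr1.
rewrite -{1}(addn1 k) iotaD big_cat /= IH big_seq1 add2n.
have k1 : k.+1%:R != 0 :> rat by rewrite pnatr_eq0.
have k2 : k.+2%:R != 0 :> rat by rewrite pnatr_eq0.
rewrite -[k.+2%:R]natr1 in k2 *; move: (k.+1%:R) k1 k2 => a a0 a1.
by field; rewrite a0 a1.
Qed.

(** The product of 1 - 1/p over the list is at least the one over all integers from 2 to
    B - 1, which telescopes. *)
Lemma prod_half_loss_ge (ls : seq nat) (B k : nat) : uniq ls -> (2 <= B)%N ->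
  all (fun p => 1 < p < B)%N ls -> (size ls <= k)%N ->
  2^-1 ^+ k / B%:R <= \prod_(p <- ls) half_loss p.
Proof.
move=> uls B2 /allP ls1 lsk.
have -> : \prod_(p <- ls) half_loss p = 2^-1 ^+ size ls * \prod_(p <- ls) (1 - p%:R^-1).
  elim: (ls) => [|p ps IH]; first by rewrite !big_nil mulr1.
  by rewrite !big_cons IH exprS /half_loss; ring.
have B0 : 0 < B%:R :> rat by rewrite ltr0n (leq_trans _ B2).
apply: ler_pM; rewrite ?exprn_ge0 ?invr_ge0 ?ler0n //.
  by apply: ler_wiXn2l => //; rewrite invr_ge0 ler0n.
have -> : B = ((B - 2).+1).+1 by lia.
apply: le_trans (_ : \prod_(i <- iota 2 (B - 2)) (1 - i%:R^-1) <= _).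
  by rewrite prod_iota_telescope lef_pV2 ?posrE ?ltr0n // ler_nat.
apply: prod_subset_ge; rewrite ?iota_uniq // => p.
  by move/ls1; rewrite mem_iota; lia.
rewrite mem_iota => /andP[p2 _].
have p0 : (0 < p)%N := ltnW p2.
by rewrite subr_ge0 invf_le1 ?ltr0n // ler1n p0 lerBlDr lerDl invr_ge0 ler0n.
Qed.

(** Besides 2 and 3, a prime is congruent to 1 or 5 modulo 6, so that division by 3 is
    injective on these primes. *)
Lemma count_primes_below (ps : seq nat) (B : nat) : uniq ps ->
  all (fun p => prime p && (p < B))%N ps -> (3 * size ps <= B + 9)%N.
Proof.
move=> ups /allP ok.
pose big := [seq p <- ps | (3 < p)%N].
have sbig : (size ps <= 2 + size big)%N.
  rewrite -(count_predC (fun p => 3 < p)%N ps) -size_filter -/big addnC leq_add2r.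
  rewrite -size_filter; apply: (@uniq_leq_size _ _ [:: 2; 3]%N).
    by rewrite filter_uniq.
  move=> p; rewrite mem_filter /= -leqNgt => /andP[p3 /ok /andP[p_pr _]].
  by move: p3 p_pr; case: p => [|[|[|[|]]]].
have odd6 p : p \in big -> (p %% 6 = 1 \/ p %% 6 = 5)%N.
  rewrite mem_filter => /andP[p3 /ok /andP[p_pr _]].
  have n2 : ~~ (2 %| p)%N by rewrite dvdn_prime2 //; apply/eqP; lia.
  have n3 : ~~ (3 %| p)%N by rewrite dvdn_prime2 //; apply/eqP; lia.
  lia.
have sz : (size big <= B %/ 3 + 1)%N.
  rewrite -(size_map (fun p => p %/ 3)%N) -[leqRHS](size_iota 0).
  apply: uniq_leq_size.
    rewrite map_inj_in_uniq ?filter_uniq // => p p' /odd6 o /odd6 o'; lia.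
  move=> _ /mapP[p pbig ->]; rewrite mem_iota /= add0n.
  by move: pbig; rewrite mem_filter => /andP[_ /ok /andP[_ pB]]; lia.
lia.
Qed.

(** * Numerical inequalities by ranges of N *)

Lemma small_loss : \prod_(p <- [:: 2; 3; 5; 7; 13]%N) half_loss p = 3 / 455.
Proof. by rewrite /half_loss !big_cons big_nil; field. Qed.

Lemma medium_loss :
  \prod_(p <- [:: 2; 3; 5; 7; 13; 17; 19; 23; 29; 31]%N) half_loss p >= 1 / 6100.
Proof. by rewrite /half_loss !big_cons big_nil; lra. Qed.

Lemma medium_sum : \sum_(p <- medium_primes) p%:R^-1 <= 5058 / 10000 :> rat.
Proof. by rewrite /medium_primes !big_cons big_nil; lra. Qed.

Lemma large_sum : \sum_(p <- large_primes) p%:R^-1 <= 4957 / 10000 :> rat.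
Proof. by rewrite /large_primes !big_cons big_nil; lra. Qed.

Lemma main_bound (X0 c0 w0 u0 X c w u : rat) : 0 <= X0 -> 0 <= c0 -> 0 <= w0 ->
  X0 <= X -> c0 <= c -> w0 <= w -> u <= u0 -> u0 < X0 / 3 * c0 * w0 ->
  u < X / 3 * c * w.
Proof.
move=> X00 c00 w00 XX cc ww uu h; apply: le_lt_trans uu (lt_le_trans h _).
apply: ler_pM => //; first by rewrite mulr_ge0 // divr_ge0.
by apply: ler_pM => //; rewrite ?divr_ge0 // ler_pM2r.
Qed.

Lemma pow11_ge (x y : nat) : (x <= y)%N -> 11 ^+ x <= 11 ^+ y :> rat.
Proof. by move=> xy; rewrite ler_weXn2l ?ler1n. Qed.

Lemma pow11_ge0 (y : nat) : 0 <= 11 ^+ y :> rat.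
Proof. by rewrite exprn_ge0 ?ler0n. Qed.

Lemma nat_ratio_le (t N B : nat) (r : rat) : (0 < B)%N -> (t <= N)%N -> N%:R / B%:R <= r ->
  t%:R / B%:R <= r.
Proof.
move=> B0 tN; apply: le_trans; rewrite ler_wpM2r ?invr_ge0 ?ler0n //.
by rewrite ler_nat.
Qed.

(** The union bound over polynomials is used only for n <= 20, hence with at most
    n - 3 = 17 of them, each of weight at most 1/q. Here q is at least 11^3, or it is 11^2
    and then N = s n is at most 40. Exactly sieved polynomials count as
    no loss at all. *)
Definition loss_bound (N b : nat) (sigma : rat) :=
  (b <= 17)%N /\ (sigma <= 17 / 1331 \/ (N <= 40)%N /\ sigma <= 17 / 121).

(** K bounds the number of primes below N. As 2^8 <= 7^3, the hypotheses
    give 2^K <= 8 * 7^y, and 11^y / 7^y outgrows the quadratic factor from y = 36 on. *)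
Lemma tail_pow (y K N : nat) : (36 <= y)%N -> (N <= 8 * y)%N -> (3 * K <= N + 9)%N ->
  (N * (36 + N) * 4 * 2 ^ K < 11 ^ y)%N.
Proof.
move=> y36 Ny KN.
have h1 : (2 ^ K <= 8 * 7 ^ y)%N.
  rewrite -(@leq_exp2r _ _ 3) // expnMn -!expnM.
  apply: (@leq_trans (2 ^ (9 + 8 * y))); first by rewrite leq_exp2l //; lia.
  rewrite expnD (expnM 2 8) (mulnC y) (expnM 7 3) leq_mul //.
  by rewrite leq_exp2r; lia.
have h2 : (32 * (8 * y) * (36 + 8 * y) * 7 ^ y < 11 ^ y)%N.
  elim: y y36 {Ny h1} => // y IH; rewrite leq_eqVlt => /predU1P[eqy|y36].
    by rewrite -eqy; lia.
  have {}IH := IH y36; rewrite (expnS 11).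
  apply: leq_trans (_ : 11 * (32 * (8 * y) * (36 + 8 * y) * 7 ^ y).+1 <= _)%N; last first.
    by rewrite leq_mul2l.
  apply: (@leq_ltn_trans (11 * (32 * (8 * y) * (36 + 8 * y) * 7 ^ y))); last first.
    by rewrite ltn_pmul2l.
  rewrite (expnS 7) !mulnA leq_mul2r; apply/orP; right.
  nia.
have Q1 : (N * (36 + N) <= 8 * y * (36 + 8 * y))%N by rewrite leq_mul // leq_add2l.
apply: leq_ltn_trans (leq_mul (leq_mul Q1 (leqnn 4)) h1) _.
apply: leq_trans h2.
by rewrite ltnS !mulnA; apply: eq_leq; ring.
Qed.

Lemma delta_small (S t sigma r1 r2 : rat) : S <= 5058 / 10000 -> t <= r1 -> sigma <= r2 ->
  1 - 5058 / 10000 - r1 - r2 <= 1 - S - t - sigma.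
Proof. lra. Qed.

Lemma delta_large (S t sigma r1 r2 : rat) : S <= 4957 / 10000 -> t <= r1 -> sigma <= r2 ->
  1 - 4957 / 10000 - r1 - r2 <= 1 - S - t - sigma.
Proof. lra. Qed.

Lemma delta_tail (t sigma : rat) : t <= 1 / 2 -> sigma <= 17 / 1331 ->
  1 / 2 - 17 / 1331 <= 1 - 0 - t - sigma.
Proof. lra. Qed.

Lemma loss_bound_large (N b : nat) (sigma : rat) : (40 < N)%N -> loss_bound N b sigma ->
  sigma <= 17 / 1331.
Proof.
move=> N40 [_ [h|[N40' _]]]; first exact: h.
by exfalso; rewrite ltnNge N40' in N40.
Qed.

Lemma small_loss_ge0 : 0 <= 3 / 455 :> rat. Proof. lra. Qed.
Lemma small_delta_ge0 : 0 <= 1 - 5058 / 10000 - 30 / 121 - 17 / 1331 :> rat. Proof. lra. Qed.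
Lemma small_delta_ge0' : 0 <= 1 - 5058 / 10000 - 20 / 121 - 17 / 121 :> rat. Proof. lra. Qed.
Lemma small_numeric :
  72%:R < 11 ^+ 5 / 3 * (3 / 455) * (1 - 5058 / 10000 - 30 / 121 - 17 / 1331) :> rat.
Proof. lra. Qed.
Lemma small_numeric' :
  62%:R < 11 ^+ 5 / 3 * (3 / 455) * (1 - 5058 / 10000 - 20 / 121 - 17 / 121) :> rat.
Proof. lra. Qed.
Lemma large_loss_ge0 : 0 <= 1 / 6100 :> rat. Proof. lra. Qed.
Lemma large_delta_ge0 : 0 <= 1 - 4957 / 10000 - 112 / 402 - 17 / 1331 :> rat. Proof. lra. Qed.
Lemma large_numeric :
  198%:R < 11 ^+ 8 / 3 * (1 / 6100) * (1 - 4957 / 10000 - 112 / 402 - 17 / 1331) :> rat.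
Proof. lra. Qed.

Lemma small_range (t N y b : nat) (X sigma : rat) : (t = N %/ 2)%N -> (N <= 60)%N -> (5 <= y)%N ->
  11 ^+ y <= X -> loss_bound N b sigma ->
  (1 + size medium_primes + t + b)%:R < X / 3 * (\prod_(p <- [:: 2; 3; 5; 7; 13]%N) half_loss p)
       * (1 - \sum_(p <- medium_primes) p%:R^-1 - t%:R / 121%:R - sigma).
Proof.
move=> tE N60 y5 Xy [b17 sig].
have X5 : 11 ^+ 5 <= X := le_trans (pow11_ge y5) Xy.
have t30 : (t <= 30)%N by lia.
have c_ge : 3 / 455 <= \prod_(p <- [:: 2; 3; 5; 7; 13]%N) half_loss p.
  by rewrite small_loss; exact: lexx.
case: sig => [sig|[N40 sig]].
  have u72 : (1 + size medium_primes + t + b <= 72)%N by rewrite /=; lia.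
  have ht := @nat_ratio_le _ _ 121 (30 / 121) isT t30 (lexx _).
  have hw := delta_small medium_sum ht sig.
  rewrite -(ler_nat rat) in u72.
  exact: (main_bound (pow11_ge0 5) small_loss_ge0 small_delta_ge0 X5 c_ge hw u72 small_numeric).
have t20 : (t <= 20)%N by lia.
have u62 : (1 + size medium_primes + t + b <= 62)%N by rewrite /=; lia.
have ht := @nat_ratio_le _ _ 121 (20 / 121) isT t20 (lexx _).
have hw := delta_small medium_sum ht sig.
rewrite -(ler_nat rat) in u62.
exact: (main_bound (pow11_ge0 5) small_loss_ge0 small_delta_ge0' X5 c_ge hw u62 small_numeric').
Qed.

Lemma medium_range (t N y b : nat) (X sigma : rat) : (t = 2 * N %/ 5)%N -> (60 < N)%N ->
  (N <= 280)%N -> (8 <= y)%N -> 11 ^+ y <= X -> loss_bound N b sigma ->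
  (1 + size large_primes + t + b)%:R <
    X / 3 * (\prod_(p <- [:: 2; 3; 5; 7; 13; 17; 19; 23; 29; 31]%N) half_loss p)
       * (1 - \sum_(p <- large_primes) p%:R^-1 - t%:R / 402%:R - sigma).
Proof.
move=> tE N60 N280 y8 Xy bnd; have [b17 _] := bnd.
have N40 : (40 < N)%N by lia.
have sig := loss_bound_large N40 bnd.
have X8 : 11 ^+ 8 <= X := le_trans (pow11_ge y8) Xy.
have t112 : (t <= 112)%N by lia.
have u198 : (1 + size large_primes + t + b <= 198)%N by rewrite /=; lia.
have ht := @nat_ratio_le _ _ 402 (112 / 402) isT t112 (lexx _).
have hw := delta_large large_sum ht sig.
rewrite -(ler_nat rat) in u198.
exact: (main_bound (pow11_ge0 8) large_loss_ge0 large_delta_ge0 X8 medium_loss hw u198 large_numeric).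
Qed.

Lemma tail_numeric (P Y N u : rat) : 0 < P -> 0 < N ->
  N * (36 + N) * 4 * P < Y -> u <= 18 + N / 2 ->
  u < Y / 3 * (P^-1 / N) * (1 / 2 - 17 / 1331).
Proof.
move=> P0 N0 h hu; apply: le_lt_trans hu _.
have NP : 0 < N * P by rewrite mulr_gt0.
rewrite -(ltr_pM2r NP).
have -> : Y / 3 * (P^-1 / N) * (1 / 2 - 17 / 1331) * (N * P) = Y * ((1 / 2 - 17 / 1331) / 3).
  by field; rewrite !gt_eqF.
nra.
Qed.

Lemma tail_range (ls : seq nat) (t N y b : nat) (X sigma : rat) : (t = N %/ 2)%N ->
  (280 < N)%N -> (N <= 8 * y)%N -> uniq ls -> all (fun p => prime p && (p < N))%N ls ->
  11 ^+ y <= X -> loss_bound N b sigma ->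
  (1 + size ([::] : seq nat) + t + b)%:R <
    X / 3 * (\prod_(p <- ls) half_loss p)
       * (1 - \sum_(p <- [::]) p%:R^-1 - t%:R / N%:R - sigma).
Proof.
move=> tE N280 Ny uls lsP Xy bnd; have [b17 _] := bnd.
have N40 : (40 < N)%N by lia.
have sig := loss_bound_large N40 bnd.
have K := count_primes_below uls lsP.
have y36 : (36 <= y)%N by lia.
have N2 : (2 <= N)%N by lia.
have tN : (t * 2 <= N)%N by lia.
have c_ge : 2^-1 ^+ size ls / N%:R <= \prod_(p <- ls) half_loss p.
  apply: prod_half_loss_ge => //.
  by apply: sub_all lsP => p /andP[/prime_gt1-> ->].
have N0 : 0 < N%:R :> rat by rewrite ltr0n; exact: ltnW.
have ht : t%:R / N%:R <= 1 / 2 :> rat.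
  rewrite ler_pdivrMr // -(ler_nat rat) natrM in tN *; lra.
have P0 : 0 < 2 ^+ size ls :> rat by rewrite exprn_gt0 ?ltr0n.
have tail := tail_pow y36 Ny K.
rewrite -(ltr_nat rat) 3!natrM !natrX natrD in tail.
have hu : (1 + size ([::] : seq nat) + t + b)%:R <= 18 + N%:R / 2 :> rat.
  rewrite addn0 !natrD; rewrite -!(ler_nat rat) natrM in tN b17; lra.
have num := tail_numeric P0 N0 tail hu.
rewrite -exprVn in num; rewrite big_nil.
apply: (main_bound (pow11_ge0 y) _ _ Xy c_ge (delta_tail ht sig) (lexx _) num).
  by rewrite mulr_ge0 ?exprn_ge0 ?invr_ge0 ?ler0n.
lra.
Qed.

(** Up to N = 60 and up to N = 280 fixed lists of primes suffice. Beyond, all primes below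
    N are sieved exactly, and the others are at most N / 2 in number, because N is greater
    than 11^2. *)
Lemma prime_part_ineq (m N y : nat) : (m %| 11 ^ N - 1)%N -> (0 < m)%N -> (0 < N)%N ->
  [\/ (N <= 60)%N /\ (5 <= y)%N, (60 < N <= 280)%N /\ (8 <= y)%N | (280 < N)%N /\ (N <= 8 * y)%N] ->
  exists ls us B t, prime_data m ls us B t /\
    forall X b sigma, 11 ^+ y <= X -> loss_bound N b sigma ->
    (1 + size us + t + b)%:R < X / 3 * (\prod_(p <- ls) half_loss p)
       * (1 - \sum_(p <- us) p%:R^-1 - t%:R / B%:R - sigma).
Proof.
move=> mN m0 N0 [[N60 y5]|[/andP[N60 N280] y8]|[N280 Ny]].
- exists [:: 2; 3; 5; 7; 13]%N, medium_primes, 121%N, (N %/ 2)%N.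
  split=> [|X b sigma Xy bnd]; first exact: prime_data_small.
  exact: small_range N60 y5 Xy bnd.
- exists [:: 2; 3; 5; 7; 13; 17; 19; 23; 29; 31]%N, large_primes, 402%N, (2 * N %/ 5)%N.
  split=> [|X b sigma Xy bnd]; first exact: prime_data_medium.
  exact: medium_range N60 N280 y8 Xy bnd.
exists [seq p <- primes m | (p < N)%N], [::], N, (N %/ 2)%N.
have NB : (11 ^ N <= N ^ (N %/ 2).+1)%N.
  apply: (@leq_trans (11 ^ (2 * (N %/ 2).+1))); first by rewrite leq_exp2l //; lia.
  by rewrite expnM leq_exp2r // -[(11 ^ 2)%N]/121%N; lia.
split=> [|X b sigma Xy bnd]; first by apply: (prime_data_all mN) => //; lia.
apply: tail_range Ny _ _ Xy bnd => //; first by rewrite filter_uniq ?primes_uniq.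
by apply/allP=> p; rewrite mem_filter mem_primes => /andP[-> /and3P[->]].
Qed.

(** * Large degrees and large base fields *)

Lemma five_elevenths : 0 <= (5 / 11 : rat) <= 5 / 11. Proof. lra. Qed.
Lemma cube_bound : 1 / 11 <= (5 / 11) ^+ 3 :> rat. Proof. lra. Qed.
Lemma loss_bound_ge0 : 0 <= 17 / 1331 :> rat. Proof. lra. Qed.
Lemma inv11_ge0 : 0 <= 1 / 11 :> rat. Proof. lra. Qed.

Lemma pow_le_pow (a r : rat) (y : nat) : 0 <= a -> 0 <= r -> a <= r ^+ 3 ->
  a ^+ y <= r ^+ (3 * y).
Proof.
move=> a0 r0 ar; rewrite exprM.
have r30 : 0 <= r ^+ 3 by rewrite exprn_ge0.
exact: lerXn2r.
Qed.

(** As (5/11)^3 >= 1/11, three exactly sieved polynomials lower the exponent of 11 by at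
    most one. *)
Lemma exact_gain (x y b : nat) : (b <= 3 * y)%N -> (y <= x)%N ->
  11 ^+ (x - y) <= 11 ^+ x * (5 / 11) ^+ b :> rat.
Proof.
move=> by3 yx; have [rho0 rho1] := andP five_elevenths.
have -> : 11 ^+ (x - y) = 11 ^+ x * (1 / 11) ^+ y :> rat.
  rewrite -[in X in _ = 11 ^+ X * _](subnK yx) exprD -mulrA -exprMn.
  have -> : 11 * (1 / 11) = 1 :> rat by field.
  by rewrite expr1n mulr1.
apply: ler_wpM2l; first exact: pow11_ge0.
apply: le_trans (ler_wiXn2l rho0 (le_5_11 rho1) by3).
exact: pow_le_pow inv11_ge0 rho0 cube_bound.
Qed.

Lemma loss_bound0 N : loss_bound N 0 0.
Proof. by split=> //; left; exact: loss_bound_ge0. Qed.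

Lemma even_of_dvd3 (k : nat) : (3 %| 11 ^ k - 1)%N -> ~~ odd k.
Proof.
have E j : ((11 ^ j) %% 3 = if odd j then 2 else 1)%N.
  by elim: j => // j IH; rewrite expnS -modnMmr IH /=; case: (odd j).
have pos : (0 < 11 ^ k)%N by rewrite expn_gt0.
by have := E k; case: (odd k) => //; lia.
Qed.

(** The ranges of [prime_part_ineq], where y is the exponent of 11 which remains once
    the polynomials have been paid for. *)
Definition good_range (N y : nat) :=
  [\/ (N <= 60)%N /\ (5 <= y)%N, (60 < N <= 280)%N /\ (8 <= y)%N
   | (280 < N)%N /\ (N <= 8 * y)%N].

Section Families.

Variables (F : finFieldType) (L : fieldExtType F) (s : nat).
Local Notation q := #|F|.
Local Notation n := (\dim {:L}).
Local Notation M := (q ^ n - 1)%N.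
Local Notation Q := (M %/ (q - 1))%N.
Local Notation d0 := (base3 Q).

Hypotheses (qE : q = (11 ^ s)%N) (s_gt0 : (0 < s)%N) (n4 : (4 <= n)%N) (M3 : (3 %| M)%N).
Hypothesis hfactor : exists p : {poly F}, size p = 4%N /\ p %| 'X^n - 1.

Lemma cofactor_gt0 : (0 < Q %/ d0)%N.
Proof.
have QM : (Q %| M)%N by rewrite {2}(M_div L) dvdn_mull.
have bQ : (d0 %| Q)%N by rewrite /base3; case: ifP.
have Q0 : (0 < Q)%N := dvdn_gt0 (M_gt0 L) QM.
have b0 : (0 < d0)%N by rewrite /base3; case: ifP.
by rewrite divn_gt0 //; exact: dvdn_leq.
Qed.

Lemma cofactor_dvd : (Q %/ d0 %| 11 ^ (s * n) - 1)%N.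
Proof.
have QM : (Q %| M)%N by rewrite {2}(M_div L) dvdn_mull.
have bQ : (d0 %| Q)%N by rewrite /base3; case: ifP.
rewrite expnM -qE; apply: dvdn_trans QM.
by rewrite -[X in (_ %| X)%N](divnK bQ) dvdn_mulr.
Qed.

Lemma base3_le : (d0 <= 3)%N. Proof. by rewrite /base3; case: ifP. Qed.

Lemma family_exact (x y b : nat) (sigma : rat) :
  (s * n = 2 * (x + 3 * s))%N -> factor_bound L b sigma ->
  (b <= 3 * y)%N -> (y <= x)%N -> good_range (s * n) (x - y) ->
  exists a : L, r_primitive 3 a /\ k_normal 3 a.
Proof.
move=> sn fb by3 yx range.
have N0 : (0 < s * n)%N by rewrite muln_gt0 s_gt0 (ltnW (ltnW (ltnW n4))).
have [ls [us [B [t [pd ineq]]]]] := prime_part_ineq cofactor_dvd cofactor_gt0 N0 range.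
apply: (@sieve_setup F L 3 ls us B t s x b sigma (5 / 11) true qE sn n4 M3 hfactor base3_le
          pd fb five_elevenths).
have := ineq _ _ _ (exact_gain by3 yx) (loss_bound0 _).
move: (5 / 11) (1 - _ - _) => r w.
by rewrite [11 ^+ x / 3 * _ * _]mulrAC [11 ^+ x / 3 * _]mulrAC.
Qed.

Lemma family_union (x b : nat) (sigma : rat) :
  (s * n = 2 * (x + 3 * s))%N -> factor_bound L b sigma -> loss_bound (s * n) b sigma ->
  good_range (s * n) x ->
  exists a : L, r_primitive 3 a /\ k_normal 3 a.
Proof.
move=> sn fb lb range.
have N0 : (0 < s * n)%N by rewrite muln_gt0 s_gt0 (ltnW (ltnW (ltnW n4))).
have [ls [us [B [t [pd ineq]]]]] := prime_part_ineq cofactor_dvd cofactor_gt0 N0 range.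
apply: (@sieve_setup F L 3 ls us B t s x b sigma (5 / 11) false qE sn n4 M3 hfactor base3_le
          pd fb five_elevenths).
by rewrite mulr1; apply: ineq lb; apply: lexx.
Qed.

Lemma even_exponent : exists k, (s * n = 2 * k)%N.
Proof.
have := M3; rewrite qE -expnM => /even_of_dvd3 ev.
by exists (s * n)./2; rewrite mul2n even_halfK.
Qed.

End Families.

Lemma range_split (N y : nat) : ((N <= 60) ==> (5 <= y))%N ->
  ((60 < N) ==> (8 <= y))%N -> ((280 < N) ==> (N <= 8 * y))%N -> good_range N y.
Proof.
move=> h1 h2 h3; case: (leqP N 60) h1 h2 => [N60 /= h1 _|N60 _ /= h2]; first by constructor 1.
case: (leqP N 280) h3 => [N280 _|N280 /= h3]; last by constructor 3.
by constructor 2; rewrite N60.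
Qed.

Lemma range_exact (n s x : nat) : (s * n = 2 * (x + 3 * s))%N -> (0 < s)%N -> (7 <= n)%N ->
  (if s == 1%N then 42 <= n else 21 <= n)%N ->
  (n.-1 %/ 3 <= x)%N /\ good_range (s * n) (x - n.-1 %/ 3).
Proof.
move=> sn s0 n7; case: eqP => [s1|s1] big.
  by subst s; split; [lia | apply: range_split; lia].
have prod : (21 * s + 2 * n <= s * n + 42)%N by nia.
by move: (s * n)%N sn prod => N sn prod; split; [lia | apply: range_split; lia].
Qed.

Lemma range_union (n s x : nat) : (s * n = 2 * (x + 3 * s))%N -> (2 <= s)%N ->
  (8 <= n <= 20)%N -> (5 <= x)%N -> good_range (s * n) x.
Proof.
move=> sn s2 /andP[n8 n20] x5; apply: range_split; first by rewrite x5 implybT.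
  apply/implyP => N60; nia.
by apply/implyP => N280; nia.
Qed.

Lemma ratio_le (k a Q b : nat) : (0 < b)%N -> (k <= a)%N -> (b <= Q)%N ->
  k%:R / Q%:R <= a%:R / b%:R :> rat.
Proof.
move=> b0 ka bQ; have Q0 : (0 < Q)%N by apply: leq_trans bQ.
apply: ler_pM; rewrite ?invr_ge0 ?ler0n ?ler_nat //.
by rewrite lef_pV2 ?posrE ?ltr0n // ler_nat.
Qed.

Lemma union_loss_bound (n s : nat) : (2 <= s)%N -> (n <= 20)%N ->
  loss_bound (s * n) (n - 3) ((n - 3)%:R / (11 ^ s)%N%:R).
Proof.
move=> s2 n20; have n17 : (n - 3 <= 17)%N by lia.
split=> //; case: (ltnP 2 s) => [s3|s2'].
  left; apply: (@ratio_le _ 17 _ 1331 isT n17).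
  by apply: (@leq_trans (11 ^ 3)); [lia | rewrite leq_exp2l].
have -> : s = 2%N by lia.
by right; split; [lia | exact: (@ratio_le _ 17 _ 121 isT n17)].
Qed.

Section Families.

Variables (F : finFieldType) (L : fieldExtType F) (s : nat).
Local Notation q := #|F|.
Local Notation n := (\dim {:L}).
Local Notation M := (q ^ n - 1)%N.

Hypotheses (qE : q = (11 ^ s)%N) (s_gt0 : (0 < s)%N) (n7 : (7 <= n)%N) (M3 : (3 %| M)%N).
Hypothesis hfactor : exists p : {poly F}, size p = 4%N /\ p %| 'X^n - 1.

Let n4 : (4 <= n)%N. Proof. exact: leq_trans n7. Qed.

(** The n - 3 possible factors, sieved exactly, cost about a third of n in the exponent of
    11, while the available exponent is s (n / 2 - 3). *)
Lemma case_large_degree : (if s == 1%N then 42 <= n else 21 <= n)%N ->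
  exists a : L, r_primitive 3 a /\ k_normal 3 a.
Proof.
move=> big; have [k sn] := even_exponent qE M3.
have [x sx] : exists x, k = (x + 3 * s)%N.
  by exists (k - 3 * s)%N; rewrite subnK //; move: sn n7; clear; nia.
rewrite sx in sn; have [yx range] := range_exact sn s_gt0 n7 big.
apply: (family_exact qE s_gt0 n4 M3 hfactor sn (@factor_bound_trivial F L) _ yx range).
by move: (n) => m; lia.
Qed.

(** The loss (n - 3) / q of the union bound is small as soon as q is at least 121. *)
Lemma case_union : (2 <= s)%N -> (8 <= n <= 20)%N -> (10 <= s * (n - 6))%N ->
  exists a : L, r_primitive 3 a /\ k_normal 3 a.
Proof.
move=> s2 n820 big; have [k sn] := even_exponent qE M3.
have [x sx] : exists x, k = (x + 3 * s)%N.
  by exists (k - 3 * s)%N; rewrite subnK //; move: sn n7; clear; nia.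
rewrite sx in sn.
have x5 : (5 <= x)%N by move: sn big; rewrite mulnBr; clear; lia.
have n20 : (n <= 20)%N by case/andP: n820.
apply: (family_union qE s_gt0 n4 M3 hfactor sn (@factor_bound_trivial F L) _
         (range_union sn s2 n820 x5)).
by rewrite qE; exact: union_loss_bound.
Qed.

(** Over the field with 11 elements a count of n - 3 factors is too pessimistic:
    only gcd (n, 10) of them can be linear. *)
Lemma case_medium_degree (g := gcdn n 10) (b := ((n - 3 + g) %/ 2)%N) (x := (n %/ 2 - 3)%N) :
  s = 1%N -> ~~ odd n -> ((b + 2) %/ 3 <= x)%N -> good_range n (x - (b + 2) %/ 3) ->
  exists a : L, r_primitive 3 a /\ k_normal 3 a.
Proof.
move=> s1 ev yx range.
have q11 : q = 11%N by rewrite qE s1.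
have sn : (s * n = 2 * (x + 3 * s))%N by rewrite s1 /x; move: ev n7; move: (n) => m; lia.
have fb := @factor_bound_linear F L.
rewrite /= [in gcdn n _]q11 in fb.
apply: (family_exact (y := ((b + 2) %/ 3)%N) qE s_gt0 n4 M3 hfactor sn fb) => //.
  by rewrite -/g -/b; move: (b) => c; lia.
by rewrite s1 mul1n.
Qed.

End Families.

(** * Checking prime divisors in binary arithmetic *)

Section BinaryArithmetic.
Local Open Scope nat_scope.

(** The unary numbers 11^(s n) - 1 cannot be evaluated; questions about them are
    transferred to binary numbers, where they are decided by computation. *)
Lemma N_of_expn (a k : nat) : BinNat.N.of_nat (a ^ k) = BinNat.N.pow (BinNat.N.of_nat a) (BinNat.N.of_nat k).
Proof.
elim: k => // k IH; rewrite expnS Nnat.Nat2N.inj_succ BinNat.N.pow_succ_r' -IH.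
exact: Nnat.Nat2N.inj_mul.
Qed.

Lemma N_of_divn (a b : nat) : BinNat.N.of_nat (a %/ b) = BinNat.N.div (BinNat.N.of_nat a) (BinNat.N.of_nat b).
Proof.
case: (posnP b) => [->|b0]; first by rewrite divn0; case: (BinNat.N.of_nat a).
apply: (BinNat.N.div_unique _ _ _ (BinNat.N.of_nat (a %% b))).
  by have := ltn_pmod a b0; lia.
rewrite {1}(divn_eq a b); lia.
Qed.

Lemma N_of_modn (a b : nat) : 0 < b ->
  BinNat.N.of_nat (a %% b) = BinNat.N.modulo (BinNat.N.of_nat a) (BinNat.N.of_nat b).
Proof.
move=> b0; apply: (BinNat.N.mod_unique _ _ (BinNat.N.of_nat (a %/ b))).
  by have := ltn_pmod a b0; lia.
rewrite {1}(divn_eq a b); lia.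
Qed.

Lemma N_dvdn (a b : nat) : 0 < b ->
  (b %| a) = BinNat.N.eqb (BinNat.N.modulo (BinNat.N.of_nat a) (BinNat.N.of_nat b)) BinNums.N0.
Proof. by move=> b0; rewrite -N_of_modn // /dvdn; case: (a %% b). Qed.

(** The quotient of 11^(s n) - 1 by 11^s - 1; its quotient by 3, when exact, is the number
    whose primes have to be sieved. *)
Definition repunitN (s n : BinNums.N) : BinNums.N :=
  BinNat.N.div (BinNat.N.sub (BinNat.N.pow (BinNat.N.of_nat 11) (BinNat.N.mul s n)) (BinNat.N.of_nat 1))
    (BinNat.N.sub (BinNat.N.pow (BinNat.N.of_nat 11) s) (BinNat.N.of_nat 1)).
Definition cofactorN (s n : BinNums.N) : BinNums.N :=
  let Q := repunitN s n in
  if BinNat.N.eqb (BinNat.N.modulo Q (BinNat.N.of_nat 3)) BinNums.N0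
  then BinNat.N.div Q (BinNat.N.of_nat 3) else Q.

Lemma cofactorN_correct (s n : nat) (Q := (((11 ^ s) ^ n - 1) %/ (11 ^ s - 1))) :
  BinNat.N.of_nat (Q %/ base3 Q) = cofactorN (BinNat.N.of_nat s) (BinNat.N.of_nat n).
Proof.
have QE : BinNat.N.of_nat Q = repunitN (BinNat.N.of_nat s) (BinNat.N.of_nat n).
  rewrite /Q N_of_divn /repunitN !Nnat.Nat2N.inj_sub -expnM !N_of_expn.
  by rewrite Nnat.Nat2N.inj_mul.
rewrite /cofactorN -QE /base3 (N_dvdn _ (isT : 0 < 3)).
case: BinNat.N.eqb; first exact: N_of_divn.
by rewrite divn1.
Qed.

(** A divisor p of m outside ps is discarded when it has a proper divisor in ps, which
    dispenses with primality tests. *)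
Definition small_primes_ok (m : BinNums.N) (B : nat) (ps : seq nat) :=
  all (fun p => [|| ~~ BinNat.N.eqb (BinNat.N.modulo m (BinNat.N.of_nat p)) BinNums.N0, p \in ps |
                    has (fun d => (1 < d) && (d < p) && (p %% d == 0)) ps]) (iota 2 B).

Lemma small_primes_okP (m B : nat) (ps : seq nat) : small_primes_ok (BinNat.N.of_nat m) B ps ->
  forall p, prime p -> p %| m -> p < B -> p \in ps.
Proof.
move=> /allP ok p p_pr pm pB; have p1 := prime_gt1 p_pr.
have := ok p; rewrite mem_iota p1 (leq_trans pB) ?leq_addl // => /(_ isT).
rewrite -N_dvdn ?pm ?(ltnW p1) //= => /orP[//|/hasP[d _ /andP[/andP[d1 dp] pd]]].
move: p_pr => /primeP[_ /(_ d)]; rewrite /dvdn pd => /(_ isT).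
by case/orP=> /eqP dE; move: d1 dp; rewrite dE ?ltnn.
Qed.

Definition prime_check (s n : nat) (ls us : seq nat) (B t : nat) : bool :=
  let m := cofactorN (BinNat.N.of_nat s) (BinNat.N.of_nat n) in
  [&& uniq ls, uniq us, all (leq 1) ls, 1 < B,
    BinNat.N.ltb m (BinNat.N.pow (BinNat.N.of_nat B) (BinNat.N.of_nat t.+1)) & small_primes_ok m B (ls ++ us)].

Lemma prime_check_data (s n : nat) (ls us : seq nat) (B t : nat)
    (Q := (((11 ^ s) ^ n - 1) %/ (11 ^ s - 1))) :
  prime_check s n ls us B t -> prime_data (Q %/ base3 Q) ls us B t.
Proof.
case/and5P=> uls uus ls1 B1 /andP[mB ok]; rewrite -cofactorN_correct in mB ok.
split=> //; last exact: small_primes_okP ok.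
rewrite B1 /=; move: mB; rewrite -N_of_expn.
by move: (Q %/ base3 Q) (B ^ t.+1) => a b; lia.
Qed.

End BinaryArithmetic.

(** * Individual pairs of a degree and a base field *)

Lemma factor_bound_weaken (F : finFieldType) (L : fieldExtType F) (b b' : nat) (sigma sigma' : rat) :
  factor_bound L b sigma -> (b <= b')%N -> sigma <= sigma' -> factor_bound L b' sigma'.
Proof.
move=> fb bb ss h ms hN sh ums irr dvd; have [h1 h2] := fb h ms hN sh ums irr dvd.
by split; [exact: leq_trans h1 bb | exact: le_trans h2 ss].
Qed.

Definition three_free (s n : nat) : bool :=
  ~~ BinNat.N.eqb (BinNat.N.modulo (repunitN (BinNat.N.of_nat s) (BinNat.N.of_nat n)) (BinNat.N.of_nat 3)) BinNums.N0.

Lemma three_freeP (s n : nat) : three_free s n ->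
  base3 ((((11 ^ s) ^ n - 1) %/ (11 ^ s - 1))%N) = 1%N.
Proof.
rewrite /three_free /base3 (N_dvdn _ (isT : (0 < 3)%N)) N_of_divn.
rewrite /repunitN !Nnat.Nat2N.inj_sub -expnM !N_of_expn Nnat.Nat2N.inj_mul.
by move/negbTE => ->.
Qed.

Section Individual.

Variables (F : finFieldType) (L : fieldExtType F).
Local Notation q := #|F|.
Local Notation goal := (exists a : L, r_primitive 3 a /\ k_normal 3 a).

(** The case d = 1 gains a factor 3 when 3 does not divide Q. *)
Lemma individual (s n x d : nat) (ls us : seq nat) (B t b : nat) (sigma : rat)
    (exact_polys : bool) :
  q = (11 ^ s)%N -> \dim {:L} = n -> (4 <= n)%N -> (3 %| q ^ n - 1)%N ->
  (exists p : {poly F}, size p = 4%N /\ p %| 'X^n - 1) ->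
  (s * n = 2 * (x + 3 * s))%N ->
  prime_check s n ls us B t ->
  (if d == 1%N then three_free s n else d == 3)%N ->
  factor_bound L b sigma ->
  (1 + size us + t + (if exact_polys then 0 else b))%:R <
    11 ^+ x / d%:R * (\prod_(p <- ls) half_loss p)
    * (if exact_polys then (5 / 11) ^+ b else 1)
    * (1 - \sum_(p <- us) p%:R^-1 - t%:R / B%:R - (if exact_polys then 0 else sigma)) ->
  goal.
Proof.
move=> qE dimL n4 M3 hf sn pc dE fb ineq.
have pd := prime_check_data pc; rewrite -qE -dimL in pd.
have dd : (base3 ((q ^ \dim {:L} - 1) %/ (q - 1)) <= d)%N.
  move: dE; case: eqP => [-> tf|_ /eqP->]; last by rewrite /base3; case: ifP.
  by have := three_freeP tf; rewrite -qE -dimL => ->.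
rewrite -dimL in n4 M3 hf sn.
exact: (sieve_setup qE sn n4 M3 hf dd pd fb five_elevenths ineq).
Qed.

Lemma trivial_bound (s n k c : nat) : q = (11 ^ s)%N -> \dim {:L} = n -> (n - 3 = k)%N ->
  (0 < c)%N -> (c <= 11 ^ s)%N -> factor_bound L k (k%:R / c%:R).
Proof.
move=> qE dimL nk c0 cs; apply: factor_bound_weaken (@factor_bound_trivial F L) _ _.
  by rewrite dimL nk.
by rewrite dimL nk qE; apply: ratio_le.
Qed.

Lemma linear_bound (n g b : nat) : q = 11%N -> \dim {:L} = n -> gcdn n 10 = g ->
  ((n - 3 + g) %/ 2 = b)%N ->
  factor_bound L b (g%:R / 11 + ((n - 3)%:R - g%:R) / (2 * 11 ^+ 2)).
Proof.
move=> q11 dimL gE bE; have := @factor_bound_linear F L.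
by rewrite /= q11 dimL gE bE.
Qed.

(** The inequality of [sieve_setup] with the polynomials in the union bound. Below,
    numeric_n_s concerns degree n over the field with 11^s elements. *)
Definition numeric_ok (x d : nat) (ls us : seq nat) (B t b : nat) (sigma : rat) :=
  (1 + size us + t + b)%:R <
    11 ^+ x / d%:R * (\prod_(p <- ls) half_loss p) * 1
    * (1 - \sum_(p <- us) p%:R^-1 - t%:R / B%:R - sigma).

Lemma numeric_7_2 : numeric_ok 1 1 [::] [:: 43]%N 1340 3 4 (4%:R / 121%:R).
Proof. by rewrite /numeric_ok /half_loss !(big_cons, big_nil) [size _]/=; lra. Qed.
Lemma numeric_8_2 : numeric_ok 2 1 [::] [:: 2; 17; 61]%N 121 7 5 (5%:R / 121%:R).
Proof. by rewrite /numeric_ok /half_loss !(big_cons, big_nil) [size _]/=; lra. Qed.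
Lemma numeric_8_3 : numeric_ok 3 3 [:: 2]%N [:: 3; 13; 37; 61]%N 121 12 5 (5%:R / 121%:R).
Proof. by rewrite /numeric_ok /half_loss !(big_cons, big_nil) [size _]/=; lra. Qed.
Lemma numeric_8_4 : numeric_ok 4 3 [::] [:: 2; 17]%N 121 16 5 (5%:R / 121%:R).
Proof. by rewrite /numeric_ok /half_loss !(big_cons, big_nil) [size _]/=; lra. Qed.
Lemma numeric_9_2 : numeric_ok 3 3 [::] [:: 3; 7; 19; 37]%N 121 9 6 (6%:R / 121%:R).
Proof. by rewrite /numeric_ok /half_loss !(big_cons, big_nil) [size _]/=; lra. Qed.
Lemma numeric_10_2 : numeric_ok 4 3 [::] [:: 2; 5; 61]%N 121 10 7 (7%:R / 121%:R).
Proof. by rewrite /numeric_ok /half_loss !(big_cons, big_nil) [size _]/=; lra. Qed.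
Lemma numeric_14_1 : numeric_ok 4 3 [::] [:: 2; 43]%N 121 7 6 (2%:R / 11 + (11%:R - 2%:R) / (2 * 11 ^+ 2)).
Proof. by rewrite /numeric_ok /half_loss !(big_cons, big_nil) [size _]/=; lra. Qed.
Lemma numeric_16_1 : numeric_ok 5 3 [:: 2]%N [:: 17; 61]%N 121 8 7 (2%:R / 11 + (13%:R - 2%:R) / (2 * 11 ^+ 2)).
Proof. by rewrite /numeric_ok /half_loss !(big_cons, big_nil) [size _]/=; lra. Qed.
Lemma numeric_18_1 : numeric_ok 6 3 [:: 2]%N [:: 3; 7; 19; 37]%N 121 9 8 (2%:R / 11 + (15%:R - 2%:R) / (2 * 11 ^+ 2)).
Proof. by rewrite /numeric_ok /half_loss !(big_cons, big_nil) [size _]/=; lra. Qed.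
Lemma numeric_22_1 : numeric_ok 8 3 [:: 2]%N [:: 23; 89]%N 121 11 10 (2%:R / 11 + (19%:R - 2%:R) / (2 * 11 ^+ 2)).
Proof. by rewrite /numeric_ok /half_loss !(big_cons, big_nil) [size _]/=; lra. Qed.
Lemma numeric_20_1 :
  (1 + size [:: 5; 61]%N + 10 + 0)%:R <
    11 ^+ 7 / 3%:R * (\prod_(p <- [:: 2]%N) half_loss p)
    * (5 / 11) ^+ 13 * (1 - \sum_(p <- [:: 5; 61]%N) p%:R^-1 - 10%:R / 121%:R - 0) :> rat.
Proof. by rewrite /half_loss !(big_cons, big_nil) [size _]/=; lra. Qed.

End Individual.

Section SmallCases.

Variables (F : finFieldType) (L : fieldExtType F) (s n : nat).
Local Notation q := #|F|.
Local Notation goal := (exists a : L, r_primitive 3 a /\ k_normal 3 a).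
Hypotheses (qE : q = (11 ^ s)%N) (dimL : \dim {:L} = n).
Hypotheses (n4 : (4 <= n)%N) (M3 : (3 %| q ^ n - 1)%N).
Hypothesis hfactor : exists p : {poly F}, size p = 4%N /\ p %| 'X^n - 1.

Let run x d ls us B t b sigma :
  (s * n = 2 * (x + 3 * s))%N -> prime_check s n ls us B t ->
  (if d == 1%N then three_free s n else d == 3)%N ->
  factor_bound L b sigma -> numeric_ok x d ls us B t b sigma -> goal.
Proof.
move=> sn pc dE fb num.
exact: (individual (exact_polys := false) qE dimL n4 M3 hfactor sn pc dE fb num).
Qed.

Lemma small_case_squared : s = 2%N -> n \in [:: 7; 8; 9; 10]%N -> goal.
Proof.
move=> s2; rewrite !inE => /or4P[] /eqP n_eq; have := run; have qE' := qE; have dimL' := dimL;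
  rewrite s2 n_eq in qE' dimL' *; move=> run'.
- have pc : prime_check 2 7 [::] [:: 43]%N 1340 3 by vm_compute.
  have dE : three_free 2 7 by vm_compute.
  have fb : factor_bound L 4 (4%:R / 121%:R).
    by exact: (trivial_bound qE' dimL' (erefl _) (isT : 0 < 121)%N (leqnn _)).
  exact: (@run' 1 1 [::] [:: 43]%N 1340 3 4 _ (erefl _) pc dE fb numeric_7_2).
- have pc : prime_check 2 8 [::] [:: 2; 17; 61]%N 121 7 by vm_compute.
  have dE : three_free 2 8 by vm_compute.
  have fb : factor_bound L 5 (5%:R / 121%:R).
    by exact: (trivial_bound qE' dimL' (erefl _) (isT : 0 < 121)%N (leqnn _)).
  exact: (@run' 2 1 [::] [:: 2; 17; 61]%N 121 7 5 _ (erefl _) pc dE fb numeric_8_2).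
- have pc : prime_check 2 9 [::] [:: 3; 7; 19; 37]%N 121 9 by vm_compute.
  have dE : (if 3 == 1 then three_free 2 9 else 3 == 3)%N by [].
  have fb : factor_bound L 6 (6%:R / 121%:R).
    by exact: (trivial_bound qE' dimL' (erefl _) (isT : 0 < 121)%N (leqnn _)).
  exact: (@run' 3 3 [::] [:: 3; 7; 19; 37]%N 121 9 6 _ (erefl _) pc dE fb numeric_9_2).
- have pc : prime_check 2 10 [::] [:: 2; 5; 61]%N 121 10 by vm_compute.
  have dE : (if 3 == 1 then three_free 2 10 else 3 == 3)%N by [].
  have fb : factor_bound L 7 (7%:R / 121%:R).
    by exact: (trivial_bound qE' dimL' (erefl _) (isT : 0 < 121)%N (leqnn _)).
  exact: (@run' 4 3 [::] [:: 2; 5; 61]%N 121 10 7 _ (erefl _) pc dE fb numeric_10_2).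
Qed.

Lemma small_case_eight : n = 8%N -> s \in [:: 3; 4]%N -> goal.
Proof.
move=> n_eq; rewrite !inE => /orP[] /eqP s_eq; have := run; have qE' := qE; have dimL' := dimL;
  rewrite s_eq n_eq in qE' dimL' *; move=> run'.
- have pc : prime_check 3 8 [:: 2]%N [:: 3; 13; 37; 61]%N 121 12 by vm_compute.
  have dE : (if 3 == 1 then three_free 3 8 else 3 == 3)%N by [].
  have fb : factor_bound L 5 (5%:R / 121%:R).
    by apply: (trivial_bound qE' dimL' (erefl _) (isT : 0 < 121)%N); rewrite (@leq_exp2l 11 2 3).
  exact: (@run' 3 3 [:: 2]%N [:: 3; 13; 37; 61]%N 121 12 5 _ (erefl _) pc dE fb numeric_8_3).
- have pc : prime_check 4 8 [::] [:: 2; 17]%N 121 16 by vm_compute.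
  have dE : (if 3 == 1 then three_free 4 8 else 3 == 3)%N by [].
  have fb : factor_bound L 5 (5%:R / 121%:R).
    by apply: (trivial_bound qE' dimL' (erefl _) (isT : 0 < 121)%N); rewrite (@leq_exp2l 11 2 4).
  exact: (@run' 4 3 [::] [:: 2; 17]%N 121 16 5 _ (erefl _) pc dE fb numeric_8_4).
Qed.

Lemma small_case_eleven : s = 1%N -> n \in [:: 14; 16; 18; 22]%N -> goal.
Proof.
move=> s1; rewrite !inE => /or4P[] /eqP n_eq; have := run; have dimL' := dimL;
  have q11 : q = 11%N by [rewrite qE s1]; rewrite s1 n_eq in dimL' *; move=> run'.
- have pc : prime_check 1 14 [::] [:: 2; 43]%N 121 7 by vm_compute.
  have dE : (if 3 == 1 then three_free 1 14 else 3 == 3)%N by [].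
  have fb := @linear_bound F L 14 2 6 q11 dimL' (erefl _) (erefl _).
  exact: (@run' 4 3 [::] [:: 2; 43]%N 121 7 6 _ (erefl _) pc dE fb numeric_14_1).
- have pc : prime_check 1 16 [:: 2]%N [:: 17; 61]%N 121 8 by vm_compute.
  have dE : (if 3 == 1 then three_free 1 16 else 3 == 3)%N by [].
  have fb := @linear_bound F L 16 2 7 q11 dimL' (erefl _) (erefl _).
  exact: (@run' 5 3 [:: 2]%N [:: 17; 61]%N 121 8 7 _ (erefl _) pc dE fb numeric_16_1).
- have pc : prime_check 1 18 [:: 2]%N [:: 3; 7; 19; 37]%N 121 9 by vm_compute.
  have dE : (if 3 == 1 then three_free 1 18 else 3 == 3)%N by [].
  have fb := @linear_bound F L 18 2 8 q11 dimL' (erefl _) (erefl _).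
  exact: (@run' 6 3 [:: 2]%N [:: 3; 7; 19; 37]%N 121 9 8 _ (erefl _) pc dE fb numeric_18_1).
- have pc : prime_check 1 22 [:: 2]%N [:: 23; 89]%N 121 11 by vm_compute.
  have dE : (if 3 == 1 then three_free 1 22 else 3 == 3)%N by [].
  have fb := @linear_bound F L 22 2 10 q11 dimL' (erefl _) (erefl _).
  exact: (@run' 8 3 [:: 2]%N [:: 23; 89]%N 121 11 10 _ (erefl _) pc dE fb numeric_22_1).
Qed.

(** Here X^20 - 1 may have ten linear factors over the field with 11 elements, which rules
    out the union bound. *)
Lemma small_case_twenty : s = 1%N -> n = 20%N -> goal.
Proof.
move=> s1 n_eq; have q11 : q = 11%N by rewrite qE s1.
have fb := @linear_bound F L 20 10 13 q11 (etrans dimL n_eq) (erefl _) (erefl _).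
have pc : prime_check 1 20 [:: 2] [:: 5; 61]%N 121 10 by vm_compute.
have sn : (1 * 20 = 2 * (7 + 3 * 1))%N by [].
have qE1 : q = (11 ^ 1)%N by rewrite qE s1.
move: dimL n4 M3 hfactor; rewrite n_eq => dimL' n4' M3' hfactor'.
exact: (individual (d := 3) (exact_polys := true) qE1 dimL' n4' M3' hfactor' sn pc (erefl _) fb
  numeric_20_1).
Qed.

End SmallCases.

(** * Degree seven *)

(** The class of q modulo p is a root of 1 + X + ... + X^6. Either it is 1, and p = 7, or
    it has order 7 in the multiplicative group modulo p. *)
Lemma prime_seven_repunit (q p : nat) : (1 < q)%N -> prime p ->
  (p %| (q ^ 7 - 1) %/ (q - 1))%N -> (p == 7) || (p %% 14 == 1)%N.
Proof.
move=> q1 p_pr; have -> : ((q ^ 7 - 1) %/ (q - 1) = \sum_(i < 7) q ^ i)%N.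
  by rewrite !subn1 predn_exp mulKn // -subn1 subn_gt0.
move=> pQ; pose a : 'F_p := q%:R.
have sum0 : \sum_(i < 7) a ^+ i = 0.
  rewrite -[LHS](_ : (\sum_(i < 7) q ^ i)%:R = _); last first.
    by rewrite natr_sum; apply: eq_bigr => i _; rewrite natrX.
  by apply/eqP; rewrite -(dvdn_pcharf (pchar_Fp p_pr)).
have [a1|a1] := eqVneq a 1.
  have : (7%:R : 'F_p) == 0.
    rewrite -sum0 a1; under eq_bigr do rewrite expr1n.
    by rewrite sumr_const card_ord.
  by rewrite -(dvdn_pcharf (pchar_Fp p_pr)) dvdn_prime2 // => ->.
have a7 : a ^+ 7 = 1 by apply/eqP; rewrite -subr_eq0 subrX1 sum0 mulr0.
have a0 : a != 0 by apply: contraNneq (oner_neq0 'F_p) => a0; rewrite -a7 a0 expr0n.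
have ap : a ^+ p.-1 = 1.
  apply: (mulfI a0); rewrite -exprS mulr1 prednK ?prime_gt0 //.
  by have := expf_card a; rewrite card_Fp.
have [k kP k7] := prim_order_exists (isT : 0 < 7)%N a7.
have kp : (k %| p.-1)%N by rewrite (prim_order_dvd kP) ap.
have k_eq : k = 7%N.
  have /primeP[_ /(_ k k7) /orP[/eqP k1|/eqP//]] : prime 7 by [].
  by move: a1; rewrite -[a]expr1 -{1}k1 (prim_expr_order kP) eqxx.
rewrite k_eq in kp; have p0 := prime_gt1 p_pr.
have [p2|podd] := even_prime p_pr; first by move: kp; rewrite p2.
by apply/orP; right; move: kp podd p0; clear; lia.
Qed.

Lemma seven_small_numeric (X t : rat) (k : nat) : t <= 56%:R / 121%:R ->
  100%:R * k%:R < 31%:R * X ->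
  k%:R < X / 1%:R * 1 * 1 *
    (1 - \sum_(p <- [:: 7; 29; 43; 71; 113]%N) p%:R^-1 - t - 4%:R / 14641%:R).
Proof.
move=> ht hk; rewrite !(big_cons, big_nil).
have X0 : 0 < X by have := ler0n rat k; lra.
have hw : 31 / 100 <= 1 - (7%:R^-1 + (29%:R^-1 + (43%:R^-1 + (71%:R^-1 + (113%:R^-1 + 0)))))
     - t - 4%:R / 14641%:R :> rat by lra.
have hX := ler_wpM2l (ltW X0) hw.
lra.
Qed.

Lemma half_ratio (m : nat) : (0 < m)%N -> m%:R / (m * 2)%N%:R <= 1 / 2 :> rat.
Proof.
move=> m0; have mnz : m%:R != 0 :> rat by rewrite pnatr_eq0 -lt0n.
have -> : m%:R / (m * 2)%N%:R = 1 / 2 :> rat by rewrite natrM; field.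
exact: lexx.
Qed.

Lemma seven_tail_numeric (u : nat) (c t : rat) : (9 <= u)%N ->
  2^-1 ^+ u / (14 * u)%:R <= c -> t <= 1 / 2 ->
  (10 + 7 * u)%:R * (14%:R * u%:R) * 100%:R * 2%:R ^+ u < 49%:R * 11%:R ^+ u :> rat ->
  (1 + size ([::] : seq nat) + 7 * u + 4)%:R < 11 ^+ u / 1%:R * c * 1 *
    (1 - \sum_(p <- [::]) p%:R^-1 - t - 4%:R / 14641%:R) :> rat.
Proof.
move=> u9 hc ht pow; rewrite big_nil /= -natrM in pow *.
have k_le : ((1 + 0 + 7 * u + 4)%:R : rat) <= (10 + 7 * u)%:R by rewrite ler_nat; lia.
apply: le_lt_trans k_le _.
have w_ge : 49 / 100 <= 1 - 0 - t - 4%:R / 14641%:R by lra.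
have N0 : 0 < (14 * u)%:R :> rat by rewrite ltr0n; lia.
have P0 : 0 < 2%:R ^+ u :> rat by rewrite exprn_gt0 ?ltr0n.
rewrite exprVn in hc; move: (2%:R ^+ u) ((14 * u)%:R) (11%:R ^+ u) (pow11_ge0 u) P0 N0 hc pow
  => P N X X0 P0 N0 hc pow.
move: (_ - 4%:R / _) w_ge => w w_ge.
have c0 : 0 < P^-1 / N by rewrite divr_gt0 ?invr_gt0.
have h49 : 0 <= 49 / 100 :> rat by lra.
have h100 : 0 < 100 :> rat by lra.
have h1 : X * (P^-1 / N) * (49 / 100) <= X * c * w :=
  ler_pM (mulr_ge0 X0 (ltW c0)) h49 (ler_wpM2l X0 hc) w_ge.
have -> : X / 1%:R * c * 1 * w = X * c * w by field.
apply: lt_le_trans h1.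
have NP : 0 < N * P * 100 := mulr_gt0 (mulr_gt0 N0 P0) h100.
rewrite -(ltr_pM2r NP).
have -> : X * (P^-1 / N) * (49 / 100) * (N * P * 100) = 49%:R * X.
  by field; rewrite !gt_eqF.
lra.
Qed.

Section DegreeSeven.

Variables (F : finFieldType) (L : fieldExtType F) (u : nat).
Local Notation q := #|F|.
Local Notation goal := (exists a : L, r_primitive 3 a /\ k_normal 3 a).
Local Notation Q := (((11 ^ (2 * u)) ^ 7 - 1) %/ (11 ^ (2 * u) - 1))%N.
Hypotheses (qE : q = (11 ^ (2 * u))%N) (dimL : \dim {:L} = 7%N) (u2 : (2 <= u)%N).
Hypothesis M3 : (3 %| q ^ 7 - 1)%N.
Hypothesis hfactor : exists p : {poly F}, size p = 4%N /\ p %| 'X^7 - 1.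

Let q1 : (1 < 11 ^ (2 * u))%N. Proof. by rewrite -qE finNzRing_gt1. Qed.

Lemma seven_base : base3 Q = 1%N.
Proof.
rewrite /base3; case: ifP => // Q3.
by have := prime_seven_repunit q1 (isT : prime 3) Q3.
Qed.

Lemma seven_cofactor_dvd : (Q %/ base3 Q %| 11 ^ (14 * u) - 1)%N.
Proof.
have := @cofactor_dvd F L (2 * u)%N qE; rewrite dimL qE.
by rewrite (_ : (2 * u * 7 = 14 * u)%N) //; clear; lia.
Qed.

Lemma seven_cofactor_gt0 : (0 < Q %/ base3 Q)%N.
Proof. by have := @cofactor_gt0 F L; rewrite dimL qE. Qed.

Lemma seven_primes p : prime p -> (p %| Q %/ base3 Q)%N -> (p == 7) || (p %% 14 == 1)%N.
Proof. by rewrite seven_base divn1; apply: prime_seven_repunit. Qed.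

Let fb : factor_bound L 4 (4%:R / 14641%:R).
Proof.
apply: (@trivial_bound F L (2 * u) 7 4 14641 qE dimL (erefl _) isT).
by rewrite -[14641%N]/(11 ^ 4)%N leq_exp2l //; move: u2; clear; lia.
Qed.

Lemma seven_finish (ls us : seq nat) (t : nat) B :
  prime_data (Q %/ base3 Q) ls us B t ->
  numeric_ok u 1 ls us B t 4 (4%:R / 14641%:R) -> goal.
Proof.
move=> pd num.
have pd' : prime_data ((q ^ \dim {:L} - 1) %/ (q - 1) %/ base3 ((q ^ \dim {:L} - 1) %/ (q - 1))) ls us B t.
  by rewrite dimL qE.
have bd : (base3 ((q ^ \dim {:L} - 1) %/ (q - 1)) <= 1)%N by rewrite dimL qE seven_base.
have n4 : (4 <= \dim {:L})%N by rewrite dimL.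
have sn : (2 * u * \dim {:L} = 2 * (u + 3 * (2 * u)))%N by rewrite dimL; clear; lia.
have M3' : (3 %| q ^ \dim {:L} - 1)%N by rewrite dimL.
have hf : exists p : {poly F}, size p = 4%N /\ p %| 'X^(\dim {:L}) - 1 by rewrite dimL.
exact: (@sieve_setup F L 1 ls us B t (2 * u) u 4 _ (5 / 11) false qE sn n4 M3' hf bd pd' fb
  five_elevenths num).
Qed.

(** The number Q is less than 121^(7 u + 1), and [prime_seven_repunit] leaves only five
    possible primes below 121. *)
Lemma seven_small : (u <= 8)%N -> goal.
Proof.
move=> u8; pose us := [:: 7; 29; 43; 71; 113]%N.
apply: (@seven_finish [::] us (7 * u) 121).
  split=> //.
    rewrite /=; apply: (@leq_trans (11 ^ (14 * u))).
      apply: leq_ltn_trans (dvdn_leq _ seven_cofactor_dvd) _.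
        by rewrite subn_gt0 -[1%N](expn0 11) ltn_exp2l //; move: u2; clear; lia.
      by rewrite ltn_subrL expn_gt0.
    by rewrite -[121%N]/(11 ^ 2)%N -expnM leq_exp2l //; clear; lia.
  have cov : all (fun p => prime p && ((p == 7) || (p %% 14 == 1)) ==> (p \in us))%N (iota 0 121).
    by vm_compute.
  move=> p p_pr pQ pB; move/allP: cov => /(_ p); rewrite mem_iota add0n pB => /(_ isT).
  by rewrite p_pr (seven_primes p_pr pQ).
have t56 : (7 * u <= 56)%N by move: u8; clear; lia.
have ht := @nat_ratio_le _ _ 121 (56%:R / 121%:R) isT t56 (lexx _).
have pow : (100 * (1 + 5 + 7 * u + 4) < 31 * 11 ^ u)%N.
  by move: u8 u2; clear; case: u => [|[|[|[|[|[|[|[|[|[]]]]]]]]]] //= _ _; lia.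
rewrite -(ltr_nat rat) natrM [X in _ < X]natrM natrX in pow.
rewrite /numeric_ok big_nil; exact: (seven_small_numeric ht pow).
Qed.

(** Among 14 k + 1, ..., 14 k + 14 at most one can be a prime of Q, so that sieving all
    primes below 14 u exactly costs a factor 2^u and a little more, against 11^u. *)
Lemma seven_tail : (9 <= u)%N -> goal.
Proof.
move=> u9; have N1 : (1 < 14 * u)%N by move: u9; clear; lia.
have N0 : (0 < 14 * u)%N := ltnW N1.
have NB : (11 ^ (14 * u) <= (14 * u) ^ (7 * u).+1)%N.
  apply: (@leq_trans (11 ^ (2 * (7 * u).+1))); first by rewrite leq_exp2l //; clear; lia.
  by rewrite expnM leq_exp2r // -[(11 ^ 2)%N]/121%N; move: u9; clear; lia.
have pd := prime_data_all seven_cofactor_dvd seven_cofactor_gt0 N0 N1 NB.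
apply: (seven_finish pd); set ls := [seq p <- primes _ | _].
have uls : uniq ls by rewrite filter_uniq ?primes_uniq.
have lsP p : p \in ls -> [/\ prime p, (p < 14 * u)%N & (p == 7) || (p %% 14 == 1)%N].
  rewrite mem_filter mem_primes => /andP[pN /and3P[p_pr _ pQ]].
  by split=> //; exact: seven_primes.
have size_ls : (size ls <= u)%N.
  rewrite -(size_map (fun p => (p - 1) %/ 14)%N) -[leqRHS](size_iota 0).
  apply: uniq_leq_size.
    rewrite map_inj_in_uniq // => p p' /lsP[p_pr _ o] /lsP[p'_pr _ o'].
    have p1 : (p != 1)%N by apply: contraTneq p_pr => ->.
    have p1' : (p' != 1)%N by apply: contraTneq p'_pr => ->.
    by move: o o' p1 p1'; clear; lia.
  move=> _ /mapP[p /lsP[p_pr pN _] ->]; rewrite mem_iota /= add0n.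
  by move: pN (prime_gt1 p_pr); clear; lia.
have c_ge : 2^-1 ^+ u / (14 * u)%:R <= \prod_(p <- ls) half_loss p.
  apply: prod_half_loss_ge => //.
  by apply/allP=> p /lsP[/prime_gt1-> ->].
have pow : ((10 + 7 * u) * (14 * u) * 100 * 2 ^ u < 49 * 11 ^ u)%N.
  move: u9; clear; elim: u => // v IH; rewrite leq_eqVlt => /predU1P[<-|v9]; first by lia.
  have {}IH := IH v9; rewrite (expnS 11) (expnS 2).
  have step : (2 * ((10 + 7 * v.+1) * (14 * v.+1)) <= 11 * ((10 + 7 * v) * (14 * v)))%N.
    by move: v9; clear; nia.
  move: (2 ^ v)%N (11 ^ v)%N IH step => a b; move: ((10 + 7 * v.+1) * _)%N (_ * (14 * v))%N.
  clear; nia.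
have ht : (7 * u)%:R / (14 * u)%:R <= 1 / 2 :> rat.
  rewrite (_ : 14 * u = 7 * u * 2)%N; last by clear; lia.
  by apply: half_ratio; move: u9; clear; lia.
rewrite -(ltr_nat rat) !natrM !natrX in pow.
rewrite /numeric_ok; exact: (seven_tail_numeric u9 c_ge ht pow).
Qed.

Lemma case_degree_seven : goal.
Proof. by case: (leqP u 8) => [/seven_small|/seven_tail]. Qed.

End DegreeSeven.

(** * All pairs but two *)

Lemma numeric_12_1 (B : nat) : numeric_ok 3 3 [:: 2; 3]%N [:: 7; 13; 19; 37; 61; 1117]%N B 0 5
  (2%:R / 11 + (9%:R - 2%:R) / (2 * 11 ^+ 2)).
Proof. by rewrite /numeric_ok /half_loss !(big_cons, big_nil) [size _]/= mul0r; lra. Qed.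

Lemma N_of_muln (a b : nat) :
  BinNat.N.of_nat (a * b)%N = BinNat.N.mul (BinNat.N.of_nat a) (BinNat.N.of_nat b).
Proof. exact: Nnat.Nat2N.inj_mul. Qed.

Lemma eq_of_N (a b : nat) (c : BinNums.N) :
  BinNat.N.of_nat a = c -> BinNat.N.of_nat b = c -> a = b.
Proof. by move=> <- /Nnat.Nat2N.inj. Qed.

Lemma cofactorN_twelve :
  BinNat.N.of_nat (2 * (2 * (2 * (3 * (7 * (13 * (19 * (37 * (61 * 1117)))))))))%N
  = cofactorN (BinNat.N.of_nat 1) (BinNat.N.of_nat 12).
Proof. by rewrite !N_of_muln; vm_compute. Qed.

Lemma cofactor_twelve (Q := (((11 ^ 1) ^ 12 - 1) %/ (11 ^ 1 - 1))%N) :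
  (Q %/ base3 Q = 2 * (2 * (2 * (3 * (7 * (13 * (19 * (37 * (61 * 1117)))))))))%N.
Proof. exact: eq_of_N (cofactorN_correct 1 12) cofactorN_twelve. Qed.

Lemma prime_1117 : prime 1117. Proof. by vm_compute. Qed.

Lemma prime_data_product (m : nat) : (0 < m)%N ->
  m = (2 * (2 * (2 * (3 * (7 * (13 * (19 * (37 * (61 * 1117)))))))))%N ->
  prime_data m [:: 2; 3]%N [:: 7; 13; 19; 37; 61; 1117]%N m.+1 0.
Proof.
move=> m0 mE; split=> //; first by rewrite ltnS m0 expn1 ltnS leqnn.
move=> p p_pr pm _; rewrite mE in pm; move: pm; clear m0 mE.
rewrite !Euclid_dvdM // !dvdn_prime2 ?prime_1117 // !inE.
by do ?case: eqP.
Qed.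

Section Main.

Variables (F : finFieldType) (L : fieldExtType F) (s : nat).
Local Notation q := #|F|.
Local Notation n := (\dim {:L}).
Local Notation goal := (exists a : L, r_primitive 3 a /\ k_normal 3 a).
Hypotheses (qE : q = (11 ^ s)%N) (s_gt0 : (0 < s)%N) (n7 : (7 <= n)%N).
Hypothesis M3 : (3 %| q ^ n - 1)%N.
Hypothesis hfactor : exists p : {poly F}, size p = 4%N /\ p %| 'X^n - 1.

Let n4 : (4 <= n)%N. Proof. exact: leq_trans n7. Qed.

(** The main term 11^3 is too small to allow for unknown primes, so the cofactor is
    factored completely: with B greater than it, t = 0. *)
Lemma case_twelve : s = 1%N -> n = 12%N -> goal.
Proof.
move=> s1 n12; have qE1 : q = (11 ^ 1)%N by rewrite qE s1.
have q11 : q = 11%N by rewrite qE1.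
have fb := @linear_bound F L 12 2 5 q11 n12 (erefl _) (erefl _).
have m0 := @cofactor_gt0 F L.
have mE : ((q ^ n - 1) %/ (q - 1) %/ base3 ((q ^ n - 1) %/ (q - 1)) =
    2 * (2 * (2 * (3 * (7 * (13 * (19 * (37 * (61 * 1117)))))))))%N.
  by rewrite n12 qE1; exact: cofactor_twelve.
have pd := prime_data_product m0 mE.
have dd : (base3 ((q ^ n - 1) %/ (q - 1)) <= 3)%N by rewrite /base3; case: ifP.
have sn : (1 * n = 2 * (3 + 3 * 1))%N by rewrite n12.
move: m0 mE pd dd; set m := ((q ^ n - 1) %/ (q - 1) %/ _)%N => _ _ pd dd.
exact: (@sieve_setup F L 3 [:: 2; 3]%N [:: 7; 13; 19; 37; 61; 1117]%N m.+1 0 1 3 5 _ (5 / 11)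
  false qE1 sn n4 M3 hfactor dd pd fb five_elevenths (numeric_12_1 m.+1)).
Qed.

(** What [case_large_degree], [case_union] and [case_medium_degree] leave is the degree
    n = 7, which [case_degree_seven] covers except for s = 2, and a finite list. *)
Lemma all_but_two : (s, n) \notin [:: (1, 8); (1, 10)]%N -> goal.
Proof.
rewrite !inE negb_or !xpair_eqE => not_small.
have [k sn] := even_exponent qE M3.
have [big|small] := boolP (if s == 1%N then 42 <= n else 21 <= n)%N.
  exact: case_large_degree big.
have [s1|s1] := eqVneq s 1%N.
  have ev : ~~ odd n by move: sn; rewrite s1; clear; lia.
  have nlist : n \in [:: 12; 14; 16; 18; 20; 22; 24; 26; 28; 30; 32; 34; 36; 38; 40]%N.
    move: small not_small ev n7; rewrite s1 /= !inE; clear; lia.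
  have [n22|n22] := leqP n 22.
    have [n12|n12] := eqVneq n 12%N; first exact: case_twelve.
    have [n20|n20] := eqVneq n 20%N.
      by apply: (small_case_twenty qE (erefl n)).
    apply: (small_case_eleven qE (erefl n)) => //.
    by move: nlist n22 n12 n20; rewrite !inE; clear; lia.
  have {nlist}nlist : n \in [:: 24; 26; 28; 30; 32; 34; 36; 38; 40]%N.
    by move: nlist n22; rewrite !inE; clear; lia.
  apply: (case_medium_degree qE s_gt0 n7 M3 hfactor s1 ev).
    by move: nlist; rewrite !inE; move: (n) => m; do ?[case/predU1P => [->|]] => // /eqP->.
  move: nlist; rewrite !inE; move: (n) => m.
  do ?[case/predU1P => [->|]]; try by apply: range_split.
  by move/eqP => ->; apply: range_split.
have s2 : (2 <= s)%N by move: s_gt0 s1; clear; lia.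
have n20 : (n <= 20)%N by move: small; rewrite (negbTE s1) -ltnNge ltnS.
have [n_eq7|n8] := eqVneq n 7%N.
  have [u u2] : exists u, s = (2 * u)%N.
    by exists s./2; move: sn; rewrite n_eq7; clear; lia.
  have [u_1|u_2] := eqVneq u 1%N.
    by apply: (small_case_squared qE (erefl n)); rewrite // ?u2 ?u_1 ?n_eq7.
  have qE2 := qE; rewrite u2 in qE2; apply: (case_degree_seven qE2 n_eq7).
  - by move: u_2 s_gt0; rewrite u2; clear; lia.
  - by rewrite -n_eq7.
  by rewrite -n_eq7.
have n820 : (8 <= n <= 20)%N by rewrite n20 andbT; move: n7 n8; clear; lia.
have [big|few] := leqP 10 (s * (n - 6)); first exact: case_union n820 big.
have [s_2|s_2] := eqVneq s 2%N.
  apply: (small_case_squared qE (erefl n)) => //.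
  by move: few n820; rewrite s_2 !inE; clear; lia.
have n_8 : n = 8%N.
  have n9 : (n <= 9)%N.
    have : (3 * (n - 6) <= s * (n - 6))%N by rewrite leq_mul2r; move: s2 s_2; clear; lia.
    by move: few; clear; lia.
  have [n_9|] := eqVneq n 9%N; last by move: n9 n820; clear; lia.
  by move: few sn s2 s_2; rewrite n_9; clear; lia.
apply: (small_case_eight qE (erefl n)) => //.
by move: few s2 s_2; rewrite n_8 !inE; clear; lia.
Qed.

End Main.

(** * Arithmetic in an explicit field *)

Section ListArithmetic.

Variables (n : nat) (R : seq nat).

Fixpoint addl (a b : seq nat) : seq nat :=
  match a, b with
  | [::], _ => b
  | _, [::] => a
  | x :: a', y :: b' => ((x + y) %% 11)%N :: addl a' b'
  end.

Definition scalel (c : nat) (a : seq nat) := [seq (c * x) %% 11 | x <- a]%N.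

(** Lists of residues modulo 11, constant coefficient first, represent the
    elements of a ring generated by x with x^n = R(x). *)
Definition mulXl (a : seq nat) := addl (0%N :: take n.-1 a) (scalel (nth 0%N a n.-1) R).

Definition mull (a b : seq nat) := foldr (fun c r => addl (scalel c b) (mulXl r)) [::] a.

Fixpoint powl_pos (a : seq nat) (e : BinNums.positive) : seq nat :=
  match e with
  | BinNums.xH => a
  | BinNums.xO e' => let b := powl_pos a e' in mull b b
  | BinNums.xI e' => let b := powl_pos a e' in mull a (mull b b)
  end.

Definition powl (a : seq nat) (e : BinNums.N) : seq nat :=
  match e with BinNums.N0 => [:: 1%N] | BinNums.Npos e' => powl_pos a e' end.

Fixpoint actl (g : seq nat) (a : seq nat) : seq nat :=
  match g with
  | [::] => [::]
  | c :: g' => addl (scalel c a) (actl g' (powl a (BinNat.N.of_nat 11)))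
  end.

Definition actl_seq (gs : seq (seq nat)) (a : seq nat) := foldr actl a gs.

Definition all_zero (a : seq nat) := all (eq_op^~ 0%N) a.
Definition is_one (a : seq nat) := (head 0%N a == 1%N) && all_zero (behead a).

Variables (A : comNzRingType) (x : A).
Hypotheses (A11 : 11%:R = 0 :> A) (n_gt0 : (0 < n)%N) (sR : (size R <= n)%N).

Definition evl (a : seq nat) : A := foldr (fun c r => c%:R + x * r) 0 a.

Hypothesis xn : x ^+ n = evl R.

Lemma natr_mod11 c : (c %% 11)%:R = c%:R :> A.
Proof. by rewrite {2}(divn_eq c 11) natrD natrM A11 mulr0 add0r. Qed.

Lemma evl_add a b : evl (addl a b) = evl a + evl b.
Proof.
elim: a b => [|c a IH] [|d b] /=; rewrite ?add0r ?addr0 //.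
by rewrite IH natr_mod11 natrD; ring.
Qed.

Lemma evl_scale c a : evl (scalel c a) = c%:R * evl a.
Proof.
by elim: a => [|d a IH] /=; rewrite ?mulr0 // IH natr_mod11 natrM; ring.
Qed.

Lemma size_addl a b : size (addl a b) = maxn (size a) (size b).
Proof. by elim: a b => [|c a IH] [|d b] //=; rewrite ?max0n ?maxn0 // IH maxnSS. Qed.

Lemma size_scalel c a : size (scalel c a) = size a.
Proof. exact: size_map. Qed.

Lemma size_mulXl a : (size (mulXl a) <= n)%N.
Proof.
rewrite size_addl size_scalel /= geq_max sR andbT size_take.
by move: n_gt0; clear; case: ifP; lia.
Qed.

Lemma evl_take a : (size a <= n)%N ->
  evl a = evl (take n.-1 a) + (nth 0%N a n.-1)%:R * x ^+ n.-1.
Proof.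
move: n n_gt0 => [//|m] _ /=; elim: a m => [|c a IH] [|m] //=.
- by rewrite mul0r addr0.
- by rewrite mul0r addr0.
- by case: a {IH} => // _; rewrite mulr0 addr0 add0r mulr1.
by rewrite ltnS => /IH ->; rewrite exprS; ring.
Qed.

Lemma evl_mulX a : (size a <= n)%N -> evl (mulXl a) = x * evl a.
Proof.
move=> sa; rewrite evl_add evl_scale -xn (evl_take sa) /= add0r mulrDr.
by congr (_ + _); rewrite mulrCA -exprS prednK.
Qed.

Lemma mull_correct a b : (size b <= n)%N ->
  (size (mull a b) <= n)%N /\ evl (mull a b) = evl a * evl b.
Proof.
move=> sb; elim: a => [|c a [IHs IH]] /=; first by rewrite mul0r.
rewrite size_addl size_scalel geq_max sb size_mulXl; split=> //.
by rewrite evl_add evl_scale evl_mulX // IH; ring.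
Qed.

Lemma powl_correct a (k : nat) : (size a <= n)%N ->
  (size (powl a (BinNat.N.of_nat k)) <= n)%N /\ evl (powl a (BinNat.N.of_nat k)) = evl a ^+ k.
Proof.
move=> sa; rewrite -[k in _ ^+ k]Nnat.Nat2N.id; case: (BinNat.N.of_nat k) => [|e] /=.
  by rewrite mulr0 addr0.
elim: e => [e [IHs IH]|e [IHs IH]|] /=.
- have [s1 e1] := mull_correct (powl_pos a e) IHs.
  have [s2 ->] := mull_correct a s1; split=> //.
  rewrite e1 IH Pnat.Pos2Nat.inj_xI exprS; congr (_ * _).
  by rewrite -expr2 -exprM mulnC.
- have [s1 ->] := mull_correct (powl_pos a e) IHs; split=> //.
  by rewrite IH Pnat.Pos2Nat.inj_xO -expr2 -exprM mulnC.
by split.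
Qed.

Lemma evl_zero a : all_zero a -> evl a = 0.
Proof. by elim: a => //= c a IH /andP[/eqP-> /IH->]; rewrite mulr0 addr0. Qed.

Lemma evl_one a : is_one a -> evl a = 1.
Proof.
case: a => [|c a] /andP[/eqP /= c1 z]; first by [].
by rewrite c1 (evl_zero z) mulr0 addr0.
Qed.

End ListArithmetic.

Section Explicit.

Variables (F : finFieldType) (L : fieldExtType F).
Local Notation q := #|F|.
Hypothesis q11 : q = 11%N.

Let F11 : 11%:R = 0 :> F.
Proof.
have pF : 11%N \in [pchar F] by apply: (@card_finPcharP F 11 1); rewrite ?q11.
exact: pcharf0 pF.
Qed.

Let L11 : 11%:R = 0 :> L.
Proof. by rewrite -(rmorph_nat (in_alg L)) F11 rmorph0. Qed.

Variables (n : nat) (R : seq nat).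
Hypotheses (dimL : \dim {:L} = n) (n_gt1 : (1 < n)%N) (sR : (size R <= n)%N).
Local Notation M := (11 ^ n - 1)%N.
Local Notation gen := [:: 0%N; 1%N].

(** In the quotient of L[X] by P = X^n - R the order of X divides 11^n - 1, so P divides
    X^(11^n) - X, which splits in L: a root exists without knowing whether P is
    irreducible. *)
Lemma root_exists (m : nat) : (m %| M)%N -> (0 < m)%N ->
  is_one (powl n R gen (BinNat.N.of_nat m)) -> exists a : L, a ^+ n = evl a R.
Proof.
move=> mM m0 one; pose P : {poly L} := 'X^n - evl 'X R.
have sevl : (size (evl 'X R : {poly L}) <= size R)%N.
  elim: (R) => [|c a IH] /=; first by rewrite size_poly0.
  apply: leq_trans (size_polyD _ _) _; rewrite geq_max.
  rewrite -(rmorph_nat (@polyC L)) (leq_trans (size_polyC_leq1 _)) //= mulrC.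
  have [->|nz] := eqVneq (evl 'X a : {poly L}) 0; first by rewrite mul0r size_poly0.
  by rewrite size_mulX.
have sP : size P = n.+1.
  by rewrite size_polyDl size_polyXn // size_polyN ltnS (leq_trans sevl).
have mP : P \is monic.
  rewrite monicE lead_coefDl ?lead_coefXn // size_polyN size_polyXn ltnS.
  exact: leq_trans sevl sR.
have PE : mk_monic P = P by rewrite /mk_monic sP ltnS (ltnW n_gt1) mP.
pose pi : {rmorphism {poly L} -> {poly %/ P}} := in_qpoly P; pose x := pi 'X.
have pi_eq0 p : (pi p == 0) = (P %| p).
  by apply/eqP/idP => [/val_eqP /=|dP]; last apply/val_eqP;
    rewrite /= -Pdiv.IdomainMonic.modpE ?PE.
have evlE a : evl x a = pi (evl 'X a).
  by elim: a => [|c a IH] /=; rewrite ?rmorph0 // rmorphD rmorphM rmorph_nat IH.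
have A11 : 11%:R = 0 :> {poly %/ P}.
  rewrite -(rmorph_nat pi) -(rmorph_nat (@polyC L)) L11 !rmorph0 //.
have xn : x ^+ n = evl x R.
  by rewrite evlE -rmorphXn; apply/eqP; rewrite -subr_eq0 -rmorphB pi_eq0.
have [_ pw] := powl_correct A11 (ltnW n_gt1) sR xn m (n_gt1 : (size gen <= n)%N).
rewrite (evl_one x one) /= !mulr0 !addr0 add0r mulr1 in pw.
have : P %| 'X^m - 1 by rewrite -pi_eq0 rmorphB rmorphXn rmorph1 -/x -pw subrr.
have XM : 'X^m - 1 %| ('X^M - 1 : {poly L}).
  by case/dvdnP: mM => c ->; rewrite mulnC exprM [X in _ %| X]subrX1 dvdp_mulr.
move=> /dvdp_trans /(_ XM) PXM.
have qn_gt0 : (0 < 11 ^ n)%N by rewrite expn_gt0.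
have : P %| \prod_(y : finvect_type L) ('X - (y : L)%:P).
  have <- := finField_genPoly (finvect_type L); rewrite card_K q11 dimL.
  have -> : 'X^(11 ^ n) - 'X = 'X * ('X^M - 1) :> {poly L}.
    by rewrite mulrBr mulr1 -exprS subn1 prednK.
  by apply: dvdp_trans PXM _; apply: dvdp_mulIr.
case/dvdp_prod_XsubC => mk eqPr; have := eqp_size eqPr; rewrite sP.
set r := mask mk _ in eqPr *; case: r eqPr => [|a r] eqPr.
  by rewrite big_nil size_poly1; case: (n) n_gt1.
move=> _; exists a; have : root P a by rewrite (eqp_root eqPr) big_cons rootM root_XsubC eqxx.
rewrite rootE !hornerE subr_eq0 => /eqP ->.
elim: (R) => [|c l IH] /=; first by rewrite horner0.
by rewrite hornerD hornerM hornerX IH -(rmorph_nat (@polyC L)) hornerC.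
Qed.

(** Being nonzero in L is certified by the power 11^n - 1 being 1, a computation which
    remains valid for any root of P in L. *)
Definition nonzero_ok (a : seq nat) :=
  is_one (powl n R a (BinNat.N.sub (BinNat.N.pow (BinNat.N.of_nat 11) (BinNat.N.of_nat n))
                                   (BinNat.N.of_nat 1))).

(** The four tests say, for m = (11^n - 1) / 3: x^m = 1; x^(m / r) differs from 1 for
    r in pf (10 stands for -1); the product of gs annihilates x; the product
    of all but one of them does not. *)
Definition explicit_ok (gs : seq (seq nat)) (pf : seq nat) : bool :=
  let m := BinNat.N.div (BinNat.N.sub (BinNat.N.pow (BinNat.N.of_nat 11) (BinNat.N.of_nat n))
                                   (BinNat.N.of_nat 1)) (BinNat.N.of_nat 3) in
  [&& is_one (powl n R gen m),
      all (fun r => nonzero_ok (addl (powl n R gen (BinNat.N.div m (BinNat.N.of_nat r))) [:: 10%N])) pf,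
      all_zero (actl_seq n R gs gen)
    & all (fun i => nonzero_ok (actl_seq n R (take i gs ++ drop i.+1 gs) gen))
          (iota 0 (size gs))].

Let N_of_M : BinNat.N.sub (BinNat.N.pow (BinNat.N.of_nat 11) (BinNat.N.of_nat n))
   (BinNat.N.of_nat 1) = BinNat.N.of_nat M.
Proof. by rewrite Nnat.Nat2N.inj_sub N_of_expn. Qed.

Lemma actl_correct (x : L) (g a : seq nat) : x ^+ n = evl x R -> (size a <= n)%N ->
  (size (actl n R g a) <= n)%N /\ evl x (actl n R g a) = act (evl 'X g) (evl x a).
Proof.
move=> xn; elim: g a => [|c g IH] a sa /=; first by rewrite act0.
have [sp ep] := powl_correct L11 (ltnW n_gt1) sR xn 11 sa.
have [sg eg] := IH _ sp.
rewrite size_addl size_scalel geq_max sa sg; split=> //.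
rewrite evl_add // evl_scale // eg ep actD -(rmorph_nat (@polyC F)) actC scaler_nat mulr_natl.
by rewrite mulrC actMX -act_frob /frob q11.
Qed.

Lemma actl_seq_correct (x : L) (gs : seq (seq nat)) (a : seq nat) :
  x ^+ n = evl x R -> (size a <= n)%N ->
  (size (actl_seq n R gs a) <= n)%N /\
  evl x (actl_seq n R gs a) = act (\prod_(g <- gs) evl 'X g) (evl x a).
Proof.
move=> xn sa; elim: gs => [|g gs [IHs IH]] /=; first by rewrite big_nil actC scale1r.
have [s1 e1] := actl_correct g xn IHs.
by rewrite big_cons actM -IH.
Qed.

Lemma nonzero_okP (x : L) (a : seq nat) : x ^+ n = evl x R -> (size a <= n)%N ->
  nonzero_ok a -> evl x a != 0.
Proof.
move=> xn sa; rewrite /nonzero_ok N_of_M => /(evl_one x) one.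
have [_ pw] := powl_correct L11 (ltnW n_gt1) sR xn M sa.
apply: contraNneq (oner_neq0 L) => a0; rewrite -one pw a0 expr0n gtn_eqF //.
by rewrite subn_gt0 -[1%N](expn0 11) ltn_exp2l // ltnW.
Qed.

(** The first two tests give the order of x, the last two the hypotheses of
    [k_normal_criterion]. *)
Lemma explicit_witness (gs : seq (seq nat)) (f : {poly F}) (pf : seq nat) :
  (4 <= n)%N -> (3 %| M)%N -> (forall r, prime r -> (r %| M %/ 3)%N -> r \in pf) ->
  f * \prod_(g <- gs) evl 'X g = 'X^n - 1 -> size f = 4%N ->
  (forall g, g \in gs -> irreducible_poly (evl 'X g : {poly F})) ->
  explicit_ok gs pf ->
  exists a : L, r_primitive 3 a /\ k_normal 3 a.
Proof.
move=> n4 M3 primes_m fh sf irr_gs; rewrite /explicit_ok N_of_M -N_of_divn.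
set m := (M %/ 3)%N => /and4P[one /allP ord zero /allP rest].
have M0 : (0 < M)%N by rewrite subn_gt0 -[1%N](expn0 11) ltn_exp2l // ltnW.
have mM : (m %| M)%N by rewrite -(divnK M3) dvdn_mulr.
have m0 : (0 < m)%N := dvdn_gt0 M0 mM.
have [x xn] := root_exists mM m0 one.
have sgen : (size gen <= n)%N by [].
have evl_gen : evl x gen = x by rewrite /= mulr0 addr0 mulr1 add0r.
have pw k := powl_correct L11 (ltnW n_gt1) sR xn k sgen.
have xm : x ^+ m = 1.
  by have [_ pm] := pw m; rewrite evl_gen (evl_one x one) in pm; rewrite -pm.
exists x; split.
  rewrite /r_primitive q11 dimL; split=> //; rewrite -/m.
  have [k kP km] := prim_order_exists m0 xm.
  have [<-//|neq] := eqVneq k m; exfalso.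
  have k0 : (0 < k)%N := dvdn_gt0 m0 km.
  have mk1 : (1 < m %/ k)%N.
    rewrite ltn_neqAle divn_gt0 // (dvdn_leq m0 km) andbT.
    by apply: contra neq => /eqP e; rewrite -(divnK km) -e mul1n.
  pose r := pdiv (m %/ k); have r_pr : prime r := pdiv_prime mk1.
  have rmk : (r %| m %/ k)%N := pdiv_dvd _.
  have rm : (r %| m)%N.
    by rewrite -(divnK km) dvdn_mulr.
  have kmr : (k %| m %/ r)%N. by rewrite dvdn_divRL // mulnC -dvdn_divRL.
  have := ord r (primes_m r r_pr rm).
  rewrite -N_of_divn; move: (pw (m %/ r)%N).
  set b := powl _ _ _ _; rewrite evl_gen => -[sb eb] nz.
  have sb' : (size (addl b [:: 10%N]) <= n)%N by rewrite size_addl geq_max sb (leq_trans _ n4).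
  have := nonzero_okP xn sb' nz; rewrite evl_add // eb.
  rewrite (eqP (_ : x ^+ (m %/ r) == 1)); last by rewrite -(prim_order_dvd kP).
  by rewrite /= mulr0 addr0 -(natrD _ 1 10) L11 eqxx.
apply: (k_normal_criterion (h := \prod_(g <- gs) evl 'X g) _ sf); rewrite ?dimL //.
- by rewrite -ltnS subn1 prednK ?(leq_trans _ n4).
- have [_] := actl_seq_correct gs xn sgen.
  by rewrite evl_gen => <-; rewrite (evl_zero x zero).
move=> p irr_p ph.
have [i ilt pi] : exists2 i, (i < size gs)%N & p %= evl 'X (nth [::] gs i).
  move: irr_gs ph; clear - irr_p; elim: gs => [|g gs IH] irr.
    by rewrite big_nil dvdp1 => /eqP s1; case: irr_p; rewrite s1.
  rewrite big_cons => pgs; have [pg|npg] := boolP (p %| evl 'X g).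
    exists 0%N => //; apply: (irr g _).2 => //; first by rewrite inE eqxx.
    by case: irr_p => p1 _; rewrite gtn_eqF.
  have cop : coprimep p (evl 'X g) by rewrite irreducible_poly_coprime.
  rewrite Gauss_dvdpr // in pgs.
  have [j jlt pj] := IH (fun g' hg' => irr g' (@mem_behead _ (g :: gs) g' hg')) pgs.
  by exists j.+1.
set h := \prod_(g <- gs) _ in ph *.
pose c := \prod_(g <- take i gs ++ drop i.+1 gs) (evl 'X g : {poly F}).
have hE : h = c * evl 'X (nth [::] gs i).
  rewrite /h /c -{1}(cat_take_drop i gs) (drop_nth [::] ilt) !big_cat big_cons /=.
  by rewrite mulrCA mulrC.
have p0 : p != 0 by rewrite irredp_neq0.
have := nonzero_okP xn _ (rest i _); rewrite mem_iota add0n ilt.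
have [-> ->] := actl_seq_correct (take i gs ++ drop i.+1 gs) xn sgen.
move=> /(_ isT isT); apply: contra_neq; rewrite evl_gen -/c => hp0.
have : h %/ p %| c.
  by rewrite -(dvdp_mul2r _ _ p0) divpK // hE dvdp_mul ?dvdpp // -(eqp_dvdl _ pi) dvdpp.
by move/act_dvd; apply.
Qed.

End Explicit.

(** * The fields with 11^8 and 11^10 elements *)

Lemma prime_dvd_foldr (r : nat) (s : seq nat) : prime r -> all prime s ->
  (r %| foldr muln 1%N s)%N -> r \in s.
Proof.
move=> r_pr; elim: s => [_|p s IH /andP[p_pr ps]] /=.
  by rewrite dvdn1 => /eqP r1; rewrite r1 in r_pr.
rewrite Euclid_dvdM // inE dvdn_prime2 // => /orP[->//|/IH->] //.
exact: orbT.
Qed.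

Definition primes8 := [:: 2; 2; 2; 2; 2; 5; 61; 7321]%N.
Definition primes10 := [:: 2; 2; 2; 5; 5; 3221; 13421]%N.

Lemma primes8_prime : all prime primes8. Proof. by vm_compute. Qed.
Lemma primes10_prime : all prime primes10. Proof. by vm_compute. Qed.

Definition prodN (s : seq nat) :=
  foldr (fun a b => BinNat.N.mul (BinNat.N.of_nat a) b) (BinNat.N.of_nat 1) s.

Lemma prodN_correct (s : seq nat) : BinNat.N.of_nat (foldr muln 1%N s) = prodN s.
Proof. by elim: s => //= a s <-; rewrite N_of_muln. Qed.

Definition thirdN (n : nat) :=
  BinNat.N.div (BinNat.N.sub (BinNat.N.pow (BinNat.N.of_nat 11) (BinNat.N.of_nat n))
    (BinNat.N.of_nat 1)) (BinNat.N.of_nat 3).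

Lemma thirdN_correct n : BinNat.N.of_nat ((11 ^ n - 1) %/ 3) = thirdN n.
Proof. by rewrite N_of_divn Nnat.Nat2N.inj_sub N_of_expn. Qed.

Lemma third8 : prodN primes8 = thirdN 8. Proof. by vm_compute. Qed.
Lemma third10 : prodN primes10 = thirdN 10. Proof. by vm_compute. Qed.

Lemma primes_third (n r : nat) (s : seq nat) : all prime s -> prodN s = thirdN n ->
  prime r -> (r %| (11 ^ n - 1) %/ 3)%N -> r \in s.
Proof.
move=> ps e r_pr rm; apply: prime_dvd_foldr => //.
by rewrite (eq_of_N (prodN_correct s) (etrans (thirdN_correct n) (esym e))).
Qed.

(** X^8 - R8 is X^8 + 6 X^5 + 3 X^2 + 5 X + 8, the minimal polynomial of a suitable
    element. The polynomials in gs8 are X + 1, X^2 + 1 and X^2 + 3 X - 1; the cubic which is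
    removed is (X - 1) (X^2 - 3 X - 1). *)
Definition R8 := [:: 3; 6; 8; 0; 0; 5; 0; 0]%N.
Definition gs8 := [:: [:: 1; 1]; [:: 1; 0; 1]; [:: 10; 3; 1]]%N.

(** All tenth roots of unity lie in the prime field. Those in gs10 are 1, ..., 7, and the
    cubic which is removed has the roots 8, 9 and 10. *)
Definition R10 := [:: 3; 0; 1; 8; 10; 9; 0; 0; 5; 2]%N.
Definition gs10 := [seq [:: 11 - i; 1]%N | i <- iota 1 7].

Lemma explicit_ok8 : explicit_ok 8 R8 gs8 primes8. Proof. by vm_compute. Qed.
Lemma explicit_ok10 : explicit_ok 10 R10 gs10 primes10. Proof. by vm_compute. Qed.

Section Eleven.

Variables (F : finFieldType) (L : fieldExtType F).
Hypothesis q11 : #|F| = 11%N.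
Local Notation goal := (exists a : L, r_primitive 3 a /\ k_normal 3 a).

Let pF : 11%N \in [pchar F].
Proof. by apply: (@card_finPcharP F 11 1); rewrite ?q11. Qed.

Let F11 : 11%:R = 0 :> F. Proof. exact: pcharf0 pF. Qed.
Let P11 : 11%:R = 0 :> {poly F}. Proof. by rewrite -(rmorph_nat (@polyC F)) F11 rmorph0. Qed.

Lemma evl_Poly (g : seq nat) : evl 'X g = Poly [seq c%:R | c <- g] :> {poly F}.
Proof.
elim: g => //= c g ->; rewrite cons_poly_def addrC mulrC.
by rewrite -(rmorph_nat (@polyC F)).
Qed.

Lemma size_evl (g : seq nat) : size (evl 'X (rcons g 1%N) : {poly F}) = (size g).+1.
Proof.
by rewrite evl_Poly (@PolyK _ 0) ?size_map ?size_rcons // map_rcons last_rcons oner_neq0.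
Qed.

Lemma horner_evl (g : seq nat) (y : F) : (evl 'X g).[y] = evl y g.
Proof.
elim: g => [|c g IH] /=; first by rewrite horner0.
by rewrite hornerD hornerM hornerX IH -(rmorph_nat (@polyC F)) hornerC.
Qed.

Lemma natr_inj11 (i j : nat) : (i < 11)%N -> (j < 11)%N -> i%:R = j%:R :> F -> i = j.
Proof.
wlog ij : i j / (i <= j)%N.
  by move=> W; have [/W//|/ltnW/W {}W i11 j11 e] := leqP i j; apply/esym/W.
move=> i11 j11 /esym/eqP; rewrite -subr_eq0 -natrB // -(dvdn_pcharf pF) => d.
have [lt_ij|lt|//] := ltngtP i j; last by move: ij lt; clear; lia.
by have := dvdn_leq _ d; rewrite subn_gt0 lt_ij => /(_ isT); move: j11; clear; lia.
Qed.

Lemma unit_pow10 (y : F) : y != 0 -> y ^+ 10 = 1.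
Proof. by move=> y0; apply: (mulfI y0); rewrite -exprS mulr1 -q11 expf_card. Qed.

Lemma quadratic_irreducible (g : seq nat) : size g = 2%N ->
  (forall y : F, evl y (rcons g 1%N) != 0) -> irreducible_poly (evl 'X (rcons g 1%N) : {poly F}).
Proof.
move=> sg nr; apply: cubic_irreducible; first by rewrite size_evl sg.
by move=> y; rewrite rootE horner_evl.
Qed.

Lemma evl_XsubC (c d : nat) : (c + d = 11)%N ->
  evl 'X [:: c; 1]%N = 'X - d%:R%:P :> {poly F}.
Proof.
move=> cd; rewrite /= mulr0 addr0 mulr1 addrC; congr (_ + _).
apply/eqP; rewrite (rmorph_nat (@polyC F)) -addr_eq0 -natrD cd; exact/eqP.
Qed.

(** The order of y divides 8, and also 10 since y is a nonzero element of F. *)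
Lemma eight_ten (y : F) : y ^+ 8 = 1 -> y ^+ 2 = 1.
Proof.
move=> y8; have y0 : y != 0.
  by apply: contra_eq_neq y8 => ->; rewrite expr0n eq_sym oner_neq0.
by have := unit_pow10 y0; rewrite -[10%N]/(8 + 2)%N exprD y8 mul1r.
Qed.

Lemma case_eight : \dim {:L} = 8%N -> (3 %| 11 ^ 8 - 1)%N -> goal.
Proof.
move=> dimL M3.
apply: (@explicit_witness F L q11 8 R8 dimL isT isT gs8 (evl 'X [:: 1; 2; 7; 1]%N) primes8
  isT M3 (fun r => @primes_third 8 r primes8 primes8_prime third8) _ _ _ explicit_ok8).
- rewrite /gs8 !big_cons big_nil /=.
  (* The difference of both sides is a multiple of 11; the cofactor was computed by
     expanding over the integers. *)
  have -> : (1%:R + 'X * (2%:R + 'X * (7%:R + 'X * (1%:R + 'X * 0)))) *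
      ((1%:R + 'X * (1%:R + 'X * 0)) * ((1%:R + 'X * (0%:R + 'X * (1%:R + 'X * 0))) *
      ((10%:R + 'X * (3%:R + 'X * (1%:R + 'X * 0))) * 1))) = 'X^8 - 1 + 11%:R *
      (1 + 3%:R * 'X + 10%:R * 'X^2 + 13%:R * 'X^3 + 13%:R * 'X^4 + 11%:R * 'X^5
       + 4%:R * 'X^6 + 'X^7) :> {poly F} by ring.
  by rewrite P11 mul0r addr0.
- exact: (size_evl [:: 1; 2; 7]%N).
move=> g; clear M3; rewrite !inE => /or3P[] /eqP->.
- by rewrite (@evl_XsubC 1 10) //; exact: irredp_XsubC.
- apply: (@quadratic_irreducible [:: 1; 0]%N) => // y; apply/eqP => /= e.
  have y2 : y ^+ 2 = -1 by rewrite -[RHS]addr0 -e; ring.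
  have y8 : y ^+ 8 = 1 by rewrite (_ : y ^+ 8 = (y ^+ 2) ^+ 4); [rewrite y2|]; ring.
  have := eight_ten y8; rewrite y2 => /eqP; rewrite eq_sym -addr_eq0 -(natrD _ 1 1).
  by move/eqP/(natr_inj11 (i := 2) (j := 0) isT isT).
apply: (@quadratic_irreducible [:: 10; 3]%N) => // y; apply/eqP => /= e.
(* (X^2 + 3 X - 1) (X^2 - 3 X - 1) = X^4 + 1 modulo 11. *)
have y4 : y ^+ 4 = -1.
  have -> : y ^+ 4 = (10%:R + y * (3%:R + y * (1 + y * 0))) * (y ^+ 2 - 3%:R * y - 1)
    - 1 + 11%:R * (1 + 3%:R * y) by ring.
  by rewrite e F11; ring.
have y8 : y ^+ 8 = 1 by rewrite (_ : y ^+ 8 = (y ^+ 4) ^+ 2); [rewrite y4|]; ring.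
have y2 := eight_ten y8.
have := y4; rewrite (_ : y ^+ 4 = (y ^+ 2) ^+ 2); last by ring.
rewrite y2 expr1n => /eqP; rewrite -addr_eq0 -(natrD _ 1 1).
by move/eqP/(natr_inj11 (i := 2) (j := 0) isT isT).
Qed.

Lemma case_ten : \dim {:L} = 10%N -> (3 %| 11 ^ 10 - 1)%N -> goal.
Proof.
move=> dimL M3.
apply: (@explicit_witness F L q11 10 R10 dimL isT isT gs10
  (\prod_(i <- iota 8 3) ('X - i%:R%:P)) primes10
  isT M3 (fun r => @primes_third 10 r primes10 primes10_prime third10) _ _ _ explicit_ok10).
- clear M3; have -> : \prod_(g <- gs10) evl 'X g = \prod_(i <- iota 1 7) ('X - i%:R%:P) :> {poly F}.
    rewrite /gs10 big_map; apply: eq_big_seq => i; rewrite mem_iota => /andP[_ i8].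
    by apply: evl_XsubC; rewrite subnK // ltnW // (leq_trans i8).
  rewrite mulrC -big_cat /= -(big_map (fun i => i%:R : F) predT (fun z => 'X - z%:P)).
  set rs := map _ _.
  have -> : 'X^10 - 1 = 1 *: \prod_(z <- rs) ('X - z%:P) :> {poly F}; last by rewrite scale1r.
  have s11 : size ('X^10 - 1 : {poly F}) = 11%N by rewrite size_Xn_sub_1.
  have <- : lead_coef ('X^10 - 1 : {poly F}) = 1.
    exact/monicP/monic_Xn_sub_1.
  apply: all_roots_prod_XsubC; first by rewrite s11.
  + apply/allP => _ /mapP[i ilt ->]; rewrite rootE !hornerE unit_pow10 ?subrr //.
    apply/negP => /eqP /(natr_inj11 (j := 0) _ isT) i0.
    by move: ilt i0; rewrite -[_ :: _]/(iota 1 10) mem_iota => /andP[i1 i2] /(_ i2) i0; rewrite i0 in i1.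
  rewrite uniq_rootsE map_inj_in_uniq // => i j.
  rewrite -[_ :: _]/(iota 1 10) !mem_iota => /andP[_ i2] /andP[_ j2].
  exact: natr_inj11.
- by rewrite -(big_map (fun i => i%:R : F) predT (fun z => 'X - z%:P)) size_prod_XsubC.
clear M3; move=> _ /mapP[i ilt ->]; rewrite (@evl_XsubC _ i); first exact: irredp_XsubC.
by move: ilt; rewrite mem_iota => /andP[_ i8]; rewrite subnK // ltnW // (leq_trans i8).
Qed.

End Eleven.

(** * All degrees and all powers of 11 *)

Theorem corollary4p3 (n s q : nat) (F : finFieldType) (L : fieldExtType F)
    (hn : (7 <= n)%N) (hs : (0 < s)%N) (hq : q = (11 ^ s)%N)
    (hF : #|F| = q) (hL : \dim {:L} = n)
    (h3 : (3 %| q ^ n - 1)%N)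
    (hfactor : exists p : {poly F}, size p = 4%N /\ p %| 'X^n - 1) :
  exists a : L, r_primitive 3 a /\ k_normal 3 a.
Proof.
rewrite -hF in h3; rewrite hq in hF; rewrite -hL in hn h3 hfactor *.
have [|general] := boolP ((s, \dim {:L}) \in [:: (1, 8); (1, 10)]%N).
  rewrite !inE => /orP[] /eqP[s1 dimL]; rewrite s1 expn1 in hF; rewrite hF dimL in h3.
    exact: case_eight hF dimL h3.
  exact: case_ten hF dimL h3.
exact: all_but_two hF hs hn h3 hfactor general.
Qed.
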